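(* Let $d\ge 2$, let $C\subset\mathbb R^d$ be a closed convex cone that is pointed (contains no line) and has non-empty interior, and let $\mathbf k\in \mathbb Z^d\cap\operatorname{Int} C$. Then there is a convex set $T_0=T_0(C,\mathbf k)\subset\mathbb R^d$ such that for every $\varepsilon>0$, $$\lim_{n\to\infty}\frac{\operatorname{card}\{T\in\mathcal T(C,n\mathbf k)\;:\;\operatorname{dist}(\tfrac1n T,T_0)>\varepsilon\}}{p(C,n\mathbf k)}=0,$$ where $n$ ranges over the positive integers.
   Context: An integral zonotope in $C$ is a set of the form $T=\{\sum_{i=1}^m\alpha_i\mathbf v_i : (\alpha_1,\dots,\alpha_m)\in[0,1]^m\}$ with $m\in\mathbb N$ and $\mathbf v_1,\dots,\mathbf v_m\in\mathbb Z^d\cap C$; its endpoint is $\sum_{i=1}^m\mathbf v_i$. For $\mathbf m\in\mathbb Z^d\cap\operatorname{Int}C$, $\mathcal T(C,\mathbf m)$ denotes the (finite) family of all integral zonotopes in $C$ (as sets; different generating multisets giving the same set are counted once) whose endpoint is $\mathbf m$, and $p(C,\mathbf m)=\operatorname{card}\mathcal T(C,\mathbf m)$. $\operatorname{dist}(A,B)$ is the Hausdorff distance of the (non-empty) sets $A,B\subset\mathbb R^d$, with values in $[0,\infty]$. *)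

(* Defs.v *)
From HB Require Import structures.
From mathcomp Require Import all_boot all_order all_algebra finmap.
From mathcomp Require Import all_classical all_reals all_analysis.

Set Implicit Arguments.
Unset Strict Implicit.
Unset Printing Implicit Defensive.

Import Order.TTheory GRing.Theory Num.Theory.
Import numFieldNormedType.Exports.

Local Open Scope classical_set_scope.
Local Open Scope ring_scope.

Section Cones.
Context {R : realType} {d : nat}.
Implicit Types C : set 'rV[R]_d.

Definition is_cone C := forall (t : R) x, 0 <= t -> C x -> C (t *: x).

Definition contains_line C :=
  exists x v : 'rV[R]_d, v != 0 /\ forall t : R, C (x + t *: v).

Definition pointed C := ~ contains_line C.

Definition convex_cone C := is_cone C /\ convex_set C.

End Cones.

Section HausdorffDistance.
Context {R : realType} {d : nat}.
Implicit Types (x y : 'rV[R]_d) (A B : set 'rV[R]_d).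

(* The canonical norm on 'rV[R]_d is the sup norm, hence this definition. *)
Definition eucl_norm x : R := Num.sqrt (\sum_(i < d) x 0 i ^+ 2).

Definition excess A B : \bar R :=
  ereal_sup [set ereal_inf [set (eucl_norm (x - y))%:E | y in B] | x in A].

Definition hausdorff_dist A B : \bar R := Order.max (excess A B) (excess B A).

End HausdorffDistance.

Section Zonotopes.
Context {R : realType} {d : nat}.
Implicit Types (C T : set 'rV[R]_d) (x : 'rV[R]_d).

Definition integral_vector x : Prop := x \is a mxOver Num.int.

Definition zonotope (m : nat) (v : 'I_m -> 'rV[R]_d) : set 'rV[R]_d :=
  [set x | exists a : 'I_m -> R,
    (forall i, 0 <= a i <= 1) /\ x = \sum_(i < m) a i *: v i].

(* Members are sets, so generating families that yield the same set are
   identified. *)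
Definition zonotopes C (p : 'rV[R]_d) : set (set 'rV[R]_d) :=
  [set T | exists (m : nat) (v : 'I_m -> 'rV[R]_d),
    [/\ forall i, integral_vector (v i) /\ C (v i),
        T = zonotope v
      & \sum_(i < m) v i = p]].

End Zonotopes.

(* fset_set is fset0 on infinite sets, so this is the cardinal only of finite
   sets; zonotopes C p is finite when C is a pointed closed convex cone. *)
Definition finite_card {T : choiceType} (A : set T) : nat := #|` fset_set A|.

Definition num_zonotopes {R : realType} {d : nat} (C : set 'rV[R]_d)
  (p : 'rV[R]_d) : nat := finite_card (zonotopes C p).

(* Main.v *)
(* Every integral zonotope in C is the Minkowski sum of segments [0, w_p p] over the
   primitive vectors p of C, for a unique finitely supported family w of naturals: its
   support function sum_p w_p max(0, <u, p>) has its kinks on distinct hyperplanes.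
   Let the w_p be independent geometric variables, w having weight exp(-<a, X(w)>/t),
   where X(w) = sum_p w_p p. This weight depends on the endpoint only, hence it is uniform
   on the zonotopes with a given endpoint.

   Comparing scales shows that t^-d sum_(v in C) f(v/t) converges for f = exp(-phi), phi
   homogeneous and Lipschitz; differentiating in phi yields the moments m(g), the
   integrals of g exp(-<a, .>) over C for g homogeneous and Lipschitz. The functional
   a |-> I(a) + <a, k>, I(a) the limit for phi = <a, .>, has a minimizer, and
   stationarity says that m(<b, .>) = <b, k> for all b. A contraction argument gives the
   analogous limits over primitive vectors, and a Chernoff bound shows that
   g(w) = sum_p w_p g(p) is within del t^(d+1) of kappa m(g) t^(d+1) outside a set of
   relative weight exp(-c t^d).

   Finitely many functions g, forming a partition of <a, .> into parts concentrated near
   directions th_i, control the Hausdorff distance to the limit zonoid. For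
   n = (1 + e) kappa t^(d+1) the bad zonotopes with endpoint nk number at most
   exp(n<a, k>/t - c t^d) Z, Z being the total weight, while padding typical
   configurations by one generator shows that the number of all zonotopes is at least
   exp(n<a, k>/t - O(e) t^d) Z up to a power of t; e small finishes the proof. *)
Require Import Defs.
From mathcomp Require Import all_boot all_order all_algebra finmap.
From mathcomp Require Import all_classical all_reals all_analysis.
From mathcomp Require Import ring lra zify.
Import Order.TTheory GRing.Theory Num.Theory.
Import numFieldNormedType.Exports.
Local Open Scope classical_set_scope.
Local Open Scope ring_scope.

Set Implicit Arguments.
Unset Strict Implicit.
Unset Printing Implicit Defensive.

(** Two obstacles shape the proof. Counting the zonotopes with endpoint [n k] precisely would call
    for a local limit theorem. None is needed, because an error [exp (e t^d)] in the count is
    harmless against the rarity of bad configurations: the law is centred at [kappa t^(d+1) k],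
    slightly short of [n k], and the missing vector, close to [e kappa t^(d+1) k], is interior to
    the cone and can serve as a generator. Stationarity is what makes the mean endpoint point along
    [k]. The second obstacle is that the scale comparison yields limits for exponentials
    [exp (- phi)] only; a moment is a derivative of such limits, and it exists because the Taylor
    remainder is bounded uniformly in [t]. No integral over [C] is taken: each constant is a limit
    of lattice sums. Total weights are finite sums, over a finite set [V] of primitive vectors with
    multiplicities at most [B], and the deviation bounds are uniform in [V] and [B]. The constant
    [kappa] is [zeta(d+1) / zeta(d)]: the denominator comes from the passage to primitive vectors,
    the numerator from expanding the mean of a geometric variable. *)

(** * Unordered sums of real families *)

Section UnorderedSums.
Context {R : realType} {T : choiceType}.
Implicit Types (f g : T -> R) (F G : {fset T}).

Definition tsummable f := exists M, forall F, \sum_(i <- F) `|f i| <= M.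

(* Meaningful for nonnegative tsummable families only. *)
Definition psum f : R := sup [set \sum_(i <- F) f i | F in [set: {fset T}]].

Definition tsum f : R :=
  psum (fun i => Num.max (f i) 0) - psum (fun i => Num.max (- f i) 0).

Lemma tsummable_le f g : (forall i, `|f i| <= g i) -> tsummable g -> tsummable f.
Proof.
move=> fg [M gM]; exists M => F; apply: le_trans (gM F).
by apply: ler_sum => i _; apply: le_trans (fg i) _; apply: ler_norm.
Qed.

Lemma tsummableD f g : tsummable f -> tsummable g -> tsummable (fun i => f i + g i).
Proof.
move=> [M fM] [N gN]; exists (M + N) => F.
apply: le_trans (lerD (fM F) (gN F)); rewrite -big_split.
by apply: ler_sum => i _; exact: ler_normD.
Qed.

Lemma tsummableZ a f : tsummable f -> tsummable (fun i => a * f i).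
Proof.
move=> [M fM]; exists (`|a| * M) => F.
under eq_bigr do rewrite normrM.
by rewrite -mulr_sumr ler_wpM2l.
Qed.

Lemma tsummableN f : tsummable f -> tsummable (fun i => - f i).
Proof. by move=> [M fM]; exists M => F; under eq_bigr do rewrite normrN. Qed.

Lemma tsummable_pos f : tsummable f -> tsummable (fun i => Num.max (f i) 0).
Proof.
move=> [M fM]; exists M => F; apply: le_trans (fM F); apply: ler_sum => i _.
by have [] := leP (f i) 0; rewrite ?normr0.
Qed.

Lemma nneg_sum_subset f F G : (forall i, 0 <= f i) -> (F `<=` G)%fset ->
  \sum_(i <- F) f i <= \sum_(i <- G) f i.
Proof.
move=> f0 FG; rewrite [leRHS](bigID (mem F)) /=.
have -> : \sum_(i <- G | i \in F) f i = \sum_(i <- F) f i.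
  rewrite -big_filter; apply: perm_big; apply: uniq_perm => //.
    by rewrite filter_uniq.
  by move=> i; rewrite mem_filter andb_idr // => /(fsubsetP FG).
by rewrite lerDl sumr_ge0.
Qed.

Lemma has_sup_psum f : (forall i, 0 <= f i) -> tsummable f ->
  has_sup [set \sum_(i <- F) f i | F in [set: {fset T}]].
Proof.
move=> f0 [M fM]; split; first by exists (\sum_(i <- fset0) f i); exists fset0.
exists M => _ [F _ <-]; apply: le_trans (fM F).
by apply: ler_sum => i _; exact: ler_norm.
Qed.

Lemma psum_ge f F : (forall i, 0 <= f i) -> tsummable f ->
  \sum_(i <- F) f i <= psum f.
Proof.
by move=> f0 sf; apply: (ub_le_sup (has_sup_psum f0 sf).2); exists F.
Qed.

Lemma psum_le f M : (forall F, \sum_(i <- F) f i <= M) -> psum f <= M.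
Proof.
move=> fM; apply: ge_sup; last by move=> _ [F _ <-].
by exists (\sum_(i <- fset0) f i); exists fset0.
Qed.

Lemma psum_approx f e : (forall i, 0 <= f i) -> tsummable f -> 0 < e ->
  exists F, psum f - e < \sum_(i <- F) f i.
Proof.
move=> f0 sf e0; have [_ [F _ <-] H] := sup_adherent e0 (has_sup_psum f0 sf).
by exists F.
Qed.

Lemma psumD f g : (forall i, 0 <= f i) -> (forall i, 0 <= g i) ->
  tsummable f -> tsummable g -> psum (fun i => f i + g i) = psum f + psum g.
Proof.
move=> f0 g0 sf sg; apply/eqP; rewrite eq_le; apply/andP; split.
  apply: psum_le => F; rewrite big_split /=.
  by apply: lerD; apply: psum_ge.
apply/ler_addgt0Pr => e e0.
have e2 : 0 < e / 2 by rewrite divr_gt0.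
have [F FP] := psum_approx f0 sf e2; have [G GP] := psum_approx g0 sg e2.
have fg0 i : 0 <= f i + g i by rewrite addr_ge0.
have := psum_ge (F `|` G)%fset fg0 (tsummableD sf sg); rewrite big_split /=.
have := nneg_sum_subset f0 (fsubsetUl F G).
have := nneg_sum_subset g0 (fsubsetUr F G).
lra.
Qed.

Lemma eq_psum f g : f =1 g -> psum f = psum g.
Proof. by move=> /funext ->. Qed.

Lemma psum0 : psum (fun=> 0) = 0.
Proof.
have z0 (i : T) : 0 <= (0 : R) by [].
apply/eqP; rewrite eq_le psum_le ?andTb => [|F]; last by rewrite big1.
have := @psum_ge (fun=> 0) fset0 z0; rewrite big_seq_fset0; apply.
by exists 0 => F; rewrite big1 // => i _; rewrite normr0.
Qed.

Lemma psumZ a f : 0 <= a -> (forall i, 0 <= f i) -> tsummable f ->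
  psum (fun i => a * f i) = a * psum f.
Proof.
move=> a0 f0 sf; apply/eqP; rewrite eq_le; apply/andP; split.
  by apply: psum_le => F; rewrite -mulr_sumr ler_wpM2l // psum_ge.
have [->|a_neq0] := eqVneq a 0.
  by rewrite mul0r (eq_psum (g := fun=> 0)) ?psum0 // => i; rewrite mul0r.
have {a_neq0}a0 : 0 < a by rewrite lt_def a_neq0.
rewrite mulrC -ler_pdivlMr //; apply: psum_le => F.
rewrite ler_pdivlMr // mulrC mulr_sumr; apply: psum_ge; last exact: tsummableZ.
by move=> i; rewrite mulr_ge0 // ltW.
Qed.

Lemma eq_tsum f g : f =1 g -> tsum f = tsum g.
Proof. by move=> /funext ->. Qed.

Lemma tsum_nneg f : (forall i, 0 <= f i) -> tsum f = psum f.
Proof.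
move=> f0; rewrite /tsum (_ : psum (fun i => Num.max (- f i) 0) = 0) ?subr0.
  by apply: eq_psum => i; rewrite max_l.
rewrite (@eq_psum _ (fun=> 0)) ?psum0 // => i.
by rewrite max_r // oppr_le0.
Qed.

Let posp f i := Num.max (f i) 0.

Let posp_ge0 f i : 0 <= posp f i.
Proof. by rewrite /posp le_max lexx orbT. Qed.

(** Adding negative parts on both sides turns the claim into the pointwise identity [(f+g)^+ + f^- +
    g^- = (f+g)^- + f^+ + g^+] between nonnegative families, where [psumD] applies. *)
Lemma tsumD f g : tsummable f -> tsummable g ->
  tsum (fun i => f i + g i) = tsum f + tsum g.
Proof.
move=> sf sg; have sfg := tsummableD sf sg.
have [sf' sg' sfg'] := And3 (tsummableN sf) (tsummableN sg) (tsummableN sfg).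
have s h : tsummable h -> tsummable (posp h) by exact: tsummable_pos.
have posD h1 h2 i : 0 <= posp h1 i + posp h2 i by rewrite addr_ge0.
suff : psum (fun i => posp (fun i => f i + g i) i
         + (posp (fun i => - f i) i + posp (fun i => - g i) i))
     = psum (fun i => posp (fun i => - (f i + g i)) i
         + (posp f i + posp g i)).
  rewrite !psumD //; try by [exact: s|apply: tsummableD; exact: s].
  by rewrite /tsum -/(posp _) -/(posp f) -/(posp g) /posp; lra.
apply: eq_psum => i; rewrite /posp.
by case: (leP (f i + g i) 0); case: (leP (- (f i + g i)) 0); case: (leP (f i) 0);
  case: (leP (g i) 0); case: (leP (- f i) 0); case: (leP (- g i) 0); lra.
Qed.

Lemma tsumN f : tsum (fun i => - f i) = - tsum f.
Proof. by rewrite /tsum opprB; congr (_ - _); apply: eq_psum => i; rewrite opprK. Qed.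

Lemma tsumB f g : tsummable f -> tsummable g ->
  tsum (fun i => f i - g i) = tsum f - tsum g.
Proof. by move=> sf sg; rewrite tsumD ?tsumN //; exact: tsummableN. Qed.

Lemma tsumZ a f : tsummable f -> tsum (fun i => a * f i) = a * tsum f.
Proof.
wlog a0 : a f / 0 <= a => [H sf|sf].
  have [a0|a0] := leP 0 a; first exact: H.
  rewrite -[a]opprK mulNr -H ?oppr_ge0 1?ltW // -tsumN.
  by apply: eq_tsum => i; rewrite mulNr.
have sf' := tsummableN sf.
rewrite /tsum mulrBr -!psumZ //; try exact: tsummable_pos.
  congr (_ - _); apply: eq_psum => i; rewrite ?mulNr -?mulrN.
    by rewrite maxr_pMr // mulr0.
  by rewrite maxr_pMr // mulr0.
- exact: (posp_ge0 (fun i => - f i)).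
- exact: posp_ge0.
Qed.

Lemma tsum_ge0 f : (forall i, 0 <= f i) -> 0 <= tsum f.
Proof.
move=> f0; rewrite tsum_nneg // /psum; set E := [set _ | _ in _].
have [hs|hs] := pselect (has_sup E); last by rewrite sup_out.
by apply: (ub_le_sup hs.2); exists fset0 => //; rewrite big_seq_fset0.
Qed.

Lemma le_tsum f g : tsummable f -> tsummable g -> (forall i, f i <= g i) ->
  tsum f <= tsum g.
Proof.
move=> sf sg fg; rewrite -subr_ge0 -tsumB //.
by apply: tsum_ge0 => i; rewrite subr_ge0.
Qed.

Lemma tsummable_norm f : tsummable f -> tsummable (fun i => `|f i|).
Proof. by move=> [M fM]; exists M => F; under eq_bigr do rewrite normr_id. Qed.

Lemma ler_norm_tsum f : tsummable f -> `|tsum f| <= tsum (fun i => `|f i|).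
Proof.
move=> sf; have sn := tsummable_norm sf.
rewrite ler_norml lerNl -tsumN; apply/andP; split; apply: le_tsum => //.
- exact: tsummableN.
- by move=> i; rewrite -normrN ler_norm.
- by move=> i; exact: ler_norm.
Qed.

Lemma sum_le_tsum f F : (forall i, 0 <= f i) -> tsummable f ->
  \sum_(i <- F) f i <= tsum f.
Proof. by move=> f0 sf; rewrite tsum_nneg // psum_ge. Qed.

Lemma tsum_le f M : (forall i, 0 <= f i) -> (forall F, \sum_(i <- F) f i <= M) ->
  tsum f <= M.
Proof. by move=> f0 fM; rewrite tsum_nneg // psum_le. Qed.

Lemma tsummable_nneg f M : (forall i, 0 <= f i) ->
  (forall F, \sum_(i <- F) f i <= M) -> tsummable f.
Proof. by move=> f0 fM; exists M => F; rewrite (eq_bigr f) // => i _; rewrite ger0_norm. Qed.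

Lemma tsum_approx f e : (forall i, 0 <= f i) -> tsummable f -> 0 < e ->
  exists F, tsum f - e < \sum_(i <- F) f i.
Proof. by move=> f0; rewrite tsum_nneg //; exact: psum_approx. Qed.

Lemma term_le_tsum f i : (forall i, 0 <= f i) -> tsummable f -> f i <= tsum f.
Proof.
by move=> f0 sf; have := sum_le_tsum [fset i]%fset f0 sf; rewrite big_seq_fset1.
Qed.

Lemma tsum0 : tsum (fun=> 0) = 0.
Proof. by rewrite tsum_nneg // psum0. Qed.

Lemma tsum_sum (I : Type) (s : seq I) (h : I -> T -> R) :
  (forall a, tsummable (h a)) ->
  tsummable (fun i => \sum_(a <- s) h a i) /\
  tsum (fun i => \sum_(a <- s) h a i) = \sum_(a <- s) tsum (h a).
Proof.
move=> sh; elim: s => [|a s [IH1 IH2]].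
  under eq_fun do rewrite big_nil.
  rewrite big_nil tsum0; split=> //.
  by exists 0 => F; rewrite big1 // => i _; rewrite normr0.
under eq_fun do rewrite big_cons.
by rewrite big_cons tsumD ?IH2 //; split => //; exact: tsummableD.
Qed.

End UnorderedSums.

Section IteratedSums.
Context {R : realType} {T U : choiceType}.

Lemma sum_fset_pair (A : {fset T}) (B : {fset U}) (f : T -> U -> R) :
  \sum_(i <- A) \sum_(j <- B) f i j
  = \sum_(p <- [fset q in [seq (i, j) | i <- A, j <- B]]%fset) f p.1 p.2.
Proof.
set G := [fset _ in _]%fset.
have GP : perm_eq G [seq (i, j) | i <- A, j <- B].
  apply: uniq_perm => //; last by move=> p; rewrite !inE.
  by apply: allpairs_uniq => // -[? ?] [? ?].
by rewrite (perm_big _ GP) /= big_allpairs.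
Qed.

(** Tonelli for nonnegative families. A finite set of pairs lies in the product of its two
    projections, which bounds the double sum; conversely a finite sum of row sums is approached by
    sums over finite rectangles. *)
Lemma tsum_pair (f : T -> U -> R) : (forall i j, 0 <= f i j) ->
  (forall i, tsummable (f i)) -> tsummable (fun i => tsum (f i)) ->
  tsummable (fun p => f p.1 p.2) /\
  tsum (fun p => f p.1 p.2) = tsum (fun i => tsum (f i)).
Proof.
move=> f0 sf ssf.
have f0' p : 0 <= f p.1 p.2 by [].
have t0 i : 0 <= tsum (f i) by exact: tsum_ge0.
have bnd (F : {fset T * U}) : \sum_(p <- F) f p.1 p.2 <= tsum (fun i => tsum (f i)).
  pose A := [fset p.1 | p in F]%fset; pose B := [fset p.2 | p in F]%fset.
  apply: (@le_trans _ _ (\sum_(i <- A) \sum_(j <- B) f i j)).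
    rewrite sum_fset_pair; apply: nneg_sum_subset => //.
    apply/fsubsetP => -[i j] ijF; rewrite !inE /=; apply/allpairsP.
    exists (i, j) => /=; split=> //; apply/imfsetP; by exists (i, j).
  apply: le_trans (sum_le_tsum A t0 ssf); apply: ler_sum => i _.
  exact: sum_le_tsum.
have sp : tsummable (fun p => f p.1 p.2) by apply: tsummable_nneg bnd.
split => //; apply/eqP; rewrite eq_le tsum_le //=.
apply: tsum_le => // F.
rewrite -(tsum_sum F sf).2; apply: tsum_le => [j|G]; first by rewrite sumr_ge0.
by rewrite exchange_big /= sum_fset_pair; exact: sum_le_tsum.
Qed.

End IteratedSums.

(** * Scalar product and l1 norm *)

Section Vectors.
Context {R : realType} {d : nat}.
Implicit Types (x y z a b : 'rV[R]_d).

Definition dot a x : R := \sum_(j < d) a 0 j * x 0 j.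
(** The l1 norm: it dominates the Euclidean norm, and [expR (- c * nrm x)] is a product over the
    coordinates. *)
Definition nrm x : R := \sum_(j < d) `|x 0 j|.

Lemma dotC a x : dot a x = dot x a.
Proof. by apply: eq_bigr => j _; rewrite mulrC. Qed.

Lemma dotDr a x y : dot a (x + y) = dot a x + dot a y.
Proof. by rewrite /dot -big_split; apply: eq_bigr => j _; rewrite !mxE mulrDr. Qed.

Lemma dotZr a s x : dot a (s *: x) = s * dot a x.
Proof. by rewrite /dot mulr_sumr; apply: eq_bigr => j _; rewrite !mxE mulrCA. Qed.

Lemma dot0r a : dot a 0 = 0.
Proof. by rewrite /dot big1 // => j _; rewrite mxE mulr0. Qed.

Lemma dotNr a x : dot a (- x) = - dot a x.
Proof. by rewrite -scaleN1r dotZr mulN1r. Qed.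

Lemma dotBr a x y : dot a (x - y) = dot a x - dot a y.
Proof. by rewrite dotDr dotNr. Qed.

Lemma dotDl a b x : dot (a + b) x = dot a x + dot b x.
Proof. by rewrite ![dot _ x]dotC dotDr. Qed.

Lemma dotZl a s x : dot (s *: a) x = s * dot a x.
Proof. by rewrite ![dot _ x]dotC dotZr. Qed.

Lemma dotBl a b x : dot (a - b) x = dot a x - dot b x.
Proof. by rewrite ![dot _ x]dotC dotBr. Qed.

Lemma dot_sumr a (I : Type) (s : seq I) (P : pred I) (F : I -> 'rV[R]_d) :
  dot a (\sum_(i <- s | P i) F i) = \sum_(i <- s | P i) dot a (F i).
Proof.
elim/big_rec2: _ => [|i u v _ <-]; first exact: dot0r.
by rewrite dotDr.
Qed.

Lemma dot_suml (I : Type) (s : seq I) (P : pred I) (F : I -> 'rV[R]_d) x :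
  dot (\sum_(i <- s | P i) F i) x = \sum_(i <- s | P i) dot (F i) x.
Proof. by rewrite dotC dot_sumr; apply: eq_bigr => i _; rewrite dotC. Qed.

Lemma dotxx_ge0 x : 0 <= dot x x.
Proof. by apply: sumr_ge0 => j _; rewrite -expr2 sqr_ge0. Qed.

Lemma dotxx_eq0 x : dot x x = 0 -> x = 0.
Proof.
move=> /eqP; rewrite psumr_eq0 => [/allP xx|j _]; last by rewrite -expr2 sqr_ge0.
apply/rowP => j; rewrite mxE; apply/eqP.
by have := xx j; rewrite mem_index_enum mulf_eq0 orbb; apply.
Qed.

Lemma dot_sqD b s x :
  dot (b + s *: x) (b + s *: x) = dot b b + 2 * s * dot b x + s ^+ 2 * dot x x.
Proof. by rewrite !dotDl !dotDr !dotZl !dotZr (dotC x b); ring. Qed.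

Lemma nrm_ge0 x : 0 <= nrm x.
Proof. exact: sumr_ge0. Qed.

Lemma nrm_eq0 x : nrm x = 0 -> x = 0.
Proof.
move=> /eqP; rewrite psumr_eq0 // => /allP xx.
apply/rowP => j; rewrite mxE; apply/eqP; rewrite -normr_eq0.
by have := xx j; rewrite mem_index_enum; apply.
Qed.

Lemma nrm0 : nrm 0 = 0.
Proof. by rewrite /nrm big1 // => j _; rewrite mxE normr0. Qed.

Lemma nrm_gt0 x : x != 0 -> 0 < nrm x.
Proof.
by move=> x0; rewrite lt_def nrm_ge0 andbT; apply: contra x0 => /eqP/nrm_eq0 ->.
Qed.

Lemma nrmD x y : nrm (x + y) <= nrm x + nrm y.
Proof. by rewrite /nrm -big_split; apply: ler_sum => j _; rewrite mxE ler_normD. Qed.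

Lemma nrmZ s x : nrm (s *: x) = `|s| * nrm x.
Proof. by rewrite /nrm mulr_sumr; apply: eq_bigr => j _; rewrite mxE normrM. Qed.

Lemma nrmN x : nrm (- x) = nrm x.
Proof. by apply: eq_bigr => j _; rewrite mxE normrN. Qed.

Lemma nrm_distC x y : nrm (x - y) = nrm (y - x).
Proof. by rewrite -nrmN opprB. Qed.

Lemma nrm_sum (I : Type) (s : seq I) (P : pred I) (F : I -> 'rV[R]_d) :
  nrm (\sum_(i <- s | P i) F i) <= \sum_(i <- s | P i) nrm (F i).
Proof.
elim/big_ind2: _ => [|u p v q up vq|//]; first by rewrite nrm0.
by apply: le_trans (nrmD _ _) _; exact: lerD.
Qed.

Lemma coord_le_nrm x j : `|x 0 j| <= nrm x.
Proof. by rewrite /nrm (bigD1 j) //= lerDl sumr_ge0. Qed.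

Lemma dot_le_nrm a x : `|dot a x| <= nrm a * nrm x.
Proof.
apply: le_trans (ler_norm_sum _ _ _) _; rewrite /nrm mulr_suml.
by apply: ler_sum => j _; rewrite normrM ler_wpM2l // coord_le_nrm.
Qed.

Lemma dot_lip a x y : `|dot a x - dot a y| <= nrm a * nrm (x - y).
Proof. by rewrite -dotBr dot_le_nrm. Qed.

Lemma eucl_le_nrm x : eucl_norm x <= nrm x.
Proof.
rewrite /eucl_norm -[leRHS]ger0_norm ?nrm_ge0 // -sqrtr_sqr ler_wsqrtr //.
rewrite expr2 {1}/nrm mulr_suml; apply: ler_sum => j _.
by rewrite -[_ ^+ 2]ger0_norm ?sqr_ge0 // normrX expr2 ler_wpM2l // coord_le_nrm.
Qed.

Lemma continuous_sumr (I : Type) (s : seq I) (F : I -> 'rV[R]_d -> R) :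
  (forall i, continuous (F i)) -> continuous (fun x => \sum_(i <- s) F i x).
Proof.
move=> cF; elim: s => [|i s IH].
  rewrite (_ : (fun x => _) = fun=> 0); last by apply/funext => x; rewrite big_nil.
  exact: cst_continuous.
rewrite (_ : (fun x => _) = (fun x => F i x + \sum_(j <- s) F j x));
  last by apply/funext => x; rewrite big_cons.
by move=> x; exact: (continuousD (cF i x) (IH x)).
Qed.

Lemma coord_cont (j : 'I_d) : continuous (fun x : 'rV[R]_d => x 0 j).
Proof. exact: coord_continuous. Qed.

Lemma dot_continuous a : continuous (dot a).
Proof.
apply: continuous_sumr => j x.
by apply: continuousM; [exact: cst_continuous|exact: (@coord_cont j x)].
Qed.

Lemma nrm_continuous : continuous nrm.
Proof.
apply: continuous_sumr => j x; apply: continuous_comp (@coord_cont j x) _.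
exact: norm_continuous.
Qed.

Lemma sqdist_continuous z : continuous (fun x => dot (x - z) (x - z)).
Proof.
apply: (@continuous_sumr _ _ (fun j x => (x - z) 0 j * (x - z) 0 j)) => j.
pose h (x : 'rV[R]_d) := x 0 j - z 0 j.
rewrite (_ : (fun x => _) = h \* h).
  have ch x : {for x, continuous h}.
    by apply: continuousB; [exact: (@coord_cont j x)|exact: cst_continuous].
  by move=> x; apply: continuousM; exact: ch.
by apply/funext => x; rewrite /= /h !mxE.
Qed.

Lemma closed_bounded_compact (A : set 'rV[R]_d) (M : R) :
  closed A -> (forall x, A x -> nrm x <= M) -> compact A.
Proof.
move=> cA AM; apply: subclosed_compact cA _ _.
  apply: (@rV_compact _ _ (fun=> `[(- M), M]%classic)) => _.
  exact: segment_compact.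
move=> x /AM xM i /=; rewrite in_itv /= -ler_norml.
exact: le_trans (coord_le_nrm _ _) xM.
Qed.

Lemma interior_nrm (A : set 'rV[R]_d) x : A° x ->
  exists2 r : R, 0 < r & forall y, nrm (y - x) <= r -> A y.
Proof.
move=> /nbhs_ballP[e /= e0 eA]; exists (e / 2); first by rewrite divr_gt0.
move=> y yx; apply: eA; split => // i j; rewrite ord1 /ball /=.
rewrite -[_ - _]opprB normrN; apply: (@le_lt_trans _ _ (e / 2)).
  by apply: le_trans yx; have := coord_le_nrm (y - x) j; rewrite !mxE.
by lra.
Qed.

End Vectors.

(** * Closed pointed cones: separation and coercive functionals *)

Section Cone.
Context {R : realType} {d : nat} (C : set 'rV[R]_d).
Hypotheses (C_closed : closed C) (C_cone : convex_cone C) (C_pointed : pointed C).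
Hypothesis C0 : C 0.

Lemma cone_scale s x : 0 <= s -> C x -> C (s *: x).
Proof. by case: C_cone => H _; exact: H. Qed.

Lemma cone_add x y : C x -> C y -> C (x + y).
Proof.
case: C_cone => sc cv Cx Cy.
have h : 0 <= (2^-1 : R) <= 1 by apply/andP; split; lra.
have := cv x y (Itv01 (andP h).1 (andP h).2); rewrite !inE => /(_ Cx Cy).
rewrite /conv /= => H; have := sc 2 _ (ler0n _ 2) H.
congr C; rewrite scalerDr !scalerA /unstable.onem.
have -> : 2 * (1 - 2^-1) = 1 :> R by lra.
by rewrite mulfV ?scale1r // pnatr_eq0.
Qed.

(** Take [b = p - z] with [p] the point of [C] nearest to [z]. Moving from [p] along [x] in [C]
    cannot decrease the distance, so [<b, x> >= 0]; shrinking [p] towards 0 gives [<b, p> <= 0] as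
    well, and then [<b, z> = - <b, b> < 0]. *)
Lemma cone_separation z : ~ C z ->
  exists b, (forall x, C x -> 0 <= dot b x) /\ dot b z < 0.
Proof.
move=> Cz; pose q x := dot (x - z) (x - z).
pose K := C `&` [set x | q x <= dot z z].
have cq := @sqdist_continuous _ _ z.
have K0 : K 0 by split => //=; rewrite /q sub0r dotNr dotC dotNr opprK.
have cK : compact K.
  (* [|u| <= u^2 + 1] bounds each of the [d] coordinates of [x - z] by [dot z z + 1]. *)
  apply: (@closed_bounded_compact _ _ _ (nrm z + d%:R * (dot z z + 1))).
    apply: closedI => //; apply: (@preimage_closed _ _ q [set y | y <= dot z z]).
      by move=> x _; exact: cq.
    exact: closed_le.
  move=> x [_ /= qx]; rewrite -[x](subrK z) addrC.
  apply: le_trans (nrmD _ _) _; rewrite lerD2l.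
  rewrite -[X in X%:R]card_ord -sumr_const mulr_suml.
  apply: ler_sum => j _; rewrite mul1r.
  have : `|(x - z) 0 j| ^+ 2 <= q x.
    rewrite /q /dot (bigD1 j) //= real_normK ?num_real // expr2 lerDl.
    by apply: sumr_ge0 => i _; rewrite -expr2 sqr_ge0.
  have : 0 <= `|(x - z) 0 j| by [].
  by move: (`|_|) qx => u; nra.
have [p /set_mem [Cp _] pmin] := @EVT_min_rV _ _ q K (ex_intro _ _ K0) cK
  (continuous_subspaceT cq).
have {}pmin x : C x -> q p <= q x.
  move=> Cx; have [qx|qx] := leP (q x) (dot z z); first by apply: pmin; apply/mem_set.
  apply: le_trans (ltW qx); have -> : dot z z = q 0.
    by rewrite /q sub0r dotNr dotC dotNr opprK.
  by apply: pmin; apply/mem_set.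
pose b := p - z; have qexp s x : q (p + s *: x) = q p + 2 * s * dot b x + s ^+ 2 * dot x x.
  rewrite /q -/b (_ : p + s *: x - z = b + s *: x); last by rewrite /b addrAC.
  exact: dot_sqD.
have bC x : C x -> 0 <= dot b x.
  move=> Cx; rewrite leNgt; apply/negP => bx.
  have xx : 0 < dot x x + 1 by have := dotxx_ge0 x; lra.
  (* At this [s] the increment [2 s <b, x> + s^2 <x, x>] is negative; the [+ 1] keeps the
     denominator positive. *)
  pose s := - dot b x / (dot x x + 1).
  have s0 : 0 < s by rewrite divr_gt0 // oppr_gt0.
  have := pmin _ (cone_add Cp (cone_scale (ltW s0) Cx)); rewrite qexp.
  have : s * (dot x x + 1) = - dot b x by rewrite /s divfK ?gt_eqF.
  by have := dotxx_ge0 x; nra.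
exists b; split => //.
have bp : dot b p = 0.
  apply/eqP; rewrite eq_le bC // andbT leNgt; apply/negP => bp.
  have pp : 0 < dot p p + dot b p by have := dotxx_ge0 p; lra.
  pose s := dot b p / (dot p p + dot b p).
  have s0 : 0 < s by rewrite divr_gt0.
  have s1 : s <= 1 by rewrite ler_pdivrMr // mul1r; have := dotxx_ge0 p; lra.
  have Cq : C (p + (- s) *: p).
    by rewrite -{1}[p]scale1r -scalerDl; apply: cone_scale => //; lra.
  have := pmin _ Cq; rewrite qexp.
  have : s * (dot p p + dot b p) = dot b p by rewrite /s divfK ?gt_eqF.
  by have := dotxx_ge0 p; nra.
have -> : z = p - b by rewrite /b opprB addrC subrK.
rewrite dotBr bp sub0r oppr_lt0 lt_def dotxx_ge0 andbT.
apply/eqP => /dotxx_eq0; rewrite /b => /eqP; rewrite subr_eq0 => /eqP pz.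
by apply: Cz; rewrite -pz.
Qed.

Let K := C `&` [set x : 'rV[R]_d | nrm x = 1].

Let K_compact : compact K.
Proof.
apply: (@closed_bounded_compact _ _ _ 1) => [|x [_ /= ->] //].
apply: closedI => //.
apply: (@preimage_closed _ _ (@nrm R d) [set y | y = 1]).
  by move=> x _; exact: nrm_continuous.
exact: closed_eq.
Qed.

Lemma pointed_opp x : C x -> x != 0 -> ~ C (- x).
Proof.
move=> Cx x0 CNx; apply: C_pointed; exists 0, x; split => // t; rewrite add0r.
have [t0|t0] := leP 0 t; first exact: cone_scale.
by rewrite -[t]opprK scaleNr -scalerN; apply: cone_scale => //; lra.
Qed.

Lemma cone_coercive b : (forall x, C x -> x != 0 -> 0 < dot b x) ->
  exists2 c, 0 < c & forall x, C x -> c * nrm x <= dot b x.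
Proof.
move=> b0; have [K0|K0] := pselect (K !=set0); last first.
  exists 1 => // x Cx; have [->|x0] := eqVneq x 0.
    by rewrite nrm0 mulr0 dot0r.
  exfalso; apply: K0; exists ((nrm x)^-1 *: x); split.
    by apply: cone_scale => //; rewrite invr_ge0 nrm_ge0.
  by rewrite /= nrmZ ger0_norm ?invr_ge0 ?nrm_ge0 // mulVf // gt_eqF ?nrm_gt0.
have [p /set_mem [Cp p1] pmin] := @EVT_min_rV _ _ (dot b) K K0 K_compact
  (continuous_subspaceT (@dot_continuous _ _ b)).
have p0 : p != 0 by apply/eqP => p0; move: p1; rewrite /= p0 nrm0; lra.
exists (dot b p); first exact: b0.
move=> x Cx; have [->|x0] := eqVneq x 0; first by rewrite nrm0 mulr0 dot0r.
have nx := nrm_gt0 x0.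
rewrite -ler_pdivlMr // [leRHS]mulrC -dotZr; apply: pmin; apply/mem_set; split.
  by apply: cone_scale => //; rewrite invr_ge0 nrm_ge0.
by rewrite /= nrmZ ger0_norm ?invr_ge0 ?nrm_ge0 // mulVf // gt_eqF ?nrm_gt0.
Qed.

(** For [x] in the unit slice [- x] is outside [C], and a functional separating it from [C] is
    nonnegative on [C] and positive at [x]. By compactness finitely many of them serve the whole
    slice, and their sum is positive on it. *)
Lemma coercive_exists :
  exists a c, 0 < c /\ forall x, C x -> c * nrm x <= dot a x.
Proof.
pose D := [set b | forall x, C x -> 0 <= dot b x].
have : finite_subset_cover D (fun b => [set x | 0 < dot b x]) K.
  have := K_compact; rewrite compact_cover; apply => [b _|x [Cx /= x1]].
    apply: (@open_comp _ _ (dot b) [set y | 0 < y]); last exact: open_gt.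
    by move=> x _; exact: dot_continuous.
  have x0 : x != 0 by apply/eqP => x0; move: x1; rewrite x0 nrm0; lra.
  have [b [bC bx]] := cone_separation (pointed_opp Cx x0).
  by exists b => //=; rewrite dotNr in bx; lra.
move=> [D' D'D cov].
pose a := \sum_(b <- D') b.
have aC x : C x -> x != 0 -> 0 < dot a x.
  move=> Cx x0; have nx := nrm_gt0 x0.
  have [|b bD' /= bx] := cov ((nrm x)^-1 *: x).
    split; first by apply: cone_scale => //; rewrite invr_ge0 nrm_ge0.
    by rewrite /= nrmZ ger0_norm ?invr_ge0 ?nrm_ge0 // mulVf // gt_eqF.
  rewrite /a dot_suml (big_fsetD1 b) //=.
  apply: ltr_pwDl.
    by move: bx; rewrite dotZr pmulr_rgt0 // invr_gt0.
  rewrite big_seq; apply: sumr_ge0 => e; rewrite !inE => /andP[_ eD'].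
  by have := D'D _ eD'; rewrite inE; apply.
by have [c c0 cP] := cone_coercive aC; exists a, c.
Qed.

End Cone.

(** * Sums along injections and over the integer lattice *)

Lemma sum_inj_le_tsum {R : realType} (T : choiceType) (I : eqType) (s : seq I)
    (h : I -> T) (f : T -> R) :
  (forall i, 0 <= f i) -> tsummable f -> uniq s -> {in s &, injective h} ->
  \sum_(i <- s) f (h i) <= tsum f.
Proof.
move=> f0 sf us hI.
have ush : uniq (map h s) by rewrite map_inj_in_uniq.
rewrite -(big_map h xpredT f).
suff -> : \sum_(x <- map h s) f x = \sum_(x <- [fset y in map h s]%fset) f x.
  exact: sum_le_tsum.
by apply: perm_big; apply: uniq_perm => // x; rewrite !inE.
Qed.

Lemma sum_inj_le_sum {R : realType} (T : finType) (I : eqType) (s : seq I)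
    (h : I -> T) (f : T -> R) :
  (forall i, 0 <= f i) -> uniq s -> {in s &, injective h} ->
  \sum_(i <- s) f (h i) <= \sum_x f x.
Proof.
move=> f0 us hI.
have ush : uniq (map h s) by rewrite map_inj_in_uniq.
rewrite -(big_map h xpredT f) big_uniq //= [leRHS](bigID (mem (map h s))) /=.
by rewrite lerDl sumr_ge0.
Qed.

Section Embedding.
Context {R : realType} {d : nat}.
Implicit Types v w : 'rV[int]_d.

Definition emb v : 'rV[R]_d := map_mx intr v.

Lemma embD v w : emb (v + w) = emb v + emb w.
Proof. by rewrite /emb map_mxD. Qed.

Lemma emb0 : emb 0 = 0.
Proof. by rewrite /emb map_mx0. Qed.

Lemma embMn v n : emb (v *+ n) = n%:R *: emb v.
Proof. by rewrite /emb raddfMn /= scaler_nat. Qed.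

Lemma emb_inj : injective emb.
Proof.
by move=> v w /rowP vw; apply/rowP => j; have := vw j; rewrite !mxE => /intr_inj.
Qed.

Lemma emb_eq0 v : (emb v == 0) = (v == 0).
Proof. by rewrite -emb0 (inj_eq emb_inj). Qed.

Lemma nrm_emb_ge1 v : v != 0 -> 1 <= nrm (emb v).
Proof.
move=> v0; have /existsP[j vj] : [exists j, v 0 j != 0].
  apply: contraNT v0 => /existsPn vn; apply/eqP/rowP => j; rewrite mxE.
  by apply/eqP; have := vn j; rewrite negbK.
apply: le_trans (coord_le_nrm _ j); rewrite mxE -intr_norm.
by rewrite -[1]/(1%:~R) ler_int -gtz0_ge1 normr_gt0.
Qed.

Lemma integral_emb (x : 'rV[R]_d) : integral_vector x -> exists v, x = emb v.
Proof.
move=> /mxOverP xi; exists (map_mx Num.floor x); apply/rowP => j.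
by rewrite !mxE floorK.
Qed.

Lemma emb_integral v : integral_vector (emb v).
Proof. by apply/mxOverP => i j; rewrite mxE intr_int. Qed.

Lemma sum_geometric_le (q : R) n : 0 <= q < 1 -> \sum_(i < n) q ^+ i <= (1 - q)^-1.
Proof.
move=> /andP[q0 q1]; have q1' : 0 < 1 - q by lra.
rewrite -[leRHS]mul1r ler_pdivlMr // mulrC.
have := subrX1 q n; have := exprn_ge0 n q0; lra.
Qed.

(** With [q = expR (- c)] the term is the product of [q ^ |v_j|] over the coordinates, so the sum
    over a box is the [d]-th power of a one-dimensional sum, which two geometric series bound by
    [2 / (1 - q)]. *)
Lemma tsummable_exp_nrm (c : R) : 0 < c ->
  tsummable (fun v : 'rV[int]_d => expR (- (c * nrm (emb v)))).
Proof.
move=> c0; pose q := expR (- c).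
have q01 : 0 <= q < 1 by rewrite expR_ge0 /= expR_lt1 oppr_lt0.
have [q0 q1] := andP q01.
apply: (@tsummable_nneg _ _ _ ((2 * (1 - q)^-1) ^+ d)) => [v|F].
  exact: expR_ge0.
pose B := (\sum_(v <- F) \sum_(j < d) `|v 0%R j|)%N.
have vB v j : v \in F -> (`|v 0%R j| <= B)%N.
  move=> vF; rewrite /B (big_fsetD1 v) //= (bigD1 j) //=.
  by rewrite -addnA leq_addr.
(* Coordinates are shifted by [B] into ordinals, so the index [m] stands for [m - B]. *)
pose h v := [ffun j : 'I_d => inord `|(v 0 j + B%:Z)%R|%N : 'I_(B + B).+1].
have hv v j : v \in F -> (h v j : nat) = `|(v 0 j + B%:Z)%R|%N.
  by move=> vF; rewrite ffunE inordK //; have := vB v j vF; lia.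
pose H (g : {ffun 'I_d -> 'I_(B + B).+1}) := \prod_j q ^+ `|(g j)%:Z - B%:Z|%N.
have -> : \sum_(v <- F) expR (- (c * nrm (emb v))) = \sum_(v <- F) H (h v).
  rewrite big_seq [RHS]big_seq; apply: eq_bigr => v vF.
  rewrite /nrm mulr_sumr -sumrN expR_sum; apply: eq_bigr => j _.
  rewrite /q -expRM_natl !mxE hv //; congr expR.
  rewrite mulrN mulrC -intr_norm; congr (- (_ * _)).
  rewrite -abszE -pmulrn; congr (_%:R); have := vB v j vF; lia.
apply: (@le_trans _ _ (\sum_g H g)).
  apply: sum_inj_le_sum => // [g|v w vF wF /ffunP vw].
    by apply: prodr_ge0 => j _; exact: exprn_ge0.
  apply/rowP => j; have /(congr1 val) := vw j; rewrite /= !hv //.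
  by have := vB v j vF; have := vB w j wF; lia.
rewrite /H -(bigA_distr_bigA (fun _ (m : 'I_(B + B).+1) => q ^+ `|m%:Z - B%:Z|%N)).
rewrite prodr_const card_ord; apply: lerXn2r.
- by rewrite nnegrE sumr_ge0 // => i _; exact: exprn_ge0.
- by rewrite nnegrE mulr_ge0 // invr_ge0; lra.
have -> : \sum_(m < (B + B).+1) q ^+ `|m%:Z - B%:Z|%N
  = \sum_(m < B + B.+1) q ^+ `|m%:Z - B%:Z|%N by rewrite addnS.
rewrite big_split_ord /= mulrDl mul1r; apply: lerD.
  rewrite (reindex_inj rev_ord_inj) /=.
  apply: le_trans (sum_geometric_le B q01); apply: ler_sum => i _.
  have -> : `|((B - i.+1)%N)%:Z - B%:Z|%N = i.+1 by have := ltn_ord i; lia.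
  by rewrite exprS ler_piMl ?exprn_ge0 // ltW.
apply: le_trans (sum_geometric_le B.+1 q01); apply: ler_sum => i _.
by rewrite (_ : `|_|%N = i) //; lia.
Qed.

End Embedding.

(** * Lattice sums at commensurable scales *)

Section LatticeSums.
Context {R : realType} {d : nat} (C : set 'rV[R]_d).
Hypotheses (C_cone : convex_cone C).
Implicit Types (v w : 'rV[int]_d) (f phi : 'rV[R]_d -> R) (x y : 'rV[R]_d).

Definition lat f (t : R) v : R :=
  if `[< C (emb v) >] then f (t^-1 *: emb v) else 0.

Definition ldens f t : R := tsum (lat f t) / t ^+ d.

Definition homog phi := forall s x, 0 <= s -> C x -> phi (s *: x) = s * phi x.

Definition lip (K : R) phi :=
  forall x y, C x -> C y -> `|phi x - phi y| <= K * nrm (x - y).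

Lemma lat_ge0 f t v : (forall x, C x -> 0 <= f x) -> 0 < t -> 0 <= lat f t v.
Proof.
move=> f0 t0; rewrite /lat; case: asboolP => // Cv; apply: f0.
by apply: (cone_scale C_cone) => //; rewrite invr_ge0 ltW.
Qed.

Lemma lat_le f g t v : (forall x, C x -> f x <= g x) -> 0 < t ->
  lat f t v <= lat g t v.
Proof.
move=> fg t0; rewrite /lat; case: asboolP => // Cv; apply: fg.
by apply: (cone_scale C_cone) => //; rewrite invr_ge0 ltW.
Qed.

Lemma tsummable_lat f c M t : 0 < c -> 0 < t ->
  (forall x, C x -> `|f x| <= M * expR (- (c * nrm x))) -> tsummable (lat f t).
Proof.
move=> c0 t0 fM.
apply: (@tsummable_le _ _ _ (fun v => `|M| * expR (- (c / t * nrm (emb v))))).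
  move=> v; rewrite /lat; case: asboolP => [Cv|_]; last first.
    by rewrite normr0 mulr_ge0 // expR_ge0.
  apply: le_trans (fM _ _) _.
    by apply: (cone_scale C_cone) => //; rewrite invr_ge0 ltW.
  rewrite nrmZ gtr0_norm ?invr_gt0 // mulrA.
  by apply: ler_wpM2r; [exact: expR_ge0|exact: ler_norm].
by apply/tsummableZ/tsummable_exp_nrm; rewrite divr_gt0.
Qed.

(* [kk] is a lattice point so deep inside the cone that rounding [x + kk], [x] in the
   cone, to a lattice point does not leave the cone. *)
Variable kk : 'rV[int]_d.
Hypothesis kkP : forall y, nrm (y - emb kk) <= d%:R -> C y.

Let sz : R := nrm (emb kk : 'rV[R]_d) + d%:R.

Let close_shift y : nrm (y - emb kk) <= d%:R -> nrm y <= sz.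
Proof.
move=> H; rewrite -[y](subrK (emb kk)); apply: le_trans (nrmD _ _) _.
by rewrite /sz addrC lerD2l.
Qed.

Section Compare.
Variables (phi : 'rV[R]_d -> R) (K : R).
Hypotheses (phi_homog : homog phi) (phi_lip : lip K phi) (K0 : 0 <= K).
Let f x := expR (- phi x).

Let phi_shift x y t : 0 < t -> C x -> nrm (y - emb kk) <= d%:R ->
  f (t^-1 *: x) <= expR (K * sz / t) * f (t^-1 *: (x + y)).
Proof.
move=> t0 Cx Hy; have Cy := kkP Hy; have Cxy := cone_add C_cone Cx Cy.
have ti : 0 <= t^-1 by rewrite invr_ge0 ltW.
rewrite /f -expRD ler_expR !phi_homog //.
have xyx : x + y - x = y by rewrite addrC addKr.
have := phi_lip Cxy Cx; rewrite xyx => /ler_normlW H.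
have : phi (x + y) - phi x <= K * sz.
  by apply: le_trans H _; rewrite ler_wpM2l // close_shift.
move: (phi (x + y)) (phi x) => p p' {}H.
rewrite -mulrN -(mulrC t^-1) -mulrN -mulrDr ler_wpM2l //; lra.
Qed.

(* Division by [N.+1] with remainder is [N.+1 ^ d]-to-one on lattice points. *)
Lemma compare_up N (t : R) (F : {fset 'rV[int]_d}) : 0 < t ->
  tsummable (lat f t) ->
  \sum_(w <- F) lat f (N.+1%:R * t) w
    <= N.+1%:R ^+ d * (expR (K * sz / t) * tsum (lat f t)).
Proof.
move=> t0 sf; have N0 : 0 < N.+1%:R :> R by rewrite ltr0n.
have lat0 v : 0 <= lat f t v by apply: lat_ge0 => // x _; exact: expR_ge0.
pose tau w : 'rV[int]_d := \row_j (w 0%R j %/ N.+1)%Z + kk.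
pose rho w := [ffun j : 'I_d => inord `|(w 0%R j %% N.+1)%Z|%N : 'I_N.+1].
have rhoE w j : ((rho w j : nat)%:Z = (w 0%R j %% N.+1)%Z).
  by rewrite ffunE inordK; lia.
have wE w j : w 0 j = (tau w 0 j - kk 0 j) * N.+1%:Z + (rho w j : nat)%:Z.
  by rewrite rhoE !mxE addrK -divz_eq.
have tauP w : nrm (emb (tau w) - N.+1%:R^-1 *: emb w - emb kk : 'rV[R]_d) <= d%:R.
  rewrite /nrm -[X in _ <= X%:R]card_ord -sumr_const; apply: ler_sum => j _.
  rewrite !mxE rmorphD /=.
  have -> : (w 0 j)%:~R = (w 0%R j %/ N.+1)%Z%:~R * N.+1%:R + (rho w j : nat)%:R :> R.
    by rewrite {1}[w 0 j](divz_eq _ N.+1) rmorphD rmorphM /= -rhoE.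
  have rN : (rho w j : nat)%:R <= N.+1%:R :> R by rewrite ler_nat ltnW.
  set a := (_ %/ _)%Z%:~R; set b := (kk 0 j)%:~R.
  have -> : a + b - N.+1%:R^-1 * (a * N.+1%:R + (rho w j : nat)%:R) - b
     = - ((rho w j : nat)%:R / N.+1%:R).
    by move: (N.+1%:R : R) (lt0r_neq0 N0) => n n0; field.
  rewrite normrN ger0_norm ?divr_ge0 //.
  by rewrite ler_pdivrMr // mul1r.
have step w : lat f (N.+1%:R * t) w <= expR (K * sz / t) * lat f t (tau w).
  rewrite {1}/lat; case: asboolP => [Cw|_]; last by rewrite mulr_ge0 // expR_ge0.
  have Cw' : C (N.+1%:R^-1 *: emb w).
    by apply: (cone_scale C_cone) => //; rewrite invr_ge0 ltW.
  have Ct : C (emb (tau w)).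
    rewrite -[emb (tau w)](subrK (N.+1%:R^-1 *: emb w)) addrC.
    by apply: (cone_add C_cone) => //; exact: kkP.
  rewrite /lat; case: asboolP => // _.
  rewrite invfM mulrC -scalerA; apply: le_trans (phi_shift t0 Cw' (tauP w)) _.
  by rewrite [_ + (_ - _)]addrC subrK.
apply: le_trans (ler_sum _ (fun w _ => step w)) _.
rewrite -mulr_sumr [leRHS]mulrCA; apply: ler_wpM2l; first exact: expR_ge0.
rewrite (eq_bigr (fun w => \sum_(u : {ffun 'I_d -> 'I_N.+1} | u == rho w) lat f t (tau w)));
  last by move=> w _; rewrite big_pred1_eq.
rewrite (exchange_big_dep xpredT) //=.
have -> : N.+1%:R ^+ d * tsum (lat f t)
    = \sum_(u : {ffun 'I_d -> 'I_N.+1}) tsum (lat f t).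
  by rewrite sumr_const card_ffun !card_ord -[RHS]mulr_natl natrX.
apply: ler_sum => u _; rewrite -big_filter.
apply: (sum_inj_le_tsum lat0 sf) => [|w w']; first exact: filter_uniq (fset_uniq _).
rewrite !mem_filter => /andP[/eqP uw _] /andP[/eqP uw' _] tt'.
by apply/rowP => j; rewrite wE [RHS]wE -uw -uw' tt'.
Qed.

(** The points [(N + 1)(v + kk) + u], with [u] a vector of remainders, are pairwise distinct, lie in
    the cone if [v] does, and after division by [N + 1] differ from [v] by a bounded vector. So each
    [v] at scale [t] is dominated by [(N + 1)^d] points at scale [(N + 1) t], up to the factor
    [expR (K * sz / t)]. *)
Lemma compare_down N (t : R) (F : {fset 'rV[int]_d}) : 0 < t ->
  tsummable (lat f (N.+1%:R * t)) ->
  N.+1%:R ^+ d * \sum_(v <- F) lat f t v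
    <= expR (K * sz / t) * tsum (lat f (N.+1%:R * t)).
Proof.
move=> t0 sf; have N0 : 0 < N.+1%:R :> R by rewrite ltr0n.
have Nt0 : 0 < N.+1%:R * t by rewrite mulr_gt0.
have lat0 v : 0 <= lat f (N.+1%:R * t) v.
  by apply: lat_ge0 => // x _; exact: expR_ge0.
pose U := {ffun 'I_d -> 'I_N.+1}.
pose sig (p : 'rV[int]_d * U) : 'rV[int]_d :=
  \row_j ((p.1 0 j + kk 0 j) * N.+1%:Z + (p.2 j : nat)%:Z).
have step v (u : U) : lat f t v <= expR (K * sz / t) * lat f (N.+1%:R * t) (sig (v, u)).
  rewrite {1}/lat; case: asboolP => [Cv|_]; last by rewrite mulr_ge0 // expR_ge0.
  pose y := N.+1%:R^-1 *: emb (sig (v, u)) - emb v : 'rV[R]_d.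
  have Hy : nrm (y - emb kk) <= d%:R.
    rewrite /nrm -[X in _ <= X%:R]card_ord -sumr_const; apply: ler_sum => j _.
    rewrite !mxE /= rmorphD rmorphM rmorphD /=.
    have rN : (u j : nat)%:R <= N.+1%:R :> R by rewrite ler_nat ltnW.
    set a := (v 0 j)%:~R; set b := (kk 0 j)%:~R.
    rewrite (_ : _ - _ = (u j : nat)%:R / N.+1%:R); last first.
      by rewrite -!pmulrn; move: (N.+1%:R : R) (lt0r_neq0 N0) => n n0; field.
    by rewrite ger0_norm ?divr_ge0 // ler_pdivrMr // mul1r.
  have vy : emb v + y = N.+1%:R^-1 *: emb (sig (v, u)) by rewrite /y addrC subrK.
  have Cs : C (emb (sig (v, u))).
    rewrite -[emb (sig _)]scale1r -[1](@mulfV _ N.+1%:R) ?pnatr_eq0 // -scalerA -vy.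
    apply: (cone_scale C_cone) => //; apply: (cone_add C_cone) => //.
    exact: kkP.
  rewrite /lat; case: asboolP => // _.
  by rewrite [N.+1%:R * t]mulrC invfM -scalerA -vy; exact: phi_shift.
have -> : N.+1%:R ^+ d * \sum_(v <- F) lat f t v
    = \sum_(u : U) \sum_(v <- F) lat f t v.
  by rewrite sumr_const card_ffun !card_ord -[RHS]mulr_natl natrX.
apply: (@le_trans _ _ (\sum_(u : U) \sum_(v <- F) expR (K * sz / t) * lat f (N.+1%:R * t) (sig
  (v, u)))).
  by apply: ler_sum => u _; apply: ler_sum => v _; exact: step.
under eq_bigr do rewrite -mulr_sumr; rewrite -mulr_sumr.
apply: ler_wpM2l; first exact: expR_ge0.
rewrite exchange_big /=.
rewrite -(@big_allpairs _ _ _ _ _ F (index_enum U) (fun p => lat f (N.+1%:R * t) (sig p))).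
apply: sum_inj_le_tsum => //.
  apply: allpairs_uniq => //; first exact: index_enum_uniq.
  by move=> [? ?] [? ?].
move=> [v u] [v' u'] _ _ /rowP H.
have E j : v 0 j = v' 0 j /\ u j = u' j.
  have := H j; rewrite !mxE /= => E.
  have sm (i : 'I_N.+1) : ((i : nat)%:Z %% N.+1%:Z)%Z = i by rewrite modz_nat modn_small.
  have uu : (u j : nat) = u' j.
    by move/(congr1 (fun z => (z %% N.+1%:Z)%Z)): E; rewrite !modzMDl !sm => -[].
  split; last exact: val_inj.
  by move: E; rewrite uu => /addIr /mulIf E; have /addIr := E isT.
by congr pair; [apply/rowP => j|apply/ffunP => j]; have [] := E j.
Qed.

End Compare.

End LatticeSums.

(** * Real inequalities and limits at infinity *)

Section RealLemmas.
Context {R : realType}.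
Implicit Types (a b c u x t : R).

Lemma eq_ler a b : a = b -> a <= b.
Proof. by move=> ->. Qed.

Lemma le0_of_natmul_bounded a b : (forall N, a * N.+1%:R <= b) -> a <= 0.
Proof.
move=> H; rewrite leNgt; apply/negP => a0.
have := H (Num.truncn (b / a)); rewrite leNgt => /negP; apply.
by rewrite mulrC -ltr_pdivrMr // truncnS_gt.
Qed.

Lemma expR_sub1Dx_le u : `|expR u - 1 - u| <= u ^+ 2 * expR `|u|.
Proof.
have h1 := expR_ge1Dx u; have h2 := expR_ge1Dx (- u).
have e0 := expR_gt0 u; have e0' := expR_gt0 (- u).
have ee : expR u * expR (- u) = 1 by rewrite -expRD subrr expR0.
have hx : expR u - 1 <= u * expR u by nra.
rewrite ger0_norm; last by lra.
have [u0|u0] := leP 0 u.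
  by have := ler_wpM2l u0 hx; rewrite (ger0_norm u0) expr2 -mulrA mulrBr mulr1; lra.
have e1 : 1 <= expR (- u) by rewrite -expR0 ler_expR; lra.
have h3 : u * (expR u - 1) <= u * u by rewrite ler_nM2l; lra.
have h4 := ler_wpM2l (sqr_ge0 u) e1.
by rewrite (ltr0_norm u0); move: h3 h4; rewrite expr2 mulr1 mulrBr mulr1; lra.
Qed.

(** Second-order Taylor bound at [x / 4]; the constant is [2 * 4 ^ 2]. *)
Lemma sqr_le_expR x : 0 <= x -> x ^+ 2 <= 32 * expR (x / 4).
Proof.
move=> x0; have x4 : 0 <= x / 4 by lra.
by have := expR_ge1Dxn 1 x4; rewrite (_ : 2`!%:R = 2 :> R) //; lra.
Qed.

Lemma le_expR_half x : x <= 2 * expR (x / 2).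
Proof. by have := expR_ge1Dx (x / 2); lra. Qed.

Lemma expR_cvg1 c : expR (c / t) @[t --> +oo] --> (1 : R).
Proof.
have h : c / t @[t --> +oo] --> (0 : R).
  rewrite -[X in _ --> X](mulr0 c); apply: cvgMr.
  by apply/gtr0_cvgV0; [near=> t; near: t; exact: nbhs_pinfty_gt|exact: cvg_id].
rewrite -[X in _ --> X]expR0.
by apply: (continuous_cvg _ _ h); exact: continuous_expR.
Unshelve. all: by end_near. Qed.

(** By the hypothesis each [expR (- c / t) * l t] is at most each [expR (c / t') * l t']. The
    supremum of the former lies in between, and the two resulting bounds squeeze [l t] towards
    it. *)
Lemma two_scale_limit (l : R -> R) c : 0 <= c -> (forall t, 0 < t -> 0 <= l t) ->
  (forall t t', 0 < t -> 0 < t' -> l t <= expR (c / t) * (expR (c / t') * l t')) ->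
  exists I : R, [/\ 0 <= I, l t @[t --> +oo] --> I &
    forall t, 0 < t -> l t <= expR (c / t) * I /\ I <= expR (c / t) * l t].
Proof.
move=> c0 l0 ll; pose E := [set expR (- (c / t)) * l t | t in [set t | 0 < t]].
have e1 t : expR (c / t) * expR (- (c / t)) = 1 by rewrite -expRD subrr expR0.
have Eub t' : 0 < t' -> ubound E (expR (c / t') * l t').
  move=> t'0 _ [t /= t0 <-]; have := ll _ _ t0 t'0.
  have := e1 t; have := expR_gt0 (- (c / t)).
  move: (expR _) (expR (c / t)) (_ * l t') => p q r p0 pq H.
  by apply: le_trans (ler_wpM2l (ltW p0) H) _; rewrite mulrA [p * q]mulrC pq mul1r.
have hs : has_sup E.
  split; last by exists (expR (c / 1) * l 1); apply: Eub.
  by exists (expR (- (c / 1)) * l 1); exists 1 => //=; exact: ltr01.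
have I2 t : 0 < t -> sup E <= expR (c / t) * l t by move=> t0; apply: ge_sup (Eub _ t0);
  exact: hs.1.
have I1 t : 0 < t -> l t <= expR (c / t) * sup E.
  move=> t0; have : expR (- (c / t)) * l t <= sup E by apply: (ub_le_sup hs.2); exists t.
  move=> /(ler_wpM2l (expR_ge0 (c / t))); by rewrite mulrA e1 mul1r.
exists (sup E); split => [||t t0]; last by split; [exact: I1|exact: I2].
  apply: le_trans (ub_le_sup hs.2 (ex_intro2 _ _ 1 ltr01 erefl)).
  by rewrite mulr_ge0 ?expR_ge0 ?l0.
have lo : expR (- c / t) * sup E @[t --> +oo] --> sup E.
  by rewrite -[X in _ --> X]mul1r; apply: cvgMl; exact: expR_cvg1.
have hi : expR (c / t) * sup E @[t --> +oo] --> sup E.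
  by rewrite -[X in _ --> X]mul1r; apply: cvgMl; exact: expR_cvg1.
apply: (squeeze_cvgr _ lo hi); near=> t.
have t0 : 0 < t by near: t; exact: nbhs_pinfty_gt.
rewrite I1 // andbT mulNr.
have := ler_wpM2l (expR_ge0 (- (c / t))) (I2 _ t0).
by rewrite mulrA [_ * expR (c / t)]mulrC e1 mul1r.
Unshelve. all: by end_near. Qed.

Lemma cvg_of_approx (h : R -> R) :
  (forall e : R, 0 < e -> exists (u : R -> R) (lam : R), u t @[t --> +oo] --> lam /\
     \forall t \near +oo, `|u t - h t| <= e) ->
  exists m : R, h t @[t --> +oo] --> m.
Proof.
move=> H; apply/cvg_ex/cauchy_cvgP/cauchy_exP => e e0.
have e2 : 0 < e / 4 by rewrite divr_gt0.
have [u [lam [/cvgrPdist_le ul uh]]] := H _ e2.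
exists lam; apply: filterS2 (ul _ e2) uh => t h1 h2; rewrite /ball /=.
have := ler_normD (lam - u t) (u t - h t); rewrite addrA subrK; lra.
Qed.

End RealLemmas.

(** * Limits of the densities of lattice sums *)

Section Densities.
Context {R : realType} {d : nat} (C : set 'rV[R]_d).
Hypotheses (C_cone : convex_cone C).
Implicit Types (f g phi : 'rV[R]_d -> R) (x y : 'rV[R]_d).

Definition rapid f := exists c M, 0 < c /\
  forall x, C x -> `|f x| <= M * expR (- (c * nrm x)).

Lemma rapid_tsummable f t : rapid f -> 0 < t -> tsummable (lat C f t).
Proof. by move=> [c [M [c0 fM]]] t0; exact: (tsummable_lat C_cone c0 t0 fM). Qed.

Lemma rapid_le f g : rapid g -> (forall x, C x -> `|f x| <= g x) -> rapid f.
Proof.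
move=> [c [M [c0 gM]]] fg; exists c, M; split => // x Cx.
apply: le_trans (gM _ Cx); apply: le_trans (fg _ Cx) _; exact: ler_norm.
Qed.

Let rapid_weaken f c M c' M' : (forall x, C x -> `|f x| <= M * expR (- (c * nrm x))) ->
  c' <= c -> `|M| <= M' -> forall x, C x -> `|f x| <= M' * expR (- (c' * nrm x)).
Proof.
move=> fM cc MM x Cx; apply: le_trans (fM _ Cx) _.
apply: (@le_trans _ _ (M' * expR (- (c * nrm x)))).
  by rewrite ler_wpM2r ?expR_ge0 //; apply: le_trans MM; exact: ler_norm.
rewrite ler_wpM2l //; first exact: le_trans (normr_ge0 _) MM.
by rewrite ler_expR lerN2 ler_wpM2r ?nrm_ge0.
Qed.

Lemma rapidD f g : rapid f -> rapid g -> rapid (fun x => f x + g x).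
Proof.
move=> [c [M [c0 fM]]] [c' [M' [c'0 gM]]].
exists (Num.min c c'), (`|M| + `|M'|); split; first by rewrite lt_min c0.
move=> x Cx; apply: le_trans (ler_normD _ _) _; rewrite mulrDl; apply: lerD.
  by apply: (rapid_weaken fM) => //; rewrite ge_min lexx.
by apply: (rapid_weaken gM) => //; rewrite ge_min lexx orbT.
Qed.

Lemma rapidZ a f : rapid f -> rapid (fun x => a * f x).
Proof.
move=> [c [M [c0 fM]]]; exists c, (`|a| * M); split => // x Cx.
by rewrite normrM -mulrA ler_wpM2l // fM.
Qed.

Lemma ldensD f g t : rapid f -> rapid g -> 0 < t ->
  ldens C (fun x => f x + g x) t = ldens C f t + ldens C g t.
Proof.
move=> rf rg t0; rewrite /ldens -mulrDl -tsumD; try exact: rapid_tsummable.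
congr (_ / _); apply: eq_tsum => v; rewrite /lat; case: asboolP => // _.
by rewrite addr0.
Qed.

Lemma ldensZ a f t : rapid f -> 0 < t ->
  ldens C (fun x => a * f x) t = a * ldens C f t.
Proof.
move=> rf t0; rewrite /ldens mulrA -tsumZ; last exact: rapid_tsummable.
congr (_ / _); apply: eq_tsum => v; rewrite /lat; case: asboolP => // _.
by rewrite mulr0.
Qed.

Lemma ldens_le f g t : rapid f -> rapid g -> 0 < t ->
  (forall x, C x -> f x <= g x) -> ldens C f t <= ldens C g t.
Proof.
move=> rf rg t0 fg; rewrite /ldens ler_pM2r ?invr_gt0 ?exprn_gt0 //.
apply: le_tsum; try exact: rapid_tsummable.
by move=> v; exact: lat_le.
Qed.

Lemma ldens_ge0 f t : 0 < t -> (forall x, C x -> 0 <= f x) -> 0 <= ldens C f t.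
Proof.
move=> t0 f0; apply: divr_ge0; last by apply/exprn_ge0/ltW.
by apply: tsum_ge0 => v; exact: lat_ge0.
Qed.

Lemma ldens_norm_le f g t : rapid f -> rapid g -> 0 < t ->
  (forall x, C x -> `|f x| <= g x) -> `|ldens C f t| <= ldens C g t.
Proof.
move=> rf rg t0 fg; rewrite ler_norml lerNl -mulN1r -ldensZ //.
apply/andP; split; apply: ldens_le => //; try exact: rapidZ; move=> x Cx.
  by rewrite mulN1r; have := fg _ Cx; rewrite ler_norml => /andP[]; lra.
by have := fg _ Cx; rewrite ler_norml => /andP[]; lra.
Qed.

Lemma rapid_exp phi c : 0 < c -> (forall x, C x -> c * nrm x <= phi x) ->
  rapid (fun x => expR (- phi x)).
Proof.
move=> c0 cphi; exists c, 1; split => // x Cx.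
by rewrite ger0_norm ?expR_ge0 // mul1r ler_expR lerN2 cphi.
Qed.

Variable kk : 'rV[int]_d.
Hypothesis kkP : forall y, nrm (y - emb kk) <= d%:R -> C y.
Let sz : R := nrm (emb kk : 'rV[R]_d) + d%:R.

Let sz_ge0 : 0 <= sz.
Proof. by rewrite addr_ge0 ?nrm_ge0. Qed.

(** Two scales [t] and [t'] need not be commensurable. They are compared through the large multiples
    [T = (N + 1) t] and [(M + 1) t'], the latter exceeding [T] by at most [t']. This rounding costs
    a factor that tends to 1 as [N] grows, and [two_scale_limit] applies to what remains. *)
Lemma density_limit phi K c : homog C phi -> lip C K phi -> 0 <= K -> 0 < c ->
  (forall x, C x -> c * nrm x <= phi x) ->
  exists I : R, [/\ 0 <= I, ldens C (fun x => expR (- phi x)) t @[t --> +oo] --> I &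
   forall t, 0 < t -> ldens C (fun x => expR (- phi x)) t <= expR (K * sz / t) * I /\
    I <= expR (K * sz / t) * ldens C (fun x => expR (- phi x)) t].
Proof.
move=> ph pl K0 c0 cphi; set f := fun x => expR (- phi x).
have rf : rapid f by exact: rapid_exp cphi.
have f0 x : C x -> 0 <= f x by move=> _; exact: expR_ge0.
have sm t : 0 < t -> tsummable (lat C f t) by exact: rapid_tsummable.
(* As [phi >= 0] on [C], each term grows with the scale; hence the sum at scale [T] is at most the
   one at the multiple of [t'] above [T]. *)
have mono t t' : 0 < t -> t <= t' -> tsum (lat C f t) <= tsum (lat C f t').
  move=> t0 tt'; have t'0 := lt_le_trans t0 tt'.
  apply: le_tsum; try exact: sm.
  move=> v; rewrite /lat; case: asboolP => // Cv.
  have ti : 0 <= t^-1 by rewrite invr_ge0 ltW.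
  have ti' : 0 <= t'^-1 by rewrite invr_ge0 ltW.
  rewrite /f ler_expR lerN2 !ph //.
  rewrite ler_wpM2r //; first by apply: le_trans (cphi _ Cv); rewrite mulr_ge0 ?nrm_ge0 ?ltW.
  by rewrite lef_pV2 ?posrE.
apply: two_scale_limit => [|t t0|t t' t0 t'0]; first by rewrite mulr_ge0.
  exact: ldens_ge0.
set E := expR (K * sz / t); set E' := expR (K * sz / t'); set l := ldens C f t'.
rewrite -subr_le0.
(* The defect is at most a constant divided by [N + 1], for each [N], hence nonpositive. *)
apply: (@le0_of_natmul_bounded _ _ (ldens C f t * (d%:R * (t' / t)))) => N.
pose T := N.+1%:R * t; pose M := Num.truncn (T / t').
have T0 : 0 < T by rewrite mulr_gt0.
have MT : T <= M.+1%:R * t' by rewrite -ler_pdivrMr // ltW // truncnS_gt.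
have MT' : M.+1%:R * t' <= T + t'.
  rewrite -natr1 mulrDl mul1r lerD2r -ler_pdivlMr //.
  by rewrite truncn_le //; apply: divr_ge0; exact: ltW.
have td0 : 0 < t ^+ d by rewrite exprn_gt0.
have h1 : N.+1%:R ^+ d * tsum (lat C f t) <= E * tsum (lat C f T).
  have Nd : 0 < N.+1%:R ^+ d :> R by rewrite exprn_gt0.
  rewrite mulrC -ler_pdivlMr //; apply: tsum_le => [v|F]; first exact: lat_ge0.
  rewrite ler_pdivlMr // mulrC.
  exact: (compare_down C_cone kkP ph pl K0 F t0 (sm _ T0)).
have M0 : 0 < M.+1%:R * t' by rewrite mulr_gt0.
have h2 := mono _ _ T0 MT.
have h3 : tsum (lat C f (M.+1%:R * t')) <= M.+1%:R ^+ d * (E' * tsum (lat C f t')).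
  apply: tsum_le => [v|F]; first exact: lat_ge0.
  exact: (compare_up C_cone kkP ph pl K0 _ F t'0 (sm _ t'0)).
have E0 : 0 <= E := expR_ge0 _; have E'0 : 0 <= E' := expR_ge0 _.
have l0 : 0 <= l by exact: ldens_ge0.
have EE : 0 <= E * (E' * l) by apply: mulr_ge0 => //; exact: mulr_ge0.
have key : ldens C f t <= E * (E' * l) * ((M.+1%:R * t') / T) ^+ d.
  have h4 : N.+1%:R ^+ d * tsum (lat C f t) <= E * (M.+1%:R ^+ d * (E' * tsum (lat C f t'))).
    by apply: le_trans h1 _; rewrite ler_wpM2l // (le_trans h2).
  rewrite /ldens ler_pdivrMr // /l /ldens /T.
  rewrite expr_div_n !exprMn.
  have Nd : N.+1%:R ^+ d != 0 :> R by rewrite expf_neq0 // pnatr_eq0.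
  have t'd : t' ^+ d != 0 by rewrite expf_neq0 // gt_eqF.
  have Nd0 : 0 < N.+1%:R ^+ d :> R by rewrite exprn_gt0.
  move: h4 Nd t'd Nd0 td0 (lt0r_neq0 td0).
  move: (N.+1%:R ^+ d) (M.+1%:R ^+ d) (t ^+ d) (t' ^+ d) => n m s s' h4 n0 s'0 np sp s0.
  rewrite -(ler_pM2l np); apply: le_trans h4 _.
  by apply: eq_ler; field; rewrite n0 s0 s'0.
have q0 : 0 <= M.+1%:R * t' / T by apply: divr_ge0; exact: ltW.
have r1 : M.+1%:R * t' / T <= 1 + t' / T.
  by rewrite ler_pdivrMr // mulrDl mul1r divfK ?gt_eqF.
have x0 : 0 <= t' / T by apply: divr_ge0; exact: ltW.
(* [(1 + x)^d * (1 - d x) <= 1] for [x = t' / T], as the two factors are below exponentials with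
   product 1. *)
have r2 : ((M.+1%:R * t') / T) ^+ d * (1 - d%:R * (t' / T)) <= 1.
  apply: (@le_trans _ _ (expR (d%:R * (t' / T)) * expR (- (d%:R * (t' / T))))); last first.
    by rewrite -expRD subrr expR0.
  have e1 : ((M.+1%:R * t') / T) ^+ d <= expR (d%:R * (t' / T)).
    rewrite expRM_natl; apply: lerXn2r; rewrite ?nnegrE ?expR_ge0 //.
    by apply: le_trans r1 _; exact: expR_ge1Dx.
  have [neg|pos] := leP (1 - d%:R * (t' / T)) 0.
    apply: le_trans (_ : 0 <= _); last by rewrite mulr_ge0 ?expR_ge0.
    by apply: mulr_ge0_le0 => //; exact: exprn_ge0.
  apply: ler_pM => //; first by rewrite exprn_ge0.
    exact: ltW.
  exact: expR_ge1Dx.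
have k2 : ldens C f t * (1 - d%:R * (t' / T)) <= E * (E' * l).
  have [neg|pos] := leP (1 - d%:R * (t' / T)) 0.
    apply: (@le_trans _ _ 0) => //.
    by apply: mulr_ge0_le0 => //; exact: ldens_ge0.
  apply: le_trans (ler_wpM2r (ltW pos) key) _.
  by rewrite -[leLHS]mulrA ler_piMr.
have k3 : ldens C f t - E * (E' * l) <= ldens C f t * (d%:R * (t' / T)) by lra.
apply: le_trans (ler_wpM2r (ler0n _ N.+1) k3) _.
rewrite -!mulrA; apply: eq_ler; congr (_ * (_ * (_ * _))).
rewrite /T; move: (N.+1%:R : R) (@lt0r_neq0 R N.+1%:R (ltr0n _ _)) => n n0.
by field; rewrite n0 gt_eqF.
Qed.

End Densities.

(** * Moments as derivatives of exponential densities *)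

Section Moments.
Context {R : realType} {d : nat} (C : set 'rV[R]_d).
Hypotheses (C_cone : convex_cone C) (C0 : C 0).
Implicit Types (f g phi : 'rV[R]_d -> R) (x y : 'rV[R]_d).

Definition hl g := homog C g /\ exists2 K, 0 <= K & lip C K g.

Definition coercive (a : 'rV[R]_d) c := 0 < c /\ forall x, C x -> c * nrm x <= dot a x.

Lemma dot_hl b : hl (dot b).
Proof.
split; first by move=> s x _ _; rewrite dotZr.
by exists (nrm b); [exact: nrm_ge0|move=> x y _ _; exact: dot_lip].
Qed.

Lemma hlD f g : hl f -> hl g -> hl (fun x => f x + g x).
Proof.
move=> [fh [K K0 fl]] [gh [L L0 gl]]; split.
  by move=> s x s0 Cx; rewrite fh // gh // mulrDr.
exists (K + L); first exact: addr_ge0.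
move=> x y Cx Cy; rewrite opprD addrACA mulrDl.
by apply: le_trans (ler_normD _ _) _; apply: lerD; [exact: fl|exact: gl].
Qed.

Lemma hlZ s g : hl g -> hl (fun x => s * g x).
Proof.
move=> [gh [L L0 gl]]; split.
  by move=> r x r0 Cx; rewrite gh // mulrCA.
exists (`|s| * L); first by rewrite mulr_ge0.
by move=> x y Cx Cy; rewrite -mulrBr normrM -mulrA ler_wpM2l // gl.
Qed.

Lemma hl0 g : hl g -> g 0 = 0.
Proof. by case=> gh _; rewrite -[X in g X](scale0r 0) gh // mul0r. Qed.

Variables (a : 'rV[R]_d) (c : R).
Hypothesis ac : coercive a c.
Let c0 : 0 < c := ac.1.
Let cP : forall x, C x -> c * nrm x <= dot a x := ac.2.

Lemma coercive_ge0 x : C x -> 0 <= dot a x.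
Proof. by move=> Cx; apply: le_trans (cP Cx); rewrite mulr_ge0 ?nrm_ge0 // ltW. Qed.

Lemma hl_bound g : hl g -> exists2 G, 0 <= G & forall x, C x -> `|g x| <= G * dot a x.
Proof.
move=> hg; have [_ [K K0 gl]] := hg; exists (K / c); first by rewrite divr_ge0 // ltW.
move=> x Cx; have := gl _ _ Cx C0; rewrite (hl0 hg) !subr0 => /le_trans; apply.
by rewrite -mulrA ler_wpM2l // ler_pdivlMl // cP.
Qed.

Definition expmul g x := g x * expR (- dot a x).

Lemma exp_rapid s : 0 < s -> rapid C (fun x => expR (- (s * dot a x))).
Proof.
move=> s0; apply: (@rapid_exp _ _ _ _ (s * c)); first by rewrite mulr_gt0.
by move=> x Cx; rewrite -mulrA ler_pM2l // cP.
Qed.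

Lemma expmul_rapid g : hl g -> rapid C (expmul g).
Proof.
move=> hg; have [G G0 gG] := hl_bound hg.
have s2 : 0 < (2^-1 : R) by rewrite invr_gt0.
apply: rapid_le (rapidZ (2 * G) (exp_rapid s2)) _ => x Cx.
rewrite /expmul normrM [X in _ * X]ger0_norm ?expR_ge0 //.
have l0 := coercive_ge0 Cx; move: (gG _ Cx) l0; move: (dot a x) => l gl l0.
apply: le_trans (ler_wpM2r (expR_ge0 _) gl) _.
rewrite -mulrA [2 * G]mulrC -mulrA ler_wpM2l //.
rewrite (_ : - l = - (l / 2) - (2^-1 * l)); last lra.
rewrite expRD mulrA ler_wpM2r ?expR_ge0 //.
apply: le_trans (ler_wpM2r (expR_ge0 _) (le_expR_half l)) _.
by rewrite -mulrA -expRD subrr expR0 mulr1.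
Qed.

Variable kk : 'rV[int]_d.
Hypothesis kkP : forall y, nrm (y - emb kk) <= d%:R -> C y.

Lemma exp_density_bounded s : 0 < s ->
  exists2 B, 0 <= B & forall t, 1 <= t -> ldens C (fun x => expR (- (s * dot a x))) t <= B.
Proof.
move=> s0; have [sh [K K0 sl]] := hlZ s (dot_hl a).
have sc0 : 0 < s * c by rewrite mulr_gt0.
have scP x : C x -> s * c * nrm x <= s * dot a x.
  by move=> Cx; rewrite -mulrA ler_pM2l // cP.
have [I [I0 _ IP]] := density_limit C_cone kkP sh sl K0 sc0 scP.
set S := nrm _ + _ in IP.
have S0 : 0 <= S by rewrite addr_ge0 ?nrm_ge0.
exists (expR (K * S) * I); first by rewrite mulr_ge0 ?expR_ge0.
move=> t t1; have t0 : 0 < t by lra.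
apply: le_trans (IP _ t0).1 _; rewrite ler_wpM2r // ler_expR ler_pdivrMr //.
by rewrite ler_peMr // mulr_ge0.
Qed.

Lemma tilt_coercive g : hl g -> exists2 s0, 0 < s0 &
  forall s x, `|s| <= s0 -> C x -> `|s * g x| <= dot a x / 2 /\
    c / 2 * nrm x <= dot a x - s * g x.
Proof.
move=> hg; have [G G0 gG] := hl_bound hg.
exists (2 * (G + 1))^-1; first by rewrite invr_gt0 mulr_gt0 //; lra.
move=> s x sG Cx; have l0 := coercive_ge0 Cx.
have h : `|s * g x| <= dot a x / 2.
  rewrite normrM; apply: le_trans (ler_pM _ _ sG (gG _ Cx)) _ => //.
  by rewrite ler_pdivrMl; [nra|rewrite mulr_gt0 //; lra].
split => //; have := cP Cx; have := ler_norm (s * g x); lra.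
Qed.

Lemma tilt_hl g s : hl g -> hl (fun x => dot a x - s * g x).
Proof.
move=> hg; have := hlD (dot_hl a) (hlZ (- s) hg); congr hl.
by apply/funext => x; rewrite mulNr.
Qed.

(** Taylor expansion in [s] with a remainder uniform in [t >= 1]. With [l = dot a x], the pointwise
    remainder is at most [s^2 g^2 exp |s g| exp (- l)]. Here [g^2 <= 32 G^2 exp (l / 4)] and
    [exp |s g| <= exp (l / 2)], which leaves [exp (- l / 4)], whose density is bounded. *)
Lemma tilt_second_order g : hl g -> exists s0 D, [/\ 0 < s0, 0 <= D &
  forall s t, `|s| <= s0 -> 1 <= t ->
    `|ldens C (fun x => expR (- (dot a x - s * g x))) t
      - ldens C (fun x => expR (- dot a x)) t - s * ldens C (expmul g) t| <= D * s ^+ 2].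
Proof.
move=> hg; have [G G0 gG] := hl_bound hg; have [s0 s00 s0P] := tilt_coercive hg.
have q4 : 0 < (4^-1 : R) by rewrite invr_gt0.
have [B B0 BP] := exp_density_bounded q4.
exists s0, (32 * G ^+ 2 * B); split => //.
  by rewrite !mulr_ge0 // sqr_ge0.
move=> s t ss0 t1; have t0 : 0 < t by lra.
have r1 : rapid C (fun x => expR (- (dot a x - s * g x))).
  apply: (@rapid_exp _ _ _ _ (c / 2)); first by rewrite divr_gt0.
  by move=> x Cx; exact: (s0P _ _ ss0 Cx).2.
have r2 : rapid C (fun x => expR (- dot a x)) by exact: rapid_exp cP.
have r3 := expmul_rapid hg.
have r2' := rapidZ (-1) r2; have r3' := rapidZ (- s) r3.
have r12 := rapidD r1 r2'.
rewrite -[- (s * _)]mulNr -[- ldens _ _ _]mulN1r -!ldensZ // -!ldensD //.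
apply: (@le_trans _ _ (32 * G ^+ 2 * s ^+ 2 * B)); last by rewrite mulrAC.
apply: (@le_trans _ _ (32 * G ^+ 2 * s ^+ 2 * ldens C (fun x =>
  expR (- (4^-1 * dot a x))) t)); last first.
  apply: ler_wpM2l; last exact: BP.
  by apply: mulr_ge0; [apply: mulr_ge0 => //|]; exact: sqr_ge0.
rewrite -ldensZ //; last exact: exp_rapid.
apply: ldens_norm_le => //; [exact: rapidD|by apply: rapidZ; exact: exp_rapid|].
move=> x Cx; rewrite /expmul.
have l0 := coercive_ge0 Cx; have [h1 _] := s0P _ _ ss0 Cx; have h2 := gG _ Cx.
move: (dot a x) (g x) l0 h1 h2 => l y l0 h1 h2.
have -> : expR (- (l - s * y)) + -1 * expR (- l) + - s * (y * expR (- l))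
    = expR (- l) * (expR (s * y) - 1 - s * y).
  rewrite opprB expRD; ring.
rewrite normrM ger0_norm ?expR_ge0 //.
apply: le_trans (ler_wpM2l (expR_ge0 _) (expR_sub1Dx_le _)) _.
have e1 : expR `|s * y| <= expR (l / 2) by rewrite ler_expR.
have e2 : (s * y) ^+ 2 <= s ^+ 2 * G ^+ 2 * (32 * expR (l / 4)).
  rewrite exprMn -mulrA ler_wpM2l ?sqr_ge0 //.
  apply: (@le_trans _ _ (G ^+ 2 * l ^+ 2)).
    rewrite -exprMn -[y ^+ 2]real_normK ?num_real //.
    by rewrite lerXn2r ?nnegrE // mulr_ge0.
  by rewrite ler_wpM2l ?sqr_ge0 // sqr_le_expR.
apply: (@le_trans _ _ (expR (- l) * (s ^+ 2 * G ^+ 2 * (32 * expR (l / 4)) * expR (l / 2)))).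
  rewrite ler_wpM2l ?expR_ge0 //; apply: ler_pM => //; rewrite ?sqr_ge0 ?expR_ge0 //.
have -> : expR (- (4^-1 * l)) = expR (- l) * (expR (l / 4) * expR (l / 2)).
  by rewrite -!expRD; congr expR; lra.
by apply: eq_ler; ring.
Qed.

Lemma tilt_cvg g s0 : hl g -> (forall s x, `|s| <= s0 -> C x ->
  c / 2 * nrm x <= dot a x - s * g x) ->
  forall s, `|s| <= s0 -> exists I : R,
  ldens C (fun x => expR (- (dot a x - s * g x))) t @[t --> +oo] --> I.
Proof.
move=> hg H s ss0; have [h [K K0 l]] := tilt_hl s hg.
have c20 : 0 < c / 2 by rewrite divr_gt0.
have [I [_ HI _]] := density_limit C_cone kkP h l K0 c20 (fun x Cx => H s x ss0 Cx).
by exists I.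
Qed.

(* The integral of [g x * expR (- dot a x)] over [C], as a limit of lattice sums. *)
Definition mom g : R := lim (ldens C (expmul g) t @[t --> +oo]).

(** The difference quotient of the densities for [dot a - s g] and [dot a] converges for each fixed
    small [s], and it differs from [ldens C (expmul g) t] by at most [D s], uniformly in [t >= 1].
    The latter is therefore Cauchy. *)
Lemma mom_cvg g : hl g -> ldens C (expmul g) t @[t --> +oo] --> mom g.
Proof.
move=> hg; suff [m Hm] : exists m : R, ldens C (expmul g) t @[t --> +oo] --> m.
  by apply/cvg_ex; exists m.
apply: cvg_of_approx => e e0.
have [s0 s00 s0P] := tilt_coercive hg.
have [s1 [D [s10 D0 DP]]] := tilt_second_order hg.
pose s := Num.min (Num.min s0 s1) (e / (D + 1)).
have sp : 0 < s by rewrite !lt_min s00 s10 divr_gt0 //; lra.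
have ss0 : `|s| <= s0 by rewrite gtr0_norm // !ge_min lexx.
have ss1 : `|s| <= s1 by rewrite gtr0_norm // !ge_min lexx orbT.
have sD : s * D <= e.
  have : s <= e / (D + 1) by rewrite !ge_min lexx orbT.
  by rewrite ler_pdivlMr; [nra|lra].
have [I1 H1] := tilt_cvg hg (fun s x h Cx => (s0P s x h Cx).2) ss0.
have z0 : `|0 : R| <= s0 by rewrite normr0 ltW.
have [I0 H0] := tilt_cvg hg (fun s x h Cx => (s0P s x h Cx).2) z0.
have E0 : (fun x => expR (- (dot a x - 0 * g x))) = (fun x => expR (- dot a x)).
  by apply/funext => x; rewrite mul0r subr0.
rewrite {}E0 in H0.
have aux p q r : `|p - q - s * r| <= D * s ^+ 2 -> `|s^-1 * (p - q) - r| <= e.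
  move=> H; have -> : s^-1 * (p - q) - r = s^-1 * (p - q - s * r).
    by field; rewrite gt_eqF.
  rewrite normrM gtr0_norm ?invr_gt0 // ler_pdivrMl //.
  by apply: le_trans H _; rewrite expr2 mulrCA ler_pM2l // mulrC.
exists (fun t => s^-1 * (ldens C (fun x => expR (- (dot a x - s * g x))) t
      - ldens C (fun x => expR (- dot a x)) t)), (s^-1 * (I1 - I0)); split.
  by apply: cvgMr; apply: cvgB.
near=> t; have t1 : 1 <= t by near: t; apply: nbhs_pinfty_ge; exact: num_real.
exact: aux (DP _ _ ss1 t1).
Unshelve. all: by end_near. Qed.

Lemma mom_uniq g (m : R) : ldens C (expmul g) t @[t --> +oo] --> m -> mom g = m.
Proof. by move=> H; exact: cvg_lim H. Qed.

Lemma eq_mom f g : hl g -> (forall x, C x -> f x = g x) -> mom f = mom g.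
Proof.
move=> hg fg; apply: mom_uniq.
apply: cvg_trans (mom_cvg hg); apply: near_eq_cvg.
near=> t; have t0 : 0 < t by near: t; apply: nbhs_pinfty_gt; exact: num_real.
rewrite /ldens; congr (_ / _); apply: eq_tsum => v; rewrite /lat.
case: asboolP => // Cv; rewrite /expmul fg //.
by apply: (cone_scale C_cone) => //; rewrite invr_ge0 ltW.
Unshelve. all: by end_near. Qed.

Lemma momD f g : hl f -> hl g -> mom (fun x => f x + g x) = mom f + mom g.
Proof.
move=> hf hg; apply: mom_uniq.
apply: cvg_trans (cvgD (mom_cvg hf) (mom_cvg hg)); apply: near_eq_cvg.
near=> t; have t0 : 0 < t by near: t; apply: nbhs_pinfty_gt; exact: num_real.
rewrite -[LHS]/(ldens C (expmul f) t + ldens C (expmul g) t) -ldensD //; try exact: expmul_rapid.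
by congr ldens; apply/funext => x; rewrite /expmul mulrDl.
Unshelve. all: by end_near. Qed.

Lemma momZ s g : hl g -> mom (fun x => s * g x) = s * mom g.
Proof.
move=> hg; apply: mom_uniq.
apply: cvg_trans (cvgMr (mom_cvg hg)); apply: near_eq_cvg.
near=> t; have t0 : 0 < t by near: t; apply: nbhs_pinfty_gt; exact: num_real.
rewrite /= -ldensZ //; last exact: expmul_rapid.
by congr ldens; apply/funext => x; rewrite /expmul mulrA.
Unshelve. all: by end_near. Qed.

Lemma mom_le f g : hl f -> hl g -> (forall x, C x -> f x <= g x) -> mom f <= mom g.
Proof.
move=> hf hg fg; apply: ler_cvg_to (mom_cvg hf) (mom_cvg hg) _.
near=> t; have t0 : 0 < t by near: t; apply: nbhs_pinfty_gt; exact: num_real.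
apply: ldens_le => //; try exact: expmul_rapid.
by move=> x Cx; rewrite /expmul ler_wpM2r ?expR_ge0 // fg.
Unshelve. all: by end_near. Qed.

(* First-order condition: [I(a - s b)] expands to [I(a) + s mom (dot b) + O(s^2)]. *)
Lemma mom_stationary (k b : 'rV[R]_d) (I : 'rV[R]_d -> R) :
  (forall a' c', coercive a' c' -> ldens C (fun x =>
    expR (- dot a' x)) t @[t --> +oo] --> I a') ->
  (forall a' c', coercive a' c' -> I a + dot a k <= I a' + dot a' k) ->
  mom (dot b) = dot b k.
Proof.
move=> Icvg Imin; have hb := dot_hl b.
have [s0 s00 s0P] := tilt_coercive hb.
have [s1 [D [s10 D0 DP]]] := tilt_second_order hb.
have key s : `|s| <= s0 -> `|s| <= s1 -> s * (dot b k - mom (dot b)) <= D * s ^+ 2.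
  move=> ss0 ss1.
  have ec x : dot (a - s *: b) x = dot a x - s * dot b x by rewrite dotBl dotZl.
  have cs : coercive (a - s *: b) (c / 2).
    split; first by rewrite divr_gt0.
    by move=> x Cx; rewrite ec; exact: (s0P _ _ ss0 Cx).2.
  have := Imin _ _ cs; rewrite ec.
  have H1 := Icvg _ _ cs.
  have E1 : (fun x => expR (- dot (a - s *: b) x)) = (fun x => expR (- (dot a x - s * dot b x))).
    by apply/funext => x; rewrite ec.
  rewrite {}E1 in H1.
  have H0 := Icvg _ _ ac; have H2 := mom_cvg hb.
  have H3 : (ldens C (fun x => expR (- (dot a x - s * dot b x))) t
      - ldens C (fun x => expR (- dot a x)) t - s * ldens C (expmul (dot b)) t)
      @[t --> +oo] --> I (a - s *: b) - I a - s * mom (dot b).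
    by apply: cvgB; [exact: cvgB|exact: cvgMr].
  suff : I (a - s *: b) - I a - s * mom (dot b) <= D * s ^+ 2.
    rewrite mulrBr; lra.
  have H4 : (fun=> D * s ^+ 2) t @[t --> (+oo : set_system R)] --> D * s ^+ 2 by exact: cvg_cst.
  apply: (ler_cvg_to H3 H4); near=> t.
  have t1 : 1 <= t by near: t; apply: nbhs_pinfty_ge; exact: num_real.
  exact: le_trans (ler_norm _) (DP _ _ ss1 t1).
apply/eqP; rewrite eq_sym -subr_eq0; apply/eqP; set z := _ - _ in key *.
pose s2 := Num.min s0 s1; have s20 : 0 < s2 by rewrite lt_min s00.
(* [key] at [s] and at [- s] bounds both signs of [z]; dividing by [s] leaves a bound that vanishes
   with [s]. *)
have key2 s : 0 < s -> s <= s2 -> `|z| <= D * s.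
  move=> sp; rewrite le_min => /andP[ss0 ss1].
  have n1 : `|s| = s by rewrite gtr0_norm.
  have n2 : `|- s| = s by rewrite normrN gtr0_norm.
  have k1 := key s; have k2 := key (- s); rewrite n1 in k1; rewrite n2 in k2.
  have {}k1 := k1 ss0 ss1; have {}k2 := k2 ss0 ss1.
  by rewrite ler_norml; apply/andP; split; rewrite -(ler_pM2l sp);
    move: k1 k2; rewrite !expr2; lra.
apply/eqP; rewrite -normr_le0; apply/ler_addgt0Pr => e e0; rewrite add0r.
pose s := Num.min s2 (e / (D + 1)).
have D1 : 0 < D + 1 by lra.
have sp : 0 < s by rewrite lt_min s20 divr_gt0.
apply: le_trans (key2 s sp _) _; first by rewrite ge_min lexx.
have : s <= e / (D + 1) by rewrite ge_min lexx orbT.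
by rewrite ler_pdivlMr //; nra.
Unshelve. all: by end_near. Qed.

End Moments.

(** * Existence of the minimizing functional *)

Section Minimizer.
Context {R : realType} {d : nat} (C : set 'rV[R]_d).
Hypotheses (C_closed : closed C) (C_cone : convex_cone C) (C_pointed : pointed C).
Hypothesis C0 : C 0.
Implicit Types (a b x y : 'rV[R]_d).
Variables (k : 'rV[R]_d) (r : R).
Hypotheses (r0 : 0 < r) (kr : forall y, nrm (y - k) <= r -> C y).
Variable kk : 'rV[int]_d.
Hypothesis kkP : forall y, nrm (y - emb kk) <= d%:R -> C y.
Let sz : R := nrm (emb kk : 'rV[R]_d) + d%:R.

Let sz_ge0 : 0 <= sz.
Proof. by rewrite addr_ge0 ?nrm_ge0. Qed.

Definition exp_dens a : R := lim (ldens C (fun x => expR (- dot a x)) t @[t --> +oo]).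

Lemma exp_densP a c : coercive C a c -> [/\ 0 <= exp_dens a,
  ldens C (fun x => expR (- dot a x)) t @[t --> +oo] --> exp_dens a &
  forall t, 0 < t -> ldens C (fun x => expR (- dot a x)) t <= expR (nrm a * sz / t) * exp_dens a].
Proof.
move=> [c0 cP].
have ah : homog C (dot a) by move=> s x _ _; rewrite dotZr.
have al : lip C (nrm a) (dot a) by move=> x y _ _; exact: dot_lip.
have [I [I0 H HI]] := density_limit C_cone kkP ah al (nrm_ge0 a) c0 cP.
have -> : exp_dens a = I by exact: cvg_lim H.
by split => // t t0; exact: (HI t t0).1.
Qed.

(** Test [a] against the points [k - r sg(a_j) e_j] of [C], one for each coordinate. The bound makes
    sublevel sets of the objective bounded. *)
Lemma nneg_dual_bound a : (forall x, C x -> 0 <= dot a x) -> r * nrm a <= d%:R * dot a k.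
Proof.
move=> aC; rewrite /nrm mulr_sumr.
have -> : d%:R * dot a k = \sum_(j < d) dot a k.
  by rewrite sumr_const card_ord mulr_natl.
apply: ler_sum => j _.
pose e : 'rV[R]_d := (r * Num.sg (a 0 j)) *: delta_mx 0 j.
have ae : dot a e = r * `|a 0 j|.
  rewrite dotZr /dot (bigD1 j) //= big1 ?addr0 => [|i ij].
    by rewrite mxE !eqxx mulr1 normrEsg mulrA.
  by rewrite mxE (negbTE ij) andbF mulr0.
have : C (k - e).
  apply: kr; rewrite addrAC subrr add0r nrmN nrmZ.
  have -> : nrm (delta_mx 0 j : 'rV[R]_d) = 1.
    rewrite /nrm (bigD1 j) //= big1 ?addr0 => [|i ij].
      by rewrite mxE !eqxx normr1.
    by rewrite mxE (negbTE ij) andbF normr0.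
  rewrite mulr1 normrM gtr0_norm //; apply: ler_piMr; first exact: ltW.
  by rewrite normr_sg lern1 leq_b1.
by move=> /aC; rewrite dotBr ae; lra.
Qed.

Lemma dot_continuousl x : continuous (fun a => dot a x).
Proof.
rewrite (_ : (fun a => _) = dot x); last by apply/funext => a; rewrite dotC.
exact: dot_continuous.
Qed.

Lemma exp_dot_continuous x : continuous (fun a => expR (- dot a x)).
Proof.
move=> a; apply: (@continuous_comp _ _ _ (fun a => - dot a x) expR).
  by apply: continuousN; exact: dot_continuousl.
exact: continuous_expR.
Qed.

Let obj a := exp_dens a + dot a k.
Let dom := [set a | exists c, coercive C a c].
Let mu := inf [set obj a | a in dom].

Let k_in : C k.
Proof. by apply: kr; rewrite subrr nrm0 ltW. Qed.

Let obj_ge0 a : dom a -> 0 <= obj a.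
Proof.
move=> [c ac]; have [I0 _ _] := exp_densP ac.
by rewrite /obj addr_ge0 // (coercive_ge0 ac).
Qed.

Let has_inf_obj : has_inf [set obj a | a in dom].
Proof.
split; last by exists 0 => _ [a da <-]; exact: obj_ge0.
have [a [c ac]] := coercive_exists C_closed C_cone C_pointed C0.
by exists (obj a); exists a => //; exists c.
Qed.

Let near_min e := [set a | dom a /\ obj a < mu + e].

(** As [exp_dens >= 0], near-minimizers satisfy [dot a k < mu + 1], so [nneg_dual_bound] confines
    them to the compact ball of radius [M]. *)
Let near_min_cluster (M := d%:R * (mu + 1) / r) :
  exists2 b, nrm b <= M & forall e, 0 < e -> e <= 1 ->
    closure (near_min e `&` [set a | nrm a <= M]) b.
Proof.
pose F := filter_from [set e : R | 0 < e] near_min.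
have FF : ProperFilter F.
  apply: filter_from_proper; last first.
    move=> e /= e0; have [_ [a da <-] H] := inf_adherent e0 has_inf_obj.
    by exists a.
  apply: filter_from_filter; first by exists 1 => /=; exact: ltr01.
  move=> e e' /= e0 e'0; exists (Num.min e e'); first by rewrite /= lt_min e0.
  move=> a [da]; rewrite addr_minr lt_min => /andP[h1 h2].
  by split; split.
have bd a : near_min 1 a -> nrm a <= M.
  move=> [[c ac] oa]; rewrite ler_pdivlMr // mulrC.
  apply: le_trans (nneg_dual_bound _) _; first exact: (coercive_ge0 ac).
  rewrite ler_wpM2l // ltW //; apply: le_lt_trans oa.
  by rewrite /obj lerDr; have [] := exp_densP ac.
have FK : F [set a | nrm a <= M].
  by exists 1; [exact: ltr01|exact: bd].
have cK : compact [set a : 'rV[R]_d | nrm a <= M].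
  apply: (@closed_bounded_compact _ _ _ M) => //.
  apply: (@preimage_closed _ _ (@nrm R d) [set y | y <= M]).
    by move=> x _; exact: nrm_continuous.
  exact: closed_le.
have [b [bM bcl]] := cK F FF FK.
exists b => // e e0 e1; move: bcl; rewrite clusterE; apply.
exists e => // a ae; split => //; apply: bd.
case: ae => da oa; split => //; apply: lt_le_trans oa _; by rewrite lerD2l.
Qed.

(** The objective cannot be passed to the limit directly, since at a cluster point [b] of
    near-minimizers the lattice sums might diverge. Finite partial sums are continuous in the
    functional, so a bound for them, with [mu - dot b k] in place of [exp_dens], survives at [b]
    ([partial]). It forces [b] to be positive on [C] off 0, hence coercive, and letting [t] grow
    then gives [exp_dens b + dot b k <= mu]. *)
Lemma minimizer_exists : exists a c, coercive C a c /\
  forall a' c', coercive C a' c' -> exp_dens a + dot a k <= exp_dens a' + dot a' k.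
Proof.
have [b bM bcl] := near_min_cluster; set M := _ / r in bM bcl.
have sub (Z : set 'rV[R]_d) e : 0 < e -> e <= 1 -> closed Z ->
    (near_min e `&` [set a | nrm a <= M] `<=` Z) -> Z b.
  move=> e0 e1 cZ sZ; rewrite closure_id in cZ; rewrite cZ.
  exact: (closure_subset sZ) (bcl e e0 e1).
have b_ge0 x : C x -> 0 <= dot b x.
  move=> Cx; apply: (sub [set a | 0 <= dot a x] 1) => //.
    apply: (@preimage_closed _ _ (fun a => dot a x) [set y | 0 <= y]).
      by move=> a _; exact: dot_continuousl.
    exact: closed_ge.
  by move=> a [[[c ac] _] _]; exact: (coercive_ge0 ac).
have partial t (F : {fset 'rV[int]_d}) : 0 < t ->
    (\sum_(v <- F) lat C (fun x => expR (- dot b x)) t v) / t ^+ d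
     <= expR (M * sz / t) * (mu - dot b k).
  move=> t0; set E := expR _; have E0 : 0 < E := expR_gt0 _.
  have td0 : 0 < t ^+ d by rewrite exprn_gt0.
  pose h a := (\sum_(v <- F) lat C (fun x => expR (- dot a x)) t v).
  have ch : continuous (fun a => h a / t ^+ d + E * dot a k).
    have c1 : continuous h.
      apply: continuous_sumr => v; rewrite /lat; case: asboolP => _.
        exact: exp_dot_continuous.
      exact: cst_continuous.
    have c2 : continuous (fun a => h a / t ^+ d).
      by move=> a; apply: (@continuousM _ _ h (fun=> _)); [exact: c1|exact: cst_continuous].
    have c3 : continuous (fun a => E * dot a k).
      by move=> a; apply: (@continuousM _ _ (fun=> E) (fun a => dot a k));
        [exact: cst_continuous|exact: dot_continuousl].
    by move=> a; exact: (continuousD (c2 a) (c3 a)).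
  suff H e : 0 < e -> e <= 1 -> h b / t ^+ d + E * dot b k <= E * (mu + e).
    rewrite -subr_ge0 -(pmulr_rge0 _ (_ : 0 < E^-1)) ?invr_gt0 //.
    suff : h b / t ^+ d + E * dot b k <= E * mu.
      by move=> H'; rewrite pmulr_rge0 ?invr_gt0 // subr_ge0 mulrBr -/(h b); lra.
    apply/ler_addgt0Pr => e e0.
    have eE : 0 < Num.min 1 (e / E) by rewrite lt_min ltr01 divr_gt0.
    apply: le_trans (H _ eE _) _; first by rewrite ge_min lexx.
    rewrite mulrDr lerD2l mulrC -ler_pdivlMr // ge_min lexx orbT //.
  move=> e0 e1.
  apply: (sub [set a | h a / t ^+ d + E * dot a k <= E * (mu + e)] e) => //.
    apply: (@preimage_closed _ _ (fun a => h a / t ^+ d + E * dot a k) [set y | y <=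
      E * (mu + e)]).
      by move=> a _; exact: ch.
    exact: closed_le.
  move=> a [[[c ac] oa] aM] /=.
  have [I0 _ /(_ _ t0) HI] := exp_densP ac.
  have ra : rapid C (fun x => expR (- dot a x)) by exact: rapid_exp ac.1 ac.2.
  have h1 : h a / t ^+ d <= E * exp_dens a.
    apply: (@le_trans _ _ (ldens C (fun x => expR (- dot a x)) t)).
      rewrite /ldens ler_pM2r ?invr_gt0 //; apply: sum_le_tsum; last exact: rapid_tsummable.
      by move=> v; apply: lat_ge0 => // x _; exact: expR_ge0.
    apply: le_trans HI _; rewrite ler_wpM2r // ler_expR ler_pM2r ?invr_gt0 //.
    by rewrite ler_wpM2r.
  apply: (@le_trans _ _ (E * obj a)); first by rewrite /obj mulrDr lerD2r.
  by rewrite ler_pM2l // ltW.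
have b_pos x : C x -> x != 0 -> 0 < dot b x.
  move=> Cx x0; rewrite lt_def b_ge0 // andbT; apply/eqP => bx.
  have nx := nrm_gt0 x0.
  (* If [dot b x = 0], lattice points near the multiples of [q x] contradict [partial]: [q] spaces
     them by more than [2 * sz], so that roundings are distinct, and each contributes at least
     [expR (- (nrm b * sz))]. *)
  pose q := (Num.truncn ((2 * sz + 1) / nrm x)).+1.
  have qx : 2 * sz + 1 <= q%:R * nrm x.
    by rewrite -ler_pdivrMr // ltW // truncnS_gt.
  pose y (i : nat) : 'rV[R]_d := emb (map_mx Num.floor ((i * q)%:R *: x) + kk) - (i * q)%:R *: x.
  have yP i : nrm (y i - emb kk) <= d%:R.
    rewrite /y embD addrAC addrK /nrm -[X in _ <= X%:R]card_ord -sumr_const.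
    apply: ler_sum => j _; rewrite !mxE.
    set z := _%:R * _; have := floor_itv z; rewrite intrD => /andP[h1 h2].
    by rewrite ler0_norm; lra.
  have ysz i : nrm (y i) <= sz.
    rewrite -[y i](subrK (emb kk)); apply: le_trans (nrmD _ _) _.
    by rewrite /sz addrC lerD2l.
  pose v (i : nat) : 'rV[int]_d := map_mx Num.floor ((i * q)%:R *: x) + kk.
  have vE i : emb (v i) = (i * q)%:R *: x + y i by rewrite /y addrC subrK.
  have Cv i : C (emb (v i)).
    rewrite vE; apply: (cone_add C_cone); last exact: kkP.
    exact: (cone_scale C_cone).
  have v_neq i j : (i < j)%N -> v i <> v j.
    move=> ij /(congr1 (@emb R d)); rewrite !vE => /eqP.
    rewrite -subr_eq0 opprD addrACA -scalerBl => /eqP H.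
    have : nrm (((i * q)%:R - (j * q)%:R) *: x) = nrm (y i - y j).
      by move/eqP: H; rewrite addr_eq0 => /eqP ->; rewrite nrmN.
    rewrite nrmZ distrC -natrB ?leq_mul2r ?(ltnW ij) ?orbT // -mulnBl normr_nat => H'.
    have : q%:R * nrm x <= 2 * sz.
      apply: (@le_trans _ _ (nrm (y i - y j))).
        rewrite -H' ler_pM2r // ler_nat; rewrite leq_pmull //; lia.
      apply: le_trans (nrmD _ _) _; rewrite nrmN.
      by have := ysz i; have := ysz j; lra.
    lra.
  have vinj : injective v.
    move=> i j vij; case: (ltngtP i j) => // [ij|ji].
      by case: (v_neq _ _ ij).
    by case: (v_neq _ _ ji).
  have : expR (- (nrm b * sz)) <= 0.
    apply: (@le0_of_natmul_bounded _ _ (expR (M * sz) * (mu - dot b k))) => N.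
    have := partial 1 [fset w in map v (index_iota 0 N.+1)]%fset ltr01.
    rewrite expr1n !divr1; apply: le_trans.
    have P : perm_eq [fset w in map v (index_iota 0 N.+1)]%fset (map v (index_iota 0 N.+1)).
      apply: uniq_perm => //; last by move=> w; rewrite !inE.
      by rewrite map_inj_uniq // iota_uniq.
    rewrite (perm_big _ P) big_map.
    have -> : expR (- (nrm b * sz)) * N.+1%:R = \sum_(0 <= i < N.+1) expR (- (nrm b * sz)).
      by rewrite sumr_const_nat subn0 mulr_natr.
    apply: ler_sum => i _; rewrite /lat asboolT // invr1 scale1r ler_expR lerN2.
    rewrite vE dotDr dotZr bx mulr0 add0r.
    apply: le_trans (ler_norm _) _; apply: le_trans (dot_le_nrm _ _) _.
    by rewrite ler_wpM2l ?nrm_ge0.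
  by rewrite leNgt expR_gt0.
have [c c0 cP] := cone_coercive C_closed C_cone b_pos.
have bc : coercive C b c by [].
exists b, c; split => // a' c' ac'.
apply: (@le_trans _ _ mu); last first.
  by apply: (ge_inf has_inf_obj.2); exists a' => //; exists c'.
have [I0 Icvg _] := exp_densP bc.
rewrite -lerBrDr.
have H : expR (M * sz / t) * (mu - dot b k) @[t --> +oo] --> 1 * (mu - dot b k).
  by apply: cvgMl; exact: expR_cvg1.
rewrite -[leRHS]mul1r; apply: (ler_cvg_to Icvg H); near=> t.
have t0 : 0 < t by near: t; apply: nbhs_pinfty_gt; exact: num_real.
have td0 : 0 < t ^+ d by rewrite exprn_gt0.
rewrite /ldens ler_pdivrMr //; apply: tsum_le => [v|F].
  by apply: lat_ge0 => // x _; exact: expR_ge0.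
by rewrite -ler_pdivrMr //; exact: partial.
Unshelve. all: by end_near. Qed.

End Minimizer.

(** By homogeneity the ball around [k] inside the cone grows in proportion to the multiple of
    [k]. *)
Lemma kk_exists {R : realType} {d : nat} (C : set 'rV[R]_d) (k : 'rV[int]_d) (r : R) :
  convex_cone C -> 0 < r -> (forall y, nrm (y - emb k) <= r -> C y) ->
  exists kk : 'rV[int]_d, forall y : 'rV[R]_d, nrm (y - emb kk) <= d%:R -> C y.
Proof.
move=> C_cone r0 kr; pose m := (Num.truncn (d%:R / r)).+1.
have m0 : 0 < m%:R :> R by rewrite ltr0n.
exists (k *+ m) => y; rewrite embMn => yk.
have -> : y = m%:R *: (m%:R^-1 *: y) by rewrite scalerA mulfV ?scale1r // gt_eqF.
apply: (cone_scale C_cone) => //; apply: kr.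
have -> : m%:R^-1 *: y - emb k = m%:R^-1 *: (y - m%:R *: emb k).
  by rewrite scalerBr scalerA mulVf ?scale1r // gt_eqF.
rewrite nrmZ gtr0_norm ?invr_gt0 // ler_pdivrMl //; apply: le_trans yk _.
by rewrite -ler_pdivrMr // ltW // truncnS_gt.
Qed.

(** * Weighted series over the scales [t / (j + 1)] *)

Section MoreSums.
Context {R : realType} {T U : choiceType}.

Lemma tsum_finite_support (c : T -> R) (F : {fset T}) : (forall i, 0 <= c i) ->
  tsummable (fun i => if i \in F then c i else 0) /\
  tsum (fun i => if i \in F then c i else 0) = \sum_(i <- F) c i.
Proof.
move=> c0; set h := fun i => _; have h0 i : 0 <= h i by rewrite /h; case: ifP.
have hF (G : {fset T}) : \sum_(i <- G) h i <= \sum_(i <- F) c i.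
  rewrite /h -big_mkcond /= -big_filter.
  have -> : \sum_(i <- [seq i <- G | i \in F]) c i = \sum_(i <- (G `&` F)%fset) c i.
    apply: perm_big; apply: uniq_perm; rewrite ?filter_uniq //.
    by move=> i; rewrite mem_filter !inE andbC.
  by apply: nneg_sum_subset => //; exact: fsubsetIr.
have sh : tsummable h by exact: tsummable_nneg hF.
split => //; apply/eqP; rewrite eq_le tsum_le //=.
apply: le_trans (sum_le_tsum F h0 sh); rewrite big_seq [leRHS]big_seq.
by apply: ler_sum => i iF; rewrite /h iF.
Qed.

Lemma tsum_pair_summable (f : T -> U -> R) : (forall i j, 0 <= f i j) ->
  tsummable (fun p => f p.1 p.2) ->
  (forall i, tsummable (f i)) /\ tsummable (fun i => tsum (f i)).
Proof.
move=> f0 sf; set M := tsum (fun p => f p.1 p.2).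
have bd (A : {fset T}) (B : {fset U}) : \sum_(i <- A) \sum_(j <- B) f i j <= M.
  by rewrite sum_fset_pair; apply: sum_le_tsum.
have s1 i : tsummable (f i).
  by apply: (@tsummable_nneg _ _ _ M) => // F; have := bd [fset i]%fset F; rewrite big_seq_fset1.
split => //; apply: (@tsummable_nneg _ _ _ M) => [i|A]; first exact: tsum_ge0.
rewrite -(tsum_sum A s1).2; apply: tsum_le => [j|B]; first exact: sumr_ge0.
by rewrite exchange_big.
Qed.

Lemma tsum_swap (f : T -> U -> R) : (forall i j, 0 <= f i j) ->
  tsummable (fun p : T * U => f p.1 p.2) ->
  tsummable (fun p : U * T => f p.2 p.1) /\
  tsum (fun p : U * T => f p.2 p.1) = tsum (fun p : T * U => f p.1 p.2).
Proof.
move=> f0 sf.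
have bd (A : {fset U * T}) : \sum_(p <- A) f p.2 p.1 <= tsum (fun p : T * U => f p.1 p.2).
  apply: (@sum_inj_le_tsum _ _ _ A (fun p => (p.2, p.1)) (fun p : T * U => f p.1 p.2)) => //.
  by move=> [? ?] [? ?] _ _ [-> ->].
have s' : tsummable (fun p : U * T => f p.2 p.1) by apply: tsummable_nneg bd.
split => //; apply/eqP; rewrite eq_le tsum_le //=.
apply: tsum_le => // A.
apply: (@sum_inj_le_tsum _ _ _ A (fun p => (p.2, p.1)) (fun p : U * T => f p.2 p.1)) => //.
by move=> [? ?] [? ?] _ _ [-> ->].
Qed.

End MoreSums.

Section SeriesOfScales.
Context {R : realType}.

Lemma sum_fset_nat_le (f : nat -> R) (F : {fset nat}) n : (forall j, 0 <= f j) ->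
  (forall j, j \in F -> (j < n)%N) -> \sum_(j <- F) f j <= \sum_(j < n) f j.
Proof.
case: n => [|n] f0 Fn.
  rewrite big_seq big1 ?big_ord0 // => j /Fn; by rewrite ltn0.
have -> : \sum_(j <- F) f j = \sum_(j <- F) f (inord j : 'I_n.+1).
  by rewrite big_seq [RHS]big_seq; apply: eq_bigr => j jF; rewrite inordK ?Fn.
apply: (@sum_inj_le_sum R 'I_n.+1 _ F _ (fun j : 'I_n.+1 => f j)) => // i j iF jF.
by move/(congr1 val); rewrite /= !inordK ?Fn.
Qed.

Lemma le_bigmax_fset (F : {fset nat}) j : j \in F -> (j < (\max_(i <- F) i).+1)%N.
Proof. by move=> jF; rewrite ltnS (big_fsetD1 j) //= leq_maxl. Qed.
Implicit Types (c : nat -> R) (w e : R -> R).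

Lemma tsum_geometric (q : R) : 0 <= q < 1 ->
  tsummable (fun j : nat => q ^+ j.+1) /\ tsum (fun j : nat => q ^+ j.+1) = q / (1 - q).
Proof.
move=> /andP[q0 q1]; have q1' : 0 < 1 - q by lra.
have h0 (j : nat) : 0 <= q ^+ j.+1 by exact: exprn_ge0.
have sumE n : \sum_(j < n) q ^+ j.+1 = (q - q ^+ n.+1) / (1 - q).
  elim: n => [|n IH]; first by rewrite big_ord0 expr1 subrr mul0r.
  rewrite big_ord_recr /= IH; apply: (mulIf (lt0r_neq0 q1')).
  by rewrite mulrDl !divfK ?gt_eqF // [q ^+ n.+2]exprS; ring.
have bd (F : {fset nat}) : \sum_(j <- F) q ^+ j.+1 <= q / (1 - q).
  pose n := (\max_(j <- F) j).+1.
  apply: (@le_trans _ _ (\sum_(j < n) q ^+ j.+1)).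
    by apply: (@sum_fset_nat_le (fun j => q ^+ j.+1)) => // j; exact: le_bigmax_fset.
  rewrite sumE ler_pM2r ?invr_gt0 //; have := h0 n; lra.
have s1 : tsummable (fun j : nat => q ^+ j.+1) by exact: tsummable_nneg bd.
split => //; apply/eqP; rewrite eq_le tsum_le //=.
have H n : (q - q ^+ n.+1) / (1 - q) <= tsum (fun j : nat => q ^+ j.+1).
  rewrite -sumE -(big_mkord xpredT (fun j => q ^+ j.+1)).
  have := @sum_inj_le_tsum R _ _ (index_iota 0 n) id (fun j : nat => q ^+ j.+1) h0 s1.
  by apply; rewrite ?iota_uniq //.
have cv : (q - q ^+ n.+1) / (1 - q) @[n --> \oo] --> (q - 0) / (1 - q).
  have cq : q ^+ n @[n --> \oo] --> (0 : R) by apply: cvg_expr; rewrite ger0_norm.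
  have cq1 : q * q ^+ n @[n --> \oo] --> q * 0 by exact: cvgMr.
  rewrite mulr0 in cq1; apply: cvgMl; apply: cvgB; first exact: cvg_cst.
  rewrite (_ : (fun n : nat => q ^+ n.+1) = (fun n => q * q ^+ n)) //.
  by apply/funext => n; rewrite exprS.
rewrite subr0 in cv; apply: (@ler_cvg_to _ _ _ _ _ _ _ _ cv (cvg_cst _)).
by near=> n; exact: H.
Unshelve. all: by end_near. Qed.

(** A finite set [F] carries all but [del / (M + 1)] of [c]. For [j] in [F] the arguments
    [t / (j + 1)] are eventually large, so [b] bounds the factors [|e|] there; off [F] they are
    bounded by [M]. *)
Lemma scale_series_bound c e M b del : (forall j, 0 <= c j) -> tsummable c ->
  (forall t, 0 < t -> `|e t| <= M) -> 0 <= b ->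
  (\forall t \near +oo, `|e t| <= b) -> 0 < del ->
  \forall t \near +oo, tsum (fun j => c j * `|e (t / j.+1%:R)|) <= b * tsum c + del.
Proof.
move=> c0 sc eM b0 eb del0.
have M0 : 0 <= M by exact: le_trans (eM 1 ltr01).
have M1 : 0 < M + 1 by lra.
have d0 : 0 < del / (M + 1) by rewrite divr_gt0.
have [F FP] := tsum_approx c0 sc d0.
pose n := (\max_(j <- F) j).+1.
have jn j : j \in F -> (j < n)%N.
  by move=> jF; rewrite /n ltnS (big_fsetD1 j) //= leq_maxl.
have [s1 E1] := tsum_finite_support F c0.
have [A [Ar AP]] := eb.
have {}AP t : A < t -> `|e t| <= b by exact: AP.
near=> t; have t0 : 0 < t by near: t; exact: nbhs_pinfty_gt.
have tA : `|A| * n%:R < t by near: t; apply: nbhs_pinfty_gt; exact: num_real.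
pose h j := b * c j + M * (c j - (if j \in F then c j else 0)).
have sh : tsummable h.
  apply: tsummableD; first exact: tsummableZ.
  by apply: tsummableZ; apply: tsummableD => //; exact: tsummableN.
have tj j : 0 < t / j.+1%:R by rewrite divr_gt0.
have hP j : c j * `|e (t / j.+1%:R)| <= h j.
  rewrite /h; case: ifPn => jF.
    rewrite subrr mulr0 addr0 mulrC ler_wpM2r //; apply: AP.
    rewrite ltr_pdivlMr //; apply: le_lt_trans tA.
    apply: le_trans (ler_wpM2r (ler0n _ _) (ler_norm _)) _.
    by rewrite ler_wpM2l // ler_nat; exact: jn.
  rewrite subr0 mulrC; apply: ler_wpDl; first exact: mulr_ge0.
  by rewrite ler_wpM2r // eM.
apply: (@le_trans _ _ (tsum h)).
  apply: le_tsum => //; apply: tsummable_le sh => j.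
  by rewrite ger0_norm // mulr_ge0.
rewrite /h tsumD ?tsumZ ?tsumB ?E1 //; last 2 first.
- exact: tsummableZ.
- by apply: tsummableZ; apply: tsummableD => //; exact: tsummableN.
- rewrite lerD2l; have H : tsum c - \sum_(i <- F) c i <= del / (M + 1) by lra.
  apply: le_trans (ler_wpM2l M0 H) _.
  rewrite mulrCA ler_piMr ?(ltW del0) // ler_pdivrMr //; lra.
- by apply: tsummableD => //; exact: tsummableN.
Unshelve. all: by end_near. Qed.

Let scale_summable c e M t : (forall j, 0 <= c j) -> tsummable c ->
  (forall t, 0 < t -> `|e t| <= M) -> 0 < t ->
  tsummable (fun j => c j * e (t / j.+1%:R)).
Proof.
move=> c0 sc eM t0.
apply: tsummable_le (tsummableZ M sc) => j.
by rewrite normrM ger0_norm // mulrC ler_wpM2r // eM // divr_gt0.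
Qed.

(** Dominated convergence: every argument [t / (j + 1)] tends to infinity, and [M * c j]
    dominates. *)
Lemma scale_series_cvg c w M (s : R) : (forall j, 0 <= c j) -> tsummable c ->
  (forall t, 0 < t -> `|w t| <= M) -> w t @[t --> +oo] --> s ->
  tsum (fun j => c j * w (t / j.+1%:R)) @[t --> +oo] --> s * tsum c.
Proof.
move=> c0 sc wM /cvgrPdist_le ws; apply/cvgrPdist_le => eps eps0.
have K0 : 0 <= tsum c by exact: tsum_ge0.
pose b := eps / 2 / (tsum c + 1).
have b0 : 0 < b by rewrite !divr_gt0 //; lra.
have bK : b * tsum c <= eps / 2.
  rewrite /b mulrAC -mulrA ler_piMr ?divr_ge0 ?(ltW eps0) //.
  by rewrite ler_pdivrMr ?mul1r; lra.
pose e t := s - w t.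
have eM t : 0 < t -> `|e t| <= `|s| + M.
  by move=> t0; apply: le_trans (ler_normB _ _) _; rewrite lerD2l wM.
have e20 : 0 < eps / 2 by rewrite divr_gt0.
have := scale_series_bound c0 sc eM (ltW b0) (ws _ b0) e20.
apply: filterS2 (nbhs_pinfty_gt (num_real 0)) => t t0 H.
have se := scale_summable c0 sc eM t0.
have -> : s * tsum c - tsum (fun j => c j * w (t / j.+1%:R))
    = tsum (fun j => c j * e (t / j.+1%:R)).
  rewrite -tsumZ // -tsumB; last 2 first.
  - exact: tsummableZ.
  - exact: scale_summable wM t0.
  by apply: eq_tsum => j; rewrite /e mulrBr [s * _]mulrC.
apply: le_trans (ler_norm_tsum se) _.
rewrite (eq_tsum (g := fun j => c j * `|e (t / j.+1%:R)|)); last first.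
  by move=> j; rewrite normrM ger0_norm.
by apply: le_trans H _; lra.
Qed.

(* Since [c 0 = 1] outweighs the remaining coefficients, the relation
   [sum_j c_j w(t / (j + 1)) -> tau] can be inverted by a contraction argument. *)
Lemma scale_series_inv c w M (tau : R) : (forall j, 0 <= c j) -> tsummable c ->
  c 0%N = 1 -> tsum c <= 7 / 4 -> (forall t, 0 < t -> `|w t| <= M) ->
  tsum (fun j => c j * w (t / j.+1%:R)) @[t --> +oo] --> tau ->
  w t @[t --> +oo] --> tau / tsum c.
Proof.
move=> c0 sc c01 c74 wM /cvgrPdist_le wtau; set K := tsum c.
have K1 : 1 <= K by rewrite -c01; exact: term_le_tsum.
have K0 : 0 < K by lra.
pose e t := w t - tau / K; pose M' := M + `|tau / K|.
have eM t : 0 < t -> `|e t| <= M'.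
  by move=> t0; apply: le_trans (ler_normB _ _) _; rewrite lerD2r wM.
have M'0 : 0 <= M' by exact: le_trans (eM 1 ltr01).
have [s1 E1] := tsum_finite_support [fset 0%N]%fset c0.
rewrite big_seq_fset1 c01 in E1.
pose c' j := c j - (if j \in [fset 0%N]%fset then c j else 0).
have c'0 j : 0 <= c' j by rewrite /c'; case: ifP; rewrite ?subrr ?subr0.
have sc' : tsummable c' by apply: tsummableD => //; exact: tsummableN.
have K' : tsum c' <= 3 / 4 by rewrite tsumB // E1; lra.
have K'0 : 0 <= tsum c' by exact: tsum_ge0.
(* [7/8 = 3/4 + 1/16 + 1/16]: the coefficients past the first, the slack of the series bound, and
   the distance of the full series to [tau]. *)
have step b : 0 < b -> (\forall t \near +oo, `|e t| <= b) ->
    \forall t \near +oo, `|e t| <= 7 / 8 * b.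
  move=> b0 eb; have b16 : 0 < b / 16 by rewrite divr_gt0.
  have H1 := wtau _ b16.
  have H2 := scale_series_bound c'0 sc' eM (ltW b0) eb b16.
  near=> t; have t0 : 0 < t by near: t; exact: nbhs_pinfty_gt.
  have h1 : `|tau - tsum (fun j => c j * w (t / j.+1%:R))| <= b / 16.
    by near: t; exact: H1.
  have h2 : tsum (fun j => c' j * `|e (t / j.+1%:R)|) <= b * tsum c' + b / 16.
    by near: t; exact: H2.
  have sce := scale_summable c0 sc eM t0.
  have sc'e := scale_summable c'0 sc' eM t0.
  have split_e : tsum (fun j => c j * e (t / j.+1%:R))
      = e t + tsum (fun j => c' j * e (t / j.+1%:R)).
    have [s2 E2] := @tsum_finite_support R _ (fun=> 1) [fset 0%N]%fset (fun=> ler01).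
    rewrite big_seq_fset1 in E2.
    rewrite -[e t]mulr1 -[X in _ * X + _]E2 -tsumZ // -tsumD //; last exact: tsummableZ.
    apply: eq_tsum => j; rewrite /c' inE; case: eqP => [->|_].
      by rewrite subrr mul0r addr0 mulr1 c01 divr1 mul1r.
    by rewrite subr0 mulr0 add0r.
  have ce : tsum (fun j => c j * e (t / j.+1%:R))
      = tsum (fun j => c j * w (t / j.+1%:R)) - tau.
    have -> : tau = tau / K * tsum c by rewrite divfK // gt_eqF.
    rewrite -tsumZ // -tsumB; last 2 first.
    - exact: scale_summable wM t0.
    - exact: tsummableZ.
    by apply: eq_tsum => j; rewrite /e mulrBr [_ / K * _]mulrC.
  have h3 : `|tsum (fun j => c' j * e (t / j.+1%:R))| <= b * tsum c' + b / 16.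
    apply: le_trans (ler_norm_tsum sc'e) (le_trans _ h2).
    by apply: eq_ler; apply: eq_tsum => j; rewrite normrM ger0_norm.
  have -> : e t = - (tau - tsum (fun j => c j * w (t / j.+1%:R)))
       - tsum (fun j => c' j * e (t / j.+1%:R)) by rewrite opprB -ce split_e addrK.
  apply: le_trans (ler_normB _ _) _; rewrite normrN.
  have : b * tsum c' <= b * (3 / 4) by rewrite ler_pM2l.
  lra.
have iter_step i : \forall t \near +oo, `|e t| <= (7 / 8) ^+ i * (M' + 1).
  elim: i => [|i IH].
    rewrite mul1r; near=> t; have t0 : 0 < t by near: t; exact: nbhs_pinfty_gt.
    by apply: le_trans (eM _ t0) _; lra.
  rewrite exprS -mulrA; apply: step => //.
  by rewrite mulr_gt0 ?exprn_gt0 //; lra.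
apply/cvgrPdist_le => eps eps0.
have q1 : `|7 / 8 : R| < 1 by rewrite ger0_norm; lra.
have eps1 : 0 < eps / (M' + 1) by rewrite divr_gt0 //; lra.
have /cvgrPdist_le /(_ _ eps1) [i _ iP] := cvg_expr q1.
have := iP i (leqnn i); rewrite sub0r normrN ger0_norm ?exprn_ge0 // => iP'.
apply: filterS (iter_step i) => t H; rewrite distrC; apply: le_trans H _.
by move: iP'; rewrite ler_pdivlMr //; lra.
Unshelve. all: by end_near. Qed.

(** Comparison of [1 / j^2] with the telescoping [1 / (j - 1) - 1 / j] from [j = 3] on keeps the
    sums below [1 + 1/4 + 1/2]. A bound below 2 is what the contraction requires: the terms past the
    first then sum to less than 1. *)
Lemma zeta_bound d : (2 <= d)%N ->
  tsummable (fun j : nat => (j.+1%:R ^+ d)^-1 : R) /\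
  tsum (fun j : nat => (j.+1%:R ^+ d)^-1 : R) <= 7 / 4.
Proof.
move=> d2.
have p0 (j : nat) m : 0 <= (j.+1%:R ^+ m)^-1 :> R by rewrite invr_ge0 exprn_ge0.
have main n : \sum_(j < n.+2) (j.+1%:R ^+ 2)^-1 <= 7 / 4 - n.+2%:R^-1 :> R.
  elim: n => [|n IH].
    rewrite !big_ord_recr big_ord0 /=; lra.
  rewrite big_ord_recr /=; apply: le_trans (lerD IH (lexx _)) _.
  have n2 : 0 < n.+2%:R :> R by rewrite ltr0n.
  have -> : n.+3%:R = n.+2%:R + 1 :> R by rewrite -[n.+3]addn1 natrD.
  move: (n.+2%:R : R) n2 => x x0.
  have x1 : 0 < x + 1 by lra.
  have : (x + 1)^-1 * (x + 1)^-1 <= x^-1 * (x + 1)^-1.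
    by rewrite ler_wpM2r ?invr_ge0 ?(ltW x1) // lef_pV2 ?posrE //; lra.
  have -> : x^-1 * (x + 1)^-1 = x^-1 - (x + 1)^-1.
    by field; rewrite !gt_eqF.
  by rewrite expr2 invfM; lra.
have bd (F : {fset nat}) : \sum_(j <- F) (j.+1%:R ^+ d)^-1 <= 7 / 4 :> R.
  pose n := (\max_(j <- F) j).+2.
  apply: (@le_trans _ _ (\sum_(j < n) (j.+1%:R ^+ 2)^-1)); last first.
    apply: le_trans (main _) _; rewrite lerBlDr lerDl invr_ge0 //.
  apply: (@le_trans _ _ (\sum_(j <- F) (j.+1%:R ^+ 2)^-1)).
    apply: ler_sum => j _; rewrite lef_pV2 ?posrE ?exprn_gt0 //.
    by apply: ler_weXn2l => //; rewrite ler1n.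
  apply: (@sum_fset_nat_le (fun j => (j.+1%:R ^+ 2)^-1)) => j; first exact: p0.
  by move=> /le_bigmax_fset; exact: leqW.
split; first by apply: tsummable_nneg bd => j; exact: p0.
by apply: tsum_le => // j; exact: p0.
Qed.

End SeriesOfScales.

(** * Primitive vectors and sums over them *)

Section Primitive.
Context {d : nat}.
Implicit Types (v p : 'rV[int]_d).

Definition gcdv v : nat := \big[gcdn/0%N]_(j < d) `|v 0%R j|%N.

Definition primv v : bool := gcdv v == 1%N.

Lemma gcdvMn v n : gcdv (v *+ n) = (gcdv v * n)%N.
Proof.
rewrite /gcdv; elim/big_rec2: _ => [|j x y _ ->]; first by rewrite mul0n.
by rewrite mulmxnE -mulr_natr abszM natz absz_nat muln_gcdl.
Qed.

Lemma gcdv_dvd v j : (gcdv v %| `|v 0%R j|)%N.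
Proof. by rewrite /gcdv (bigD1 j) //= dvdn_gcdl. Qed.

Lemma gcdv_eq0 v : gcdv v = 0%N -> v = 0.
Proof.
move=> v0; apply/rowP => j; rewrite mxE; have := gcdv_dvd v j.
by rewrite v0 dvd0n absz_eq0 => /eqP.
Qed.

Lemma gcdv0 : gcdv 0 = 0%N.
Proof. by rewrite -(mulr0n 0) gcdvMn muln0. Qed.

Definition primpart v : 'rV[int]_d := \row_j (v 0%R j %/ gcdv v)%Z.

Lemma primpartK v : primpart v *+ gcdv v = v.
Proof.
apply/rowP => j; rewrite mulmxnE mxE -mulr_natr natz.
by rewrite divzK // dvdzE /= gcdv_dvd.
Qed.

Lemma primpart_prim v : v != 0 -> primv (primpart v).
Proof.
move=> v0; have g0 : (0 < gcdv v)%N.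
  by rewrite lt0n; apply: contra v0 => /eqP/gcdv_eq0 ->.
have := congr1 gcdv (primpartK v); rewrite gcdvMn => /eqP.
by rewrite -{2}[gcdv v]mul1n eqn_pmul2r.
Qed.

Lemma primv_neq0 p : primv p -> p != 0.
Proof. by apply: contraL => /eqP ->; rewrite /primv gcdv0. Qed.

Lemma primv_mul_inj p p' n n' : primv p -> primv p' ->
  p *+ n.+1 = p' *+ n'.+1 -> n = n' /\ p = p'.
Proof.
move=> /eqP pp /eqP pp' E; have := congr1 gcdv E.
rewrite !gcdvMn pp pp' !mul1n => -[nn]; split => //.
apply/rowP => j; move/rowP: E => /(_ j); rewrite !mulmxnE nn -[LHS]mulr_natr -[RHS]mulr_natr.
by apply: mulIf; rewrite natz.
Qed.

End Primitive.

Section PrimitiveSums.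
Context {R : realType} {d : nat} (C : set 'rV[R]_d).
Hypotheses (C_cone : convex_cone C).
Implicit Types (f g : 'rV[R]_d -> R) (v p : 'rV[int]_d) (t : R).

Definition plat f t p : R := if primv p then lat C f t p else 0.

Definition pdens f t : R := tsum (plat f t) / t ^+ d.

Lemma lat_mul f t p n : lat C f t (p *+ n.+1) = lat C f (t / n.+1%:R) p.
Proof.
have n0 : n.+1%:R != 0 :> R by rewrite pnatr_eq0.
rewrite /lat embMn.
have -> : `[< C (n.+1%:R *: emb p) >] = `[< C (emb p) >].
  apply/asboolP/asboolP => Cp; last exact: (cone_scale C_cone).
  have := cone_scale C_cone (_ : 0 <= n.+1%:R^-1) Cp.
  by rewrite scalerA mulVf // scale1r; apply; rewrite invr_ge0.
by case: asboolP => // _; rewrite scalerA invfM invrK.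
Qed.

Variables (f : 'rV[R]_d -> R) (t : R).
Hypotheses (f_ge0 : forall x, C x -> 0 <= f x) (f0 : f 0 = 0) (t0 : 0 < t).
Hypothesis sf : tsummable (lat C f t).

Let G (j : nat) (p : 'rV[int]_d) : R := plat f (t / j.+1%:R) p.

Let G0 j p : 0 <= G j p.
Proof.
rewrite /G /plat; case: ifP => // _; apply: lat_ge0 => //.
by rewrite divr_gt0.
Qed.

Let lat0 v : 0 <= lat C f t v.
Proof. exact: lat_ge0. Qed.

Let sumG_le (A : {fset nat * 'rV[int]_d}) : \sum_(q <- A) G q.1 q.2 <= tsum (lat C f t).
Proof.
rewrite (bigID (fun q => primv q.2)) /= [X in _ + X]big1 ?addr0; last first.
  by move=> q /negbTE np; rewrite /G /plat np.
rewrite (eq_bigr (fun q => lat C f t (q.2 *+ q.1.+1))); last first.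
  by move=> q pp; rewrite lat_mul /G /plat pp.
rewrite -big_filter; apply: (sum_inj_le_tsum lat0 sf).
  exact: filter_uniq (fset_uniq _).
move=> [j p] [j' p']; rewrite !mem_filter /= => /andP[pp _] /andP[pp' _].
by move=> /(primv_mul_inj pp pp')[-> ->].
Qed.

Lemma pairs_summable : tsummable (fun q => G q.1 q.2).
Proof. by apply: tsummable_nneg sumG_le => p; exact: G0. Qed.

(** Each nonzero lattice vector is [(j + 1) p] for one [j] and one primitive [p], and its term at
    scale [t] is that of [p] at scale [t / (j + 1)]. The zero vector contributes [f 0 = 0]. *)
Lemma tsum_lat_prim : tsum (lat C f t) = tsum (fun j => tsum (G j)).
Proof.
have [s1 s2] := tsum_pair_summable G0 pairs_summable.
rewrite -(tsum_pair G0 s1 s2).2; apply/eqP; rewrite eq_le; apply/andP; split; last first.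
  by apply: tsum_le => // p; exact: G0.
apply: tsum_le => // F.
(* The index [j] stands for the multiple [j + 1], hence the predecessor. *)
pose h v := ((gcdv v).-1, primpart v).
rewrite (bigID (fun v => v != 0)) /= [X in _ + X]big1 ?addr0; last first.
  by move=> v /negPn/eqP ->; rewrite /lat emb0 scaler0 f0 if_same.
rewrite (eq_bigr (fun v => G (h v).1 (h v).2)); last first.
  move=> v v0; rewrite /G /plat primpart_prim // -lat_mul /= prednK ?primpartK //.
  by rewrite lt0n; apply: contra v0 => /eqP/gcdv_eq0 ->.
rewrite -big_filter; apply: (sum_inj_le_tsum (f := fun q => G q.1 q.2)) => //.
- exact: pairs_summable.
- exact: filter_uniq (fset_uniq _).
move=> v v'; rewrite !mem_filter => /andP[v0 _] /andP[v'0 _] [E1 E2].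
rewrite -[v]primpartK -[v']primpartK E2; congr (_ *+ _).
have g0 : (0 < gcdv v)%N by rewrite lt0n; apply: contra v0 => /eqP/gcdv_eq0 ->.
have g0' : (0 < gcdv v')%N by rewrite lt0n; apply: contra v'0 => /eqP/gcdv_eq0 ->.
by rewrite -[LHS]prednK // -[RHS]prednK // E1.
Qed.

(** The form from which the primitive densities are recovered: [scale_series_inv] inverts a series
    over the scales [t / (j + 1)]. *)
Lemma ldens_prim : ldens C f t
  = tsum (fun j => (j.+1%:R ^+ d)^-1 * pdens f (t / j.+1%:R)).
Proof.
rewrite /ldens tsum_lat_prim mulrC -tsumZ; last first.
  exact: (tsum_pair_summable G0 pairs_summable).2.
apply: eq_tsum => j; rewrite /pdens expr_div_n invfM invrK.
have j0 : j.+1%:R ^+ d != 0 :> R by rewrite expf_neq0 // pnatr_eq0.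
move: (j.+1%:R ^+ d : R) j0 => x x0.
by rewrite [RHS]mulrCA [x^-1 * _]mulrC -[_ * x * _]mulrA mulfV // mulr1 mulrC.
Qed.

End PrimitiveSums.

(** * Means under the geometric laws *)

Section Means.
Context {R : realType} {d : nat} (C : set 'rV[R]_d).
Hypotheses (d2 : (2 <= d)%N) (C_cone : convex_cone C) (C0 : C 0).
Implicit Types (f g : 'rV[R]_d -> R) (v p : 'rV[int]_d) (t : R).
Variables (a : 'rV[R]_d) (c : R).
Hypothesis ac : coercive C a c.
Variable kk : 'rV[int]_d.
Hypothesis kkP : forall y, nrm (y - emb kk) <= d%:R -> C y.

Definition zeta_coef (m j : nat) : R := (j.+1%:R ^+ m)^-1.

(** With the index shifted by one, this is [zeta(d + 1) / zeta(d)]. *)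
Definition kappa : R := tsum (zeta_coef d.+1) / tsum (zeta_coef d).

Let zc0 m j : 0 <= zeta_coef m j.
Proof. by rewrite invr_ge0 exprn_ge0. Qed.

Let szd : tsummable (zeta_coef d). Proof. exact: (zeta_bound d2).1. Qed.

Let szd1 : tsummable (zeta_coef d.+1). Proof. exact: (zeta_bound (leqW d2)).1. Qed.

Lemma kappa_gt0 : 0 < kappa.
Proof.
have h m : tsummable (zeta_coef m) -> 0 < tsum (zeta_coef m).
  move=> s; apply: lt_le_trans (term_le_tsum 0%N (zc0 m) s).
  by rewrite /zeta_coef expr1n invr1.
by rewrite divr_gt0 // h.
Qed.

(* The expectation of [g / t] for the geometric law of parameter [exp (- dot a p / t)]
   at each primitive [p] of the cone. *)
Definition mean_term g t p : R :=
  if primv p && `[< C (emb p) >]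
  then g (emb p) / t / (expR (dot a (emb p) / t) - 1) else 0.

Section OneFunction.
Variable g : 'rV[R]_d -> R.
Hypotheses (hg : hl C g) (g_ge0 : forall x, C x -> 0 <= g x).

Let f := expmul a g.

Let f_ge0 x : C x -> 0 <= f x.
Proof. by move=> Cx; rewrite /f /expmul mulr_ge0 ?expR_ge0 // g_ge0. Qed.

Let f0 : f 0 = 0.
Proof. by rewrite /f /expmul (hl0 C0 hg) mul0r. Qed.

Let sf t : 0 < t -> tsummable (lat C f t).
Proof. by move=> t0; apply: rapid_tsummable => //; exact: (expmul_rapid C0 ac hg). Qed.

Let plat_ge0 t p : 0 < t -> 0 <= plat C f t p.
Proof. by move=> t0; rewrite /plat; case: ifP => // _; exact: lat_ge0. Qed.

Let plat_le t p : 0 < t -> plat C f t p <= lat C f t p.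
Proof. by move=> t0; rewrite /plat; case: ifP => // _; exact: lat_ge0. Qed.

Let splat t : 0 < t -> tsummable (plat C f t).
Proof.
move=> t0; apply: tsummable_le (sf t0) => p.
by rewrite ger0_norm ?plat_ge0 // plat_le.
Qed.

Let pdens_ge0 t : 0 < t -> 0 <= pdens C f t.
Proof.
by move=> t0; apply: divr_ge0; [apply: tsum_ge0 => p; exact: plat_ge0|apply/exprn_ge0/ltW].
Qed.

(** Small [t] matter because the series over scales reaches [t / (j + 1)] for all [j]. For [t >= 1]
    the full lattice density is a bound. For [t < 1] primitive vectors have norm at least 1, so a
    quarter of the exponent already yields [exp (- c / (4 t))], which beats [t ^ -d]. *)
Lemma pdens_bounded : exists M, forall t, 0 < t -> `|pdens C f t| <= M.
Proof.
have [G G0 gG] := hl_bound C0 ac hg; have [c0 cP] := ac.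
have half : 0 < (2^-1 : R) by rewrite invr_gt0.
have quarter : 0 < (4^-1 : R) by rewrite invr_gt0.
have [B B0 BP] := exp_density_bounded C_cone ac kkP half.
have f_le x : C x -> f x <= 2 * G * expR (- (2^-1 * dot a x)).
  move=> Cx; have l0 := coercive_ge0 ac Cx; rewrite /f /expmul.
  apply: (@le_trans _ _ (G * dot a x * expR (- dot a x))).
    by rewrite ler_wpM2r ?expR_ge0 //; apply: le_trans (gG _ Cx); exact: ler_norm.
  move: (dot a x) l0 => l l0; rewrite -mulrA [2 * G]mulrC -mulrA ler_wpM2l //.
  rewrite (_ : - l = - (l / 2) - (2^-1 * l)); last lra.
  rewrite expRD mulrA ler_wpM2r ?expR_ge0 //.
  apply: le_trans (ler_wpM2r (expR_ge0 _) (le_expR_half l)) _.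
  by rewrite -mulrA -expRD subrr expR0 mulr1.
pose Q := tsum (lat C (fun x => expR (- (4^-1 * dot a x))) 1).
have r4 := exp_rapid ac quarter.
have Q0 : 0 <= Q.
  by apply: tsum_ge0 => v; apply: lat_ge0 => // x _; exact: expR_ge0.
have d0 : 0 < d%:R :> R by rewrite ltr0n; exact: leq_trans d2.
pose M2 := 2 * G * Q * (4 * d%:R / c) ^+ d.
exists (Num.max (2 * G * B) M2) => t t0; rewrite ger0_norm ?pdens_ge0 // le_max.
have [t1|t1] := leP 1 t; apply/orP; [left|right].
  apply: (@le_trans _ _ (ldens C f t)).
    rewrite ler_pM2r ?invr_gt0 ?exprn_gt0 //; apply: le_tsum; [exact: splat|exact: sf|].
    by move=> p; exact: plat_le.
  have r2 := exp_rapid ac half.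
  apply: (@le_trans _ _ (ldens C (fun x => 2 * G * expR (- (2^-1 * dot a x))) t)).
    apply: ldens_le => //; [exact: (expmul_rapid C0 ac hg)|exact: rapidZ].
  rewrite ldensZ //; apply: ler_wpM2l; [by rewrite mulr_ge0|exact: BP].
have key : tsum (plat C f t) <= 2 * G * expR (- (c / (4 * t))) * Q.
  rewrite -tsumZ; last exact: rapid_tsummable.
  apply: le_tsum; [exact: splat|by apply: tsummableZ; exact: rapid_tsummable|].
  move=> p; rewrite /plat.
  have H0 : 0 <= 2 * G * expR (- (c / (4 * t))) by rewrite !mulr_ge0 ?expR_ge0.
  have H1 : 0 <= lat C (fun x => expR (- (4^-1 * dot a x))) 1 p.
    by apply: lat_ge0 => // x _; exact: expR_ge0.
  case: ifPn => [pp|_]; last exact: mulr_ge0.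
  rewrite /lat; case: asboolP => [Cp|_]; last by rewrite mulr0.
  have p1 := nrm_emb_ge1 (R := R) (primv_neq0 pp); have lp := cP _ Cp.
  have ti : 0 <= t^-1 by rewrite invr_ge0 ltW.
  apply: le_trans (f_le _ (cone_scale C_cone ti Cp)) _.
  rewrite -[leRHS]mulrA ler_wpM2l; [|by rewrite mulr_ge0|].
    by [].
  rewrite invr1 scale1r -expRD ler_expR dotZr.
  have ti1 : 1 <= t^-1 by rewrite invf_ge1 // ltW.
  have cl : c <= dot a (emb p).
    by apply: le_trans lp; rewrite ler_peMr // ltW.
  have -> : c / (4 * t) = 4^-1 * (c * t^-1) by rewrite invfM; ring.
  move: (dot a (emb p)) (t^-1) cl ti1 ti => l u cl u1 u0; nra.
rewrite /pdens ler_pdivrMr ?exprn_gt0 //; apply: le_trans key _.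
(* [exp (- z) <= (d / z)^d] with [z = c / (4 t)], from [z / d <= exp (z / d)]. *)
have e1 : expR (- (c / (4 * t))) <= (4 * d%:R / c) ^+ d * t ^+ d.
  rewrite expRN -exprMn; set z := c / (4 * t).
  have z0 : 0 < z by rewrite divr_gt0 // mulr_gt0.
  have -> : 4 * d%:R / c * t = (z / d%:R)^-1.
    by rewrite /z; field; rewrite !gt_eqF.
  have w0 : 0 < z / d%:R by rewrite divr_gt0.
  rewrite exprVn lef_pV2 ?posrE ?exprn_gt0 ?expR_gt0 //.
  have -> : expR z = expR (z / d%:R) ^+ d by rewrite -expRM_natl mulrC divfK // gt_eqF.
  apply: lerXn2r; [by rewrite nnegrE ltW|by rewrite nnegrE expR_ge0|].
  by have := expR_ge1Dx (z / d%:R); lra.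
have GG : 0 <= 2 * G by rewrite mulr_ge0.
apply: le_trans (ler_wpM2r Q0 (ler_wpM2l GG e1)) _.
by apply: eq_ler; rewrite /M2; ring.
Qed.

Lemma pdens_cvg : pdens C f t @[t --> +oo] --> mom C a g / tsum (zeta_coef d).
Proof.
have [M MP] := pdens_bounded.
apply: (@scale_series_inv R (zeta_coef d) _ M _ (zc0 d) szd _ (zeta_bound d2).2 MP).
  by rewrite /zeta_coef expr1n invr1.
apply: cvg_trans (mom_cvg C_cone C0 ac kkP hg); apply: near_eq_cvg.
near=> t; have t0 : 0 < t by near: t; apply: nbhs_pinfty_gt; exact: num_real.
by rewrite -/f (ldens_prim C_cone f_ge0 f0 t0 (sf t0)).
Unshelve. all: by end_near. Qed.

(** Expand [1 / (exp x - 1)] as the geometric series of [exp (- (j + 1) x)] and exchange the sums.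
    By homogeneity [g (p / t)] is [1 / (j + 1)] times the value of [g] at scale [t / (j + 1)], which
    raises the exponent in the coefficients from [d] to [d + 1]. *)
Lemma mean_series t : 0 < t -> tsummable (mean_term g t) /\
  tsum (mean_term g t) / t ^+ d
    = tsum (fun j => zeta_coef d.+1 j * pdens C f (t / j.+1%:R)).
Proof.
move=> t0; pose G j p := plat C f (t / j.+1%:R) p.
have tj j : 0 < t / j.+1%:R by rewrite divr_gt0.
pose H j p := j.+1%:R^-1 * G j p.
have G0 j p : 0 <= G j p by exact: plat_ge0.
have ji j : 0 <= j.+1%:R^-1 :> R by rewrite invr_ge0.
have H0 j p : 0 <= H j p by rewrite mulr_ge0.
have sG := pairs_summable C_cone f_ge0 t0 (sf t0).
have sH : tsummable (fun q => H q.1 q.2).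
  apply: tsummable_le sG => q; rewrite ger0_norm // /H ler_piMl ?G0 //.
  by rewrite invf_le1 // ler1n.
have meanE p : mean_term g t p = tsum (fun j => H j p).
  rewrite /mean_term /H /G /plat; case: (boolP (primv p)) => [pp|_] /=; last first.
    by under eq_tsum do rewrite mulr0; rewrite tsum0.
  rewrite /lat; case: asboolP => [Cp|_]; last first.
    by under eq_tsum do rewrite mulr0; rewrite tsum0.
  have x0 : 0 < dot a (emb p) / t.
    rewrite divr_gt0 //; apply: lt_le_trans (ac.2 _ Cp).
    by rewrite mulr_gt0 ?ac.1 //; apply: nrm_gt0; rewrite emb_eq0 primv_neq0.
  set x := _ / t in x0 *.
  have q01 : 0 <= expR (- x) < 1 by rewrite expR_ge0 expR_lt1; lra.
  have [sq Eq] := tsum_geometric q01.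
  have -> : (expR x - 1)^-1 = tsum (fun j : nat => expR (- x) ^+ j.+1).
    rewrite Eq expRN; have ex : 1 < expR x by rewrite expR_gt1.
    by field; rewrite subr_eq0 !gt_eqF ?expR_gt0.
  rewrite -tsumZ //; apply: eq_tsum => j; rewrite /f /expmul hg.1 //;
    last by rewrite invr_ge0 ltW.
  rewrite dotZr -expRM_natl invfM invrK.
  have -> : - (t^-1 * j.+1%:R * dot a (emb p)) = j.+1%:R * - x by rewrite /x; ring.
  have j0 : j.+1%:R != 0 :> R by rewrite pnatr_eq0.
  by move: (j.+1%:R : R) j0 => y y0; field; rewrite y0 gt_eqF.
have [sH' EH'] := tsum_swap H0 sH.
have H0' p j : 0 <= H j p by [].
have [s1 s2] := @tsum_pair_summable R _ _ (fun p j => H j p) H0' sH'.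
have [s3 s4] := tsum_pair_summable H0 sH.
have -> : mean_term g t = fun p => tsum (fun j => H j p) by apply/funext.
split => //; rewrite -(@tsum_pair R _ _ (fun p j => H j p) H0' s1 s2).2 EH'.
rewrite (tsum_pair H0 s3 s4).2 mulrC -tsumZ //; apply: eq_tsum => j.
rewrite /H tsumZ; last exact: splat.
rewrite /zeta_coef /pdens /G expr_div_n [_ ^+ d.+1]exprS.
have j0 : j.+1%:R != 0 :> R by rewrite pnatr_eq0.
have jd0 : j.+1%:R ^+ d != 0 :> R by rewrite expf_neq0.
have td0 : t ^+ d != 0 by rewrite expf_neq0 // gt_eqF.
move: (t ^+ d) (j.+1%:R ^+ d : R) (j.+1%:R : R) td0 jd0 j0 => u w z u0 w0 z0.
by field; rewrite u0 w0 z0.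
Qed.

Lemma mean_cvg : tsum (mean_term g t) / t ^+ d @[t --> +oo] --> kappa * mom C a g.
Proof.
have [M MP] := pdens_bounded.
have := scale_series_cvg (zc0 d.+1) szd1 MP pdens_cvg.
rewrite (_ : _ * tsum (zeta_coef d.+1) = kappa * mom C a g); last by rewrite /kappa; ring.
apply: cvg_trans; apply: near_eq_cvg.
near=> t; have t0 : 0 < t by near: t; apply: nbhs_pinfty_gt; exact: num_real.
by rewrite (mean_series t0).2.
Unshelve. all: by end_near. Qed.

End OneFunction.

End Means.

(** * Exponential moments of geometric variables *)

Section GeometricLaws.
Context {R : realType}.
Implicit Types (x z u w th : R).

Lemma inv1B_le_expR w : `|w| <= 1 / 4 -> (1 - w)^-1 <= expR (w + w ^+ 2).
Proof.
rewrite ler_norml => /andP[w1 w2]; have w0 : 0 < 1 - w by lra.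
rewrite -[leLHS]mul1r ler_pdivrMr //.
have [wn|wp] := leP w 0.
  have := ler_wpM2r (ltW w0) (expR_ge1Dx (w + w ^+ 2)); apply: le_trans.
  by rewrite expr2; nra.
set u := w + w ^+ 2; have u0 : 0 <= u by rewrite /u expr2; nra.
have h1 := expR_ge1Dx (u / 2).
have -> : expR u = expR (u / 2) * expR (u / 2) by rewrite -expRD; congr expR; lra.
have h2 : (1 + u / 2) * (1 + u / 2) <= expR (u / 2) * expR (u / 2) by apply: ler_pM => //; lra.
have := ler_wpM2r (ltW w0) h2; apply: le_trans.
have -> : (1 + u / 2) * (1 + u / 2) * (1 - w)
   = 1 + w ^+ 2 * ((1 - w) * (1 + w) ^+ 2 / 4 - w).
  by rewrite /u; field.
rewrite lerDl mulr_ge0 ?sqr_ge0 //.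
rewrite expr2; nra.
Qed.

Lemma norm_expR_sub1_le z : `|expR z - 1| <= `|z| * expR `|z|.
Proof.
have h1 := expR_ge1Dx z; have h2 := expR_ge1Dx (- z).
have ee : expR z * expR (- z) = 1 by rewrite -expRD subrr expR0.
have e0 := expR_gt0 z.
have [z0|z0] := leP 0 z.
  have e1 : 1 <= expR z by lra.
  rewrite !ger0_norm //; last by lra.
  have := ler_wpM2l (ltW e0) h2; rewrite ee; nra.
have e1 : expR z <= 1 by rewrite -expR0 ler_expR ltW.
have e2 : 1 <= expR (- z) by lra.
rewrite ler0_norm ?subr_le0 // ltr0_norm //.
have : - z * 1 <= - z * expR (- z) by rewrite ler_pM2l //; lra.
lra.
Qed.

Lemma expR_sub1_ge x : 0 <= x -> x / 2 * expR (x / 2) <= expR x - 1.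
Proof.
move=> x0; have h := expR_ge1Dx (x / 2).
have -> : expR x = expR (x / 2) * expR (x / 2) by rewrite -expRD; congr expR; lra.
nra.
Qed.

(** The left side is the moment generating function of a geometric variable; it equals [1 / (1 - w)]
    with [w = (exp z - 1) / (exp x - 1)]. The first order is [z] times the mean [1 / (exp x - 1)].
    Of the constant 12, 8 comes from the second order of [exp z] and 4 from [w ^ 2]. The factor
    [expR (- (x / 8))] keeps the remainder summable over the primitive vectors. *)
Lemma tilted_ratio_le x z th : 0 < x -> 0 <= th -> th <= 1 / 8 -> `|z| <= th * x ->
  (1 - expR (- x)) / (1 - expR (- (x - z)))
    <= expR (z / (expR x - 1) + 12 * th ^+ 2 * expR (- (x / 8))).
Proof.
move=> x0 th0 th8 zth.
have D0 : 0 < expR x - 1 by rewrite subr_gt0 expR_gt1.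
have z8 : `|z| <= x / 8 by nra.
have ez8 : expR `|z| <= expR (x / 8) by rewrite ler_expR.
pose e := expR (x / 8).
have e0 : 0 < e := expR_gt0 _.
have e1 : 1 <= e by have := expR_ge1Dx (x / 8); rewrite /e; lra.
have eX n : expR (n%:R * (x / 8)) = e ^+ n by rewrite /e expRM_natl.
have e4 : expR (x / 2) = e ^+ 4 by rewrite -eX; congr expR; lra.
have eN : expR (- (x / 8)) = e^-1 by rewrite expRN.
have D1 : x / 2 * e ^+ 4 <= expR x - 1 by rewrite -e4; apply/expR_sub1_ge/ltW.
pose w := (expR z - 1) / (expR x - 1).
have wth : `|w| <= 2 * th * e^-1.
  rewrite normrM [X in _ * X <= _]gtr0_norm ?invr_gt0 // ler_pdivrMr //.
  apply: le_trans (norm_expR_sub1_le _) _.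
  apply: (@le_trans _ _ (th * x * e)); first by apply: ler_pM => //; exact: expR_ge0.
  have te : 0 <= 2 * th * e^-1 by rewrite !mulr_ge0 // invr_ge0 ltW.
  apply: le_trans (ler_wpM2l te D1).
  have -> : 2 * th * e^-1 * (x / 2 * e ^+ 4) = th * x * e ^+ 3.
    by field; rewrite gt_eqF.
  rewrite ler_wpM2l //; first by rewrite mulr_ge0 // ltW.
  by rewrite -[leLHS]expr1 ler_weXn2l.
have ei1 : e^-1 <= 1 by rewrite invf_le1.
have ei0 : 0 < e^-1 by rewrite invr_gt0.
have w4 : `|w| <= 1 / 4.
  apply: le_trans wth _; have : 2 * th * e^-1 <= 2 * th * 1 by rewrite ler_wpM2l //; lra.
  lra.
have ratioE : (1 - expR (- x)) / (1 - expR (- (x - z))) = (1 - w)^-1.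
  have ex0 := expR_gt0 x.
  have zx : z < x by have := ler_norm z; lra.
  have E : 1 - w = (1 - expR (- (x - z))) / (1 - expR (- x)).
    rewrite /w opprB expRD !expRN; field.
    have h1 : expR x != 0 by rewrite gt_eqF.
    have h2 : expR x - 1 != 0 by rewrite gt_eqF.
    by rewrite ?h1 ?h2.
  by rewrite E invf_div.
rewrite ratioE; apply: le_trans (inv1B_le_expR w4) _; rewrite ler_expR.
have w2 : w ^+ 2 <= 4 * th ^+ 2 * e^-1.
  rewrite -[w ^+ 2]real_normK ?num_real //.
  apply: (@le_trans _ _ ((2 * th * e^-1) ^+ 2)).
    by rewrite lerXn2r ?nnegrE // !mulr_ge0 // ltW.
  rewrite exprMn (_ : (2 * th) ^+ 2 = 4 * th ^+ 2); last by ring.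
  rewrite ler_wpM2l ?mulr_ge0 ?sqr_ge0 //.
  by rewrite expr2 ler_piMl // ltW.
have w1 : w <= z / (expR x - 1) + 8 * th ^+ 2 * e^-1.
  have -> : z / (expR x - 1) + 8 * th ^+ 2 * e^-1
     = (z + 8 * th ^+ 2 * e^-1 * (expR x - 1)) / (expR x - 1).
    by field; rewrite !gt_eqF.
  rewrite /w ler_pM2r ?invr_gt0 //.
  have h1 : expR z - 1 - z <= z ^+ 2 * expR `|z|.
    exact: le_trans (ler_norm _) (expR_sub1Dx_le z).
  suff : z ^+ 2 * expR `|z| <= 8 * th ^+ 2 * e^-1 * (expR x - 1) by lra.
  have h2 : z ^+ 2 <= (th * x) ^+ 2.
    by rewrite -[z ^+ 2]real_normK ?num_real // lerXn2r ?nnegrE // mulr_ge0 // ltW.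
  apply: (@le_trans _ _ ((th * x) ^+ 2 * e)).
    by apply: ler_pM; rewrite ?sqr_ge0 ?expR_ge0.
  have t2 : 0 <= 8 * th ^+ 2 * e^-1 by rewrite !mulr_ge0 ?sqr_ge0 // ltW.
  apply: le_trans (ler_wpM2l t2 D1).
  have -> : 8 * th ^+ 2 * e^-1 * (x / 2 * e ^+ 4) = th ^+ 2 * x * e * (4 * e ^+ 2).
    by field; rewrite gt_eqF.
  have -> : (th * x) ^+ 2 * e = th ^+ 2 * x * e * x by ring.
  rewrite ler_wpM2l //; first by rewrite !mulr_ge0 ?sqr_ge0 // ltW.
  rewrite -eX; have := expR_ge1Dx (2 * (x / 8)); lra.
by rewrite eN; lra.
Qed.

Lemma prod1B_ge (I : finType) (u : I -> R) : (forall i, 0 <= u i <= 1) ->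
  1 - \sum_i u i <= \prod_i (1 - u i).
Proof.
move=> u01; suff : 1 - \sum_i u i <= \prod_i (1 - u i) /\ 0 <= \prod_i (1 - u i) <= 1 by case.
elim/big_ind2: _ => [|a b c e [h1 /andP[h2 h3]] [h4 /andP[h5 h6]]|i _].
- by rewrite subr0 lexx ler01.
- split; first by nra.
  by apply/andP; split; nra.
- by have /andP[? ?] := u01 i; split; [|apply/andP; split]; lra.
Qed.

Lemma sum_ffun_exp (I : finType) B (y : I -> R) :
  \sum_(om : {ffun I -> 'I_B.+1}) expR (- \sum_i (om i)%:R * y i)
    = \prod_i \sum_(j < B.+1) expR (- y i) ^+ j.
Proof.
rewrite bigA_distr_bigA; apply: eq_bigr => om _.
rewrite -sumrN expR_sum; apply: eq_bigr => i _.
by rewrite -expRM_natl mulrN.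
Qed.

Lemma sum_geometricE (q : R) n : q != 1 -> \sum_(j < n) q ^+ j = (1 - q ^+ n) / (1 - q).
Proof.
move=> q1; have q1' : 1 - q != 0 by rewrite subr_eq0 eq_sym.
apply: (mulIf q1'); rewrite divfK // mulrC.
by have := subrX1 q n; lra.
Qed.

(** Both sums factor over [I]. On the left the truncated geometric sums are enlarged to full series
    and [tilted_ratio_le] applies factor by factor; on the right truncation at [B] costs at most the
    factor 2. *)
Lemma chernoff_exp (I : finType) B (x z : I -> R) th :
  0 <= th -> th <= 1 / 8 -> (forall i, 0 < x i) -> (forall i, `|z i| <= th * x i) ->
  1 / 2 <= \prod_i (1 - expR (- x i) ^+ B.+1) ->
  \sum_(om : {ffun I -> 'I_B.+1}) expR (- \sum_i (om i)%:R * (x i - z i))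
  <= 2 * expR (\sum_i z i / (expR (x i) - 1) + 12 * th ^+ 2 * \sum_i expR (- (x i / 8)))
     * \sum_(om : {ffun I -> 'I_B.+1}) expR (- \sum_i (om i)%:R * x i).
Proof.
move=> th0 th8 x0 zx hB; rewrite !sum_ffun_exp.
have q1 i : expR (- x i) < 1 by rewrite expR_lt1 oppr_lt0.
have xz i : 0 < x i - z i.
  by have := ler_norm (z i); have := zx i; have := x0 i; nra.
have q2 i : expR (- (x i - z i)) < 1 by rewrite expR_lt1 oppr_lt0.
set S := (X in _ <= _ * expR X * _).
have -> : expR S = \prod_i expR (z i / (expR (x i) - 1) + 12 * th ^+ 2 * expR (- (x i / 8))).
  by rewrite -expR_sum big_split /= -mulr_sumr.
have -> : \prod_i \sum_(j < B.+1) expR (- x i) ^+ j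
   = (\prod_i (1 - expR (- x i) ^+ B.+1)) * \prod_i (1 - expR (- x i))^-1.
  rewrite -big_split; apply: eq_bigr => i _ /=.
  by rewrite sum_geometricE // lt_eqF.
apply: (@le_trans _ _ ((\prod_i expR (z i / (expR (x i) - 1) + 12 * th ^+ 2 * expR (- (x i / 8))))
    * \prod_i (1 - expR (- x i))^-1)).
  rewrite -big_split /=; apply: ler_prod => i _; apply/andP; split.
    by apply: sumr_ge0 => j _; rewrite exprn_ge0 ?expR_ge0.
  have q1' : 0 < 1 - expR (- x i) by rewrite subr_gt0.
  apply: (@le_trans _ _ ((1 - expR (- (x i - z i)))^-1)).
    by apply: sum_geometric_le; rewrite expR_ge0 q2.
  rewrite ler_pdivlMr // mulrC.
  exact: tilted_ratio_le.
have P0 : 0 <= \prod_i (1 - expR (- x i))^-1.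
  by apply: prodr_ge0 => i _; rewrite invr_ge0 subr_ge0 ltW.
have Q0 : 0 <= \prod_i expR (z i / (expR (x i) - 1) + 12 * th ^+ 2 * expR (- (x i / 8))).
  by apply: prodr_ge0 => i _; exact: expR_ge0.
set p := \prod_i expR _ in Q0 *; set s := \prod_i (1 - _ ^+ _) in hB *.
set q := \prod_i _^-1 in P0 *.
have s1 : 1 <= 2 * s by lra.
have := ler_wpM2l (mulr_ge0 Q0 P0) s1; rewrite mulr1 => /le_trans; apply.
by apply: eq_ler; ring.
Qed.

Lemma truncation_exists (I : finType) (x : I -> R) : (forall i, 0 < x i) ->
  exists B0, forall B, (B0 <= B)%N -> 1 / 2 <= \prod_i (1 - expR (- x i) ^+ B.+1).
Proof.
move=> x0; have q1 i : expR (- x i) < 1 by rewrite expR_lt1 oppr_lt0.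
pose e : R := (2 * #|I|.+1%:R)^-1.
have e0 : 0 < e by rewrite invr_gt0 mulr_gt0.
have H i : exists N, forall n, (N <= n)%N -> expR (- x i) ^+ n <= e.
  have qn : `|expR (- x i)| < 1 by rewrite ger0_norm ?expR_ge0.
  have /cvgrPdist_le /(_ _ e0) [N _ NP] := cvg_expr qn.
  exists N => n Nn; have := NP n Nn.
  by rewrite sub0r normrN ger0_norm ?exprn_ge0 ?expR_ge0.
have [N NP] := choice H.
exists (\max_i N i) => B BN.
apply: le_trans (prod1B_ge _); last first.
  move=> i; rewrite exprn_ge0 ?expR_ge0 // exprn_ile1 ?expR_ge0 //.
  exact: ltW.
have : \sum_i expR (- x i) ^+ B.+1 <= \sum_(i : I) e.
  apply: ler_sum => i _; apply: NP; apply: leqW; apply: leq_trans BN.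
  exact: leq_bigmax.
rewrite sumr_const -mulr_natl.
suff : #|I|%:R * e <= 1 / 2 by lra.
rewrite /e invfM mulrCA mul1r ler_piMr ?invr_ge0 //.
by rewrite ler_pdivrMr // mul1r ler_nat.
Qed.

End GeometricLaws.

(** * Chernoff bounds for random configurations *)

Local Notation config V B := {ffun V -> 'I_B.+1}.

Section Deviations.
Context {R : realType} {d : nat} (C : set 'rV[R]_d).
Hypotheses (d2 : (2 <= d)%N) (C_cone : convex_cone C) (C0 : C 0).
Implicit Types (g : 'rV[R]_d -> R) (p : 'rV[int]_d) (t e del : R) (V : {fset 'rV[int]_d}).
Variables (a : 'rV[R]_d) (c : R).
Hypothesis ac : coercive C a c.
Variable kk : 'rV[int]_d.
Hypothesis kkP : forall y, nrm (y - emb kk) <= d%:R -> C y.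

Local Notation kap := (@kappa R d).

Definition gsum g V B (om : config V B) : R :=
  \sum_(p : V) (om p)%:R * g (emb (val p)).

Definition weight t V B (om : config V B) : R := expR (- (gsum (dot a) om / t)).

Definition prims_in V := forall p, p \in V -> primv p /\ C (emb p).

(** The loss of 1 is negligible against [t^d]. Controlling [dot a] is enough, since every
    homogeneous Lipschitz function is bounded by a multiple of it. *)
Definition almost_all t V := prims_in V /\
  tsum (mean_term C a (dot a) t) - 1 <= \sum_(p <- V) mean_term C a (dot a) t p.

(** Under the product of the geometric laws over [V], no multiplicity exceeds [B] with probability
    at least 1/2. *)
Definition truncated t V B := 1 / 2 <= \prod_(p : V) (1 -
  expR (- (dot a (emb (val p)) / t)) ^+ B.+1).

Lemma prim_dot_gt0 p : primv p -> C (emb p) -> 0 < dot a (emb p).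
Proof.
move=> pp Cp; apply: lt_le_trans (ac.2 _ Cp).
by rewrite mulr_gt0 ?ac.1 //; apply: nrm_gt0; rewrite emb_eq0 primv_neq0.
Qed.

Lemma almost_all_exists t (F : {fset 'rV[int]_d}) : 0 < t ->
  exists V, almost_all t V /\ forall p, p \in F -> primv p -> C (emb p) -> p \in V.
Proof.
move=> t0; have hd := dot_hl C a; have d0 := coercive_ge0 ac.
have [s _] := mean_series C_cone C0 ac hd d0 t0.
have m0 p : 0 <= mean_term C a (dot a) t p.
  rewrite /mean_term; case: ifP => // /andP[pp /asboolP Cp].
  by rewrite !divr_ge0 ?d0 ?(ltW t0) // subr_ge0 -expR0 ler_expR divr_ge0 ?d0 // ltW.
have [G GP] := tsum_approx m0 s ltr01.
pose V := [fset p in (G `|` F)%fset | primv p && `[< C (emb p) >]]%fset.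
exists V; split; last first.
  by move=> p pF pp /asboolP Cp; rewrite !inE pF orbT pp Cp.
split; first by move=> p; rewrite !inE => /and3P[_ pp /asboolP].
apply: (le_trans (ltW GP)); apply: (@le_trans _ _ (\sum_(p <- (G `|` F)%fset) mean_term C a
  (dot a) t p)).
  by apply: nneg_sum_subset => //; exact: fsubsetUl.
rewrite [leLHS](bigID (mem V)) /= [X in _ + X <= _]big_seq_cond [X in _ + X <= _]big1 ?addr0;
  last first.
  move=> p /andP[pGF]; rewrite !inE in pGF *; rewrite pGF /= => /negbTE h.
  by rewrite /mean_term h.
apply: eq_ler; rewrite -big_filter; apply: perm_big; apply: uniq_perm.
- exact: filter_uniq (fset_uniq _).
- exact: fset_uniq.
move=> p; rewrite mem_filter !inE.
by case: (_ || _); rewrite ?andbT ?andbF.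
Qed.

(** Restricting a sum to [V] decreases it only for nonnegative terms, so [g] is written as
    [h - G dot a] with [h = g + G dot a >= 0]: the sum of [h] over [V] is at most the full one, and
    the sum of [dot a] that is subtracted is almost full. *)
Lemma sum_mean_le g e : hl C g -> 0 < e -> \forall t \near +oo, forall V,
  almost_all t V ->
  \sum_(p : V) g (emb (val p)) / t / (expR (dot a (emb (val p)) / t) - 1)
    <= (kap * mom C a g + e) * t ^+ d.
Proof.
move=> hg e0; have [G G0 gG] := hl_bound C0 ac hg.
have hd := dot_hl C a; have hG := hlZ G hd; have hh := hlD hg hG.
set h := fun x => _ in hh.
have h0 x : C x -> 0 <= h x.
  by move=> Cx; have := gG _ Cx; rewrite /h ler_norml => /andP[]; lra.
have d0 := coercive_ge0 ac.
pose e1 := e / (2 * (G + 2)).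
have e10 : 0 < e1 by rewrite divr_gt0 // mulr_gt0 //; lra.
have /cvgrPdist_le /(_ _ e10) H1 := mean_cvg d2 C_cone C0 ac kkP hh h0.
have /cvgrPdist_le /(_ _ e10) H2 := mean_cvg d2 C_cone C0 ac kkP hd d0.
near=> t => V [Vp Vt].
have t0 : 0 < t by near: t; apply: nbhs_pinfty_gt; exact: num_real.
have t1 : 1 <= t by near: t; apply: nbhs_pinfty_ge; exact: num_real.
have t2 : G / e1 <= t by near: t; apply: nbhs_pinfty_ge; exact: num_real.
have h1 : `|kap * mom C a h - tsum (mean_term C a h t) / t ^+ d| <= e1.
  by near: t; exact: H1.
have h2 : `|kap * mom C a (dot a) - tsum (mean_term C a (dot a) t) / t ^+ d| <= e1.
  by near: t; exact: H2.
have td0 : 0 < t ^+ d by rewrite exprn_gt0.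
have tdt : t <= t ^+ d by rewrite -[leLHS]expr1 ler_weXn2l // (leq_trans _ d2).
have x0 p : p \in V -> 0 < expR (dot a (emb p) / t) - 1.
  by move=> /Vp[pp Cp]; rewrite subr_gt0 expR_gt1 divr_gt0 // prim_dot_gt0.
have mtE f p : p \in V -> mean_term C a f t p = f (emb p) / t / (expR (dot a (emb p) / t) - 1).
  by move=> /Vp[pp Cp]; rewrite /mean_term pp asboolT.
have -> : \sum_(p : V) g (emb (val p)) / t / (expR (dot a (emb (val p)) / t) - 1)
   = \sum_(p <- V) mean_term C a h t p - G * \sum_(p <- V) mean_term C a (dot a) t p.
  rewrite -(big_seq_fsetE _ V xpredT (fun p =>
    g (emb p) / t / (expR (dot a (emb p) / t) - 1))) /=.
  rewrite mulr_sumr -sumrB [LHS]big_seq [RHS]big_seq; apply: eq_bigr => p pV.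
  by rewrite !mtE // /h; ring.
have [s1 _] := mean_series C_cone C0 ac hh h0 t0.
have m0 p : 0 <= mean_term C a h t p.
  rewrite /mean_term; case: ifP => // /andP[pp /asboolP Cp].
  by rewrite !divr_ge0 ?h0 ?(ltW t0) // subr_ge0 -expR0 ler_expR divr_ge0 ?d0 // ltW.
have k1 := sum_le_tsum V m0 s1.
have k2 : tsum (mean_term C a h t) <= (kap * mom C a h + e1) * t ^+ d.
  by rewrite -ler_pdivrMr //; move: h1; rewrite ler_norml => /andP[]; lra.
have k3 : (kap * mom C a (dot a) - e1) * t ^+ d <= tsum (mean_term C a (dot a) t).
  by rewrite -ler_pdivlMr //; move: h2; rewrite ler_norml => /andP[]; lra.
have mh : mom C a h = mom C a g + G * mom C a (dot a).
  by rewrite (momD C_cone C0 ac kkP hg hG) (momZ C_cone C0 ac kkP _ hd).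
have k4 : G <= e1 * t ^+ d.
  by rewrite mulrC -ler_pdivrMr //; exact: le_trans tdt.
have k5 : G * ((kap * mom C a (dot a) - e1) * t ^+ d - 1)
   <= G * \sum_(p <- V) mean_term C a (dot a) t p.
  by rewrite ler_wpM2l //; lra.
have k6 : e1 * (G + 2) = e / 2 by rewrite /e1; field; rewrite gt_eqF //; lra.
rewrite mh in k2; move: k1 k2 k5 k4 k6.
move: (\sum_(p <- V) _) (\sum_(p <- V) _) (tsum _) => S1 S2 S3.
move: (t ^+ d) (kap) (mom C a g) (mom C a (dot a)) td0 => T kp mg ml T0 k1 k2 k5 k4 k6.
apply: (@le_trans _ _ (kp * mg * T + (e1 * (G + 2)) * T)); first by nra.
by rewrite k6; nra.
Unshelve. all: by end_near. Qed.

(** Exponential Markov inequality with the tilt [z = y g / t]. Exceeding the mean by [del] gains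
    [y del t^d] in the exponent; the error in the mean and the quadratic term [D y^2] cost at most
    [y del / 4] each, which leaves the rate [del y / 2]. *)
Lemma upper_deviation g del : hl C g -> 0 < del -> exists2 eta, 0 < eta &
  \forall t \near +oo, forall V B, almost_all t V -> truncated t V B ->
  \sum_(om : config V B | (kap * mom C a g + del) * t ^+ d.+1 <= gsum g om)
     weight t om <= 2 * expR (- (eta * t ^+ d)) * \sum_(om : config V B) weight t om.
Proof.
move=> hg del0; have [G G0 gG] := hl_bound C0 ac hg.
have e8 : 0 < (8^-1 : R) by rewrite invr_gt0.
have [E E0 EP] := exp_density_bounded C_cone ac kkP e8.
pose D := 12 * G ^+ 2 * E.
have D0 : 0 <= D by rewrite !mulr_ge0 ?sqr_ge0.
(* The first bound gives [y * G <= 1 / 8], as [chernoff_exp] requires, the second makes the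
   quadratic term small. *)
pose y := Num.min (8 * (G + 1))^-1 (del / (4 * (D + 1))).
have G8 : 0 < 8 * (G + 1) by rewrite mulr_gt0 //; lra.
have D4 : 0 < 4 * (D + 1) by rewrite mulr_gt0 //; lra.
have y0 : 0 < y by rewrite lt_min invr_gt0 G8 divr_gt0.
have yG : y * G <= 1 / 8.
  have : y <= (8 * (G + 1))^-1 by rewrite ge_min lexx.
  rewrite -[leRHS]mul1r ler_pdivlMr //.
  by nra.
have yD : D * y <= del / 4.
  have : y <= del / (4 * (D + 1)) by rewrite ge_min lexx orbT.
  rewrite ler_pdivlMr //.
  by nra.
exists (del * y / 2); first by rewrite !mulr_gt0.
have del4 : 0 < del / 4 by rewrite divr_gt0.
have Hm := sum_mean_le hg del4.
near=> t => V B aV tV.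
have t0 : 0 < t by near: t; apply: nbhs_pinfty_gt; exact: num_real.
have t1 : 1 <= t by near: t; apply: nbhs_pinfty_ge; exact: num_real.
have hm : \sum_(p : V) g (emb (val p)) / t / (expR (dot a (emb (val p)) / t) - 1)
    <= (kap * mom C a g + del / 4) * t ^+ d.
  by move: V aV {tV}; near: t; exact: Hm.
have td0 : 0 < t ^+ d by rewrite exprn_gt0.
have Vp := aV.1.
pose x (p : V) := dot a (emb (val p)) / t.
pose z (p : V) := y * (g (emb (val p)) / t).
have x0 (p : V) : 0 < x p.
  by have [pp Cp] := Vp _ (valP p); rewrite /x divr_gt0 // prim_dot_gt0.
have zx (p : V) : `|z p| <= y * G * x p.
  have [pp Cp] := Vp _ (valP p); rewrite /z /x.
  rewrite normrM gtr0_norm // -mulrA ler_pM2l // normrM (gtr0_norm (_ : 0 < t^-1)) ?invr_gt0 //.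
  by rewrite mulrA ler_pM2r ?invr_gt0 // gG.
have yG0 : 0 <= y * G by rewrite mulr_ge0 // ltW.
have := chernoff_exp yG0 yG x0 zx tV.
have WE : \sum_(om : config V B) expR (- \sum_i (om i)%:R * x i) =
  \sum_(om : config V B) weight t om.
  apply: eq_bigr => om _; rewrite /weight /gsum mulr_suml; congr (expR (- _)).
  by apply: eq_bigr => p _; rewrite /x mulrA.
rewrite {}WE; set Z := \sum_(om : config V B) weight t om.
have Z0 : 0 <= Z by apply: sumr_ge0 => om _; exact: expR_ge0.
set S := (X in expR X) => ch.
set L := (kap * mom C a g + del) * t ^+ d.+1.
have mk : expR (y * L / t) * (\sum_(om : config V B | L <= gsum g om) weight t om)
   <= \sum_(om : config V B) expR (- \sum_i (om i)%:R * (x i - z i)).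
  rewrite [leRHS](bigID (fun om => L <= gsum g om)) /= mulr_sumr.
  apply: ler_wpDr; first by apply: sumr_ge0 => om _; exact: expR_ge0.
  apply: ler_sum => om Lg; rewrite /weight -expRD ler_expR.
  have -> : \sum_i (om i)%:R * (x i - z i) = gsum (dot a) om / t - y * gsum g om / t.
    rewrite /gsum mulr_suml -mulrA mulr_suml mulr_sumr -sumrB; apply: eq_bigr => p _.
    by rewrite /x /z; ring.
  rewrite opprB lerD2r ler_pM2r ?invr_gt0 // ler_pM2l //.
have SP : S <= y * (kap * mom C a g + del / 4) * t ^+ d + D * y ^+ 2 * t ^+ d.
  rewrite /S; apply: lerD.
    have -> : \sum_i z i / (expR (x i) - 1) =
      y * \sum_(p : V) g (emb (val p)) / t / (expR (dot a (emb (val p)) / t) - 1).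
      by rewrite mulr_sumr; apply: eq_bigr => p _; rewrite /z /x !mulrA.
    by rewrite -mulrA ler_pM2l.
  have -> : D * y ^+ 2 * t ^+ d = 12 * (y * G) ^+ 2 * (E * t ^+ d) by rewrite /D; ring.
  apply: ler_wpM2l; first by rewrite mulr_ge0 // sqr_ge0.
  have := EP _ t1; rewrite /ldens ler_pdivrMr //; apply: le_trans.
  have -> : \sum_i expR (- (x i / 8)) = \sum_(p <- V) lat C (fun w =>
    expR (- (8^-1 * dot a w))) t p.
    rewrite big_seq_fsetE /=; apply: eq_bigr => p _; have [pp Cp] := Vp _ (valP p).
    rewrite /lat asboolT // dotZr /x; congr (expR (- _)); ring.
  apply: sum_le_tsum.
    by move=> p; apply: lat_ge0 => // w _; exact: expR_ge0.
  exact: (rapid_tsummable C_cone (exp_rapid ac e8) t0).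
have fin : \sum_(om : config V B | L <= gsum g om) weight t om
    <= expR (- (y * L / t)) * (2 * expR S * Z).
  rewrite -(ler_pM2l (expR_gt0 (y * L / t))) [leRHS]mulrA -expRD subrr expR0 mul1r.
  exact: le_trans mk ch.
apply: le_trans fin _; rewrite mulrA; apply: ler_wpM2r => //.
rewrite mulrCA ler_pM2l // -expRD ler_expR.
have -> : y * L / t = y * (kap * mom C a g + del) * t ^+ d.
  by rewrite /L exprS; field; rewrite gt_eqF.
have key : D * y ^+ 2 <= del / 4 * y by rewrite expr2 mulrA ler_pM2r.
move: key SP; move: (t ^+ d) (kap * mom C a g) td0 => T K T0 key SP.
have key2 : D * y ^+ 2 * T <= del / 4 * y * T by rewrite ler_pM2r.
lra.
Unshelve. all: by end_near. Qed.

Lemma deviation g del : hl C g -> 0 < del -> exists2 eta, 0 < eta &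
  \forall t \near +oo, forall V B, almost_all t V -> truncated t V B ->
  \sum_(om : config V B | del * t ^+ d.+1 <= `|gsum g om - kap * mom C a g * t ^+ d.+1|)
     weight t om <= 4 * expR (- (eta * t ^+ d)) * \sum_(om : config V B) weight t om.
Proof.
move=> hg del0; have hn := hlZ (-1) hg.
have [e1 e10 H1] := upper_deviation hg del0.
have [e2 e20 H2] := upper_deviation hn del0.
rewrite (momZ C_cone C0 ac kkP _ hg) in H2.
exists (Num.min e1 e2); first by rewrite lt_min e10.
near=> t => V B aV tV.
have t0 : 0 < t by near: t; apply: nbhs_pinfty_gt; exact: num_real.
have td0 : 0 < t ^+ d by rewrite exprn_gt0.
have h1 : \sum_(om : config V B | (kap * mom C a g + del) * t ^+ d.+1 <= gsum g om)
     weight t om <= 2 * expR (- (e1 * t ^+ d)) * \sum_(om : config V B) weight t om.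
  by move: V B aV tV; near: t; exact: H1.
have h2 : \sum_(om : config V B | (kap * (-1 * mom C a g) + del) * t ^+ d.+1 <=
  gsum (fun x => -1 * g x) om)
     weight t om <= 2 * expR (- (e2 * t ^+ d)) * \sum_(om : config V B) weight t om.
  by move: V B aV tV {h1}; near: t; exact: H2.
set Z := \sum_(om : config V B) weight t om in h1 h2 *.
have Z0 : 0 <= Z by apply: sumr_ge0 => om _; exact: expR_ge0.
have W0 (om : config V B) : 0 <= weight t om by exact: expR_ge0.
have gN (om : config V B) : gsum (fun x => -1 * g x) om = - gsum g om.
  by rewrite /gsum -sumrN; apply: eq_bigr => p _; ring.
have cover (om : config V B) :
  (if del * t ^+ d.+1 <= `|gsum g om - kap * mom C a g * t ^+ d.+1| then weight t om else 0)
  <= (if (kap * mom C a g + del) * t ^+ d.+1 <= gsum g om then weight t om else 0)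
   + (if (kap * (-1 * mom C a g) + del) * t ^+ d.+1 <=
     gsum (fun x => -1 * g x) om then weight t om else 0).
  rewrite gN lerNr; case: ifPn => [H|_]; last by rewrite addr_ge0 //; case: ifP.
  move: H; rewrite ler_normr => /orP[H|H].
    by rewrite ifT; [rewrite lerDl; case: ifP|lra].
  by rewrite [X in _ <= _ + X]ifT; [rewrite lerDr; case: ifP|lra].
rewrite big_mkcond /=; apply: le_trans (ler_sum _ (fun om _ => cover om)) _.
rewrite big_split /= -!big_mkcond /=; apply: le_trans (lerD h1 h2) _.
have m1 : expR (- (e1 * t ^+ d)) <= expR (- (Num.min e1 e2 * t ^+ d)).
  by rewrite ler_expR lerN2 ler_pM2r // ge_min lexx.
have m2 : expR (- (e2 * t ^+ d)) <= expR (- (Num.min e1 e2 * t ^+ d)).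
  by rewrite ler_expR lerN2 ler_pM2r // ge_min lexx orbT.
have k1 := ler_wpM2r Z0 m1; have k2 := ler_wpM2r Z0 m2.
by rewrite -!mulrA; lra.
Unshelve. all: by end_near. Qed.

End Deviations.

(** * Zonotopes with finitely many generators and their support functions *)

Lemma big_option (M : nmodType) (I : finType) (F : option I -> M) :
  \sum_o F o = F None + \sum_i F (Some i).
Proof.
rewrite (bigD1 None) //=; congr (_ + _).
rewrite (reindex_omap Some id) /=; first by apply: eq_bigl => i; rewrite eqxx.
by case.
Qed.

Section FiniteZonotopes.
Context {R : realType} {d : nat}.
Implicit Types (x y u w : 'rV[R]_d).

Definition zon (I : finType) (v : I -> 'rV[R]_d) : set 'rV[R]_d :=
  [set x | exists al : I -> R, (forall i, 0 <= al i <= 1) /\ x = \sum_i al i *: v i].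

Lemma zon_zonotope (I : finType) (v : I -> 'rV[R]_d) :
  zonotope (fun i : 'I_#|I| => v (enum_val i)) = zon v.
Proof.
apply/seteqP; split => x [al [al01 ->]].
  exists (fun i => al (enum_rank i)); split => //.
  rewrite [RHS](reindex (@enum_val I predT)) /=; last first.
    exact: onW_bij (enum_val_bij _).
  by apply: eq_bigr => i _; rewrite enum_valK.
exists (fun i => al (enum_val i)); split => //.
by rewrite [LHS](reindex (@enum_val I predT)) //; exact: onW_bij (enum_val_bij _).
Qed.

Lemma zonotope_zon m (v : 'I_m -> 'rV[R]_d) : zonotope v = zon v.
Proof. by []. Qed.

Definition support (I : finType) (v : I -> 'rV[R]_d) u : R :=
  \sum_i Num.max 0 (dot u (v i)).

Lemma zon_support_ub (I : finType) (v : I -> 'rV[R]_d) u x :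
  zon v x -> dot u x <= support v u.
Proof.
move=> [al [al01 ->]]; rewrite dot_sumr; apply: ler_sum => i _.
rewrite dotZr; have /andP[a0 a1] := al01 i.
by have [h|h] := leP 0 (dot u (v i)); nra.
Qed.

Lemma zon_support_attained (I : finType) (v : I -> 'rV[R]_d) u :
  exists2 x, zon v x & dot u x = support v u.
Proof.
pose al i : R := (0 <= dot u (v i))%R%:R.
exists (\sum_i al i *: v i).
  by exists al; split => // i; rewrite /al ler0n lern1 leq_b1.
rewrite dot_sumr; apply: eq_bigr => i _; rewrite dotZr /al.
by have [h|h] := leP 0 (dot u (v i)); rewrite ?mul1r ?mul0r.
Qed.

Lemma zon_support_inj (I J : finType) (v : I -> 'rV[R]_d) (w : J -> 'rV[R]_d) :
  zon v = zon w -> support v =1 support w.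
Proof.
move=> vw u; apply/eqP; rewrite eq_le; apply/andP; split.
  by have [x vx <-] := zon_support_attained v u; apply: zon_support_ub; rewrite -vw.
by have [x wx <-] := zon_support_attained w u; apply: zon_support_ub; rewrite vw.
Qed.

Lemma small_eps (I : eqType) (s : seq I) (A B : I -> R) :
  (forall i, i \in s -> 0 < A i) ->
  exists2 e, 0 < e & forall i, i \in s -> e * `|B i| < A i.
Proof.
elim: s => [|i s IH] H; first by exists 1.
have [|e e0 eP] := IH; first by move=> j js; apply: H; rewrite inE js orbT.
have Ai : 0 < A i by apply: H; rewrite inE eqxx.
have b1 : 0 < `|B i| + 1 by have := normr_ge0 (B i); lra.
exists (Num.min e (A i / (`|B i| + 1))); first by rewrite lt_min e0 divr_gt0.
move=> j; rewrite inE => /orP[/eqP ->|js]; last first.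
  by apply: le_lt_trans (eP _ js); rewrite ler_wpM2r // ge_min lexx.
apply: (@le_lt_trans _ _ (A i / (`|B i| + 1) * `|B i|)).
  by rewrite ler_wpM2r // ge_min lexx orbT.
by rewrite mulrAC ltr_pdivrMr // ltr_pM2l //; lra.
Qed.

(** In the orthogonal complement of [x0] each [x] of the list excludes only a proper subspace. A
    vector that is good for the earlier [x] but fails for the next one is perturbed by [e *: w],
    with [e] too small to spoil the earlier ones. *)
Lemma generic_orthogonal x0 (s : seq 'rV[R]_d) :
  (forall x, x \in s -> exists w, dot w x0 = 0 /\ dot w x != 0) ->
  exists u, dot u x0 = 0 /\ forall x, x \in s -> dot u x != 0.
Proof.
elim: s => [|x s IH] H; first by exists 0; split => //; rewrite dotC dot0r.
have [|u [u0 us]] := IH; first by move=> y ys; apply: H; rewrite inE ys orbT.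
have [|w [w0 wx]] := H x; first by rewrite inE eqxx.
have [ux|ux] := eqVneq (dot u x) 0; last first.
  by exists u; split => // y; rewrite inE => /orP[/eqP ->|]; [|exact: us].
have [|e e0 eP] := @small_eps _ s (fun y => `|dot u y|) (fun y => dot w y).
  by move=> y ys; rewrite normr_gt0 us.
exists (u + e *: w); rewrite dotDl dotZl u0 w0 mulr0 addr0; split => // y.
rewrite inE dotDl dotZl => /orP[/eqP ->|ys].
  by rewrite ux add0r mulf_neq0 // gt_eqF.
apply/eqP => H0; have := eP _ ys.
have -> : `|dot u y| = e * `|dot w y|.
  by rewrite (_ : dot u y = - (e * dot w y)) ?normrN ?normrM ?(gtr0_norm e0) //; lra.
by rewrite ltxx.
Qed.

Lemma nonparallel_orthogonal x0 x : x0 != 0 -> (forall lam, x != lam *: x0) ->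
  exists w, dot w x0 = 0 /\ dot w x != 0.
Proof.
move=> x00 npar; pose lam := dot x x0 / dot x0 x0.
have xx : dot x0 x0 != 0 by apply: contra x00 => /eqP/dotxx_eq0 ->.
exists (x - lam *: x0); have h : dot (x - lam *: x0) x0 = 0.
  by rewrite dotBl dotZl /lam divfK // subrr.
split => //; apply/eqP => h2; have := npar lam; rewrite -subr_eq0.
by rewrite (@dotxx_eq0 _ _ (x - lam *: x0)) ?eqxx // dotBr dotZr h h2 mulr0 subrr.
Qed.

(* The kinks of [u |-> max 0 <u, x_i>] lie on pairwise distinct hyperplanes: a second
   difference across a generic point of the hyperplane of [x_i] isolates [c i]. *)
Lemma kink_independence (I : finType) (x : I -> 'rV[R]_d) (c : I -> R) :
  (forall i, x i != 0) -> (forall i j lam, i != j -> x j != lam *: x i) ->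
  (forall u, \sum_i c i * Num.max 0 (dot u (x i)) = 0) -> forall i, c i = 0.
Proof.
move=> x0 npar H i0.
pose s := [seq x i | i <- enum I & i != i0].
have [|u [u0 us]] := @generic_orthogonal (x i0) s.
  move=> y /mapP[i]; rewrite mem_filter => /andP[ii _] ->.
  by apply: nonparallel_orthogonal => // lam; apply: npar; rewrite eq_sym.
have us' i : i != i0 -> dot u (x i) != 0.
  by move=> ii; apply: us; apply: map_f; rewrite mem_filter ii mem_enum.
have [|e e0 eP] := @small_eps _ [seq i <- enum I | i != i0]
    (fun i => `|dot u (x i)|) (fun i => dot (x i0) (x i)).
  by move=> i; rewrite mem_filter => /andP[ii _]; rewrite normr_gt0 us'.
have := H (u + e *: x i0); have := H (u - e *: x i0); have := H u.
rewrite !(bigD1 i0 (P := xpredT)) //= => h0 h1 h2.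
(* Away from [i0] the sign of [<u, x_i>] survives the perturbation, so these terms are linear there
   and have no second difference. *)
have rest : \sum_(i | i != i0) c i * Num.max 0 (dot (u + e *: x i0) (x i))
   + \sum_(i | i != i0) c i * Num.max 0 (dot (u - e *: x i0) (x i))
   = 2 * \sum_(i | i != i0) c i * Num.max 0 (dot u (x i)).
  rewrite mulr_sumr -big_split /=; apply: eq_bigr => i ii.
  have := eP i; rewrite mem_filter ii mem_enum => /(_ isT).
  rewrite -{1}(gtr0_norm e0) -normrM dotDl dotBl dotZl.
  move: (e * _) (dot u _) => y z; rewrite ltr_norml.
  have [z0|z0] := leP 0 z.
    by rewrite ger0_norm // => /andP[? ?]; rewrite !max_r; first [ring|lra].
  by rewrite ltr0_norm // => /andP[? ?]; rewrite !max_l; first [ring|lra].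
have xx : 0 < dot (x i0) (x i0).
  by rewrite lt_def dotxx_ge0 andbT; apply/eqP => /dotxx_eq0/eqP; rewrite (negbTE (x0 i0)).
have d1 : dot (u + e *: x i0) (x i0) = e * dot (x i0) (x i0).
  by rewrite dotDl dotZl u0 add0r.
have d2 : dot (u - e *: x i0) (x i0) = - (e * dot (x i0) (x i0)).
  by rewrite dotBl dotZl u0 sub0r.
rewrite u0 maxxx mulr0 add0r in h0; rewrite d2 in h1; rewrite d1 in h2.
have ex : 0 < e * dot (x i0) (x i0) by rewrite mulr_gt0.
rewrite max_l in h1; last by lra.
rewrite max_r in h2; last exact: ltW.
rewrite mulr0 add0r in h1; rewrite h0 mulr0 h1 addr0 in rest.
move: h2; rewrite rest addr0 => /eqP; rewrite mulf_eq0 => /orP[/eqP //|].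
by rewrite gt_eqF.
Qed.

(** Segments in the same direction add up to one segment. Its coefficient is the weighted mean of
    the original ones; conversely the coefficient of a class is given to all its members. A
    generator in no class has [c i = 0] and contributes nothing. *)
Lemma zon_merge (I J : finType) (c : I -> R) (y : I -> 'rV[R]_d) (x : J -> 'rV[R]_d)
    (om := fun j => \sum_(i | y i == x j) c i) :
  injective x -> (forall i, 0 <= c i) ->
  (forall i, c i != 0 -> exists j, y i = x j) ->
  zon (fun i => c i *: y i) = zon (fun j => om j *: x j) /\
  \sum_i c i *: y i = \sum_j om j *: x j.
Proof.
move=> xinj c0 cx.
have merge (al : I -> R) : \sum_i al i *: (c i *: y i)
    = \sum_j (\sum_(i | y i == x j) al i * c i) *: x j.
  under [RHS]eq_bigr do rewrite scaler_suml.
  rewrite (exchange_big_dep xpredT) //=; apply: eq_bigr => i _.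
  rewrite scalerA; have [->|ci] := eqVneq (c i) 0.
    by rewrite mulr0 scale0r big1 // => j _; rewrite scale0r.
  have [j yj] := cx i ci; rewrite (bigD1 j) ?yj //= big1 ?addr0 // => j' /andP[/eqP jj' nj].
  by case/negP: nj; apply/eqP; apply: xinj.
have om0 j : 0 <= om j by apply: sumr_ge0.
split; last first.
  have := merge (fun=> 1); under eq_bigr do rewrite scale1r.
  by move=> ->; apply: eq_bigr => j _; congr (_ *: _); apply: eq_bigr => i _; rewrite mul1r.
apply/seteqP; split => z [al [al01 ->]].
  exists (fun j => (\sum_(i | y i == x j) al i * c i) / om j); split => [j|].
    have le1 : \sum_(i | y i == x j) al i * c i <= om j.
      by apply: ler_sum => i _; have /andP[? ?] := al01 i; rewrite ler_piMl.
    have ge0 : 0 <= \sum_(i | y i == x j) al i * c i.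
      by apply: sumr_ge0 => i _; have /andP[? ?] := al01 i; rewrite mulr_ge0.
    have [->|omj] := eqVneq (om j) 0; first by rewrite invr0 mulr0 lexx ler01.
    have omp : 0 < om j by rewrite lt_def omj om0.
    by rewrite divr_ge0 //= ler_pdivrMr // mul1r.
  rewrite merge; apply: eq_bigr => j _; rewrite scalerA; congr (_ *: _).
  have [omj|omj] := eqVneq (om j) 0; last by rewrite divfK.
  rewrite omj mulr0; apply: big1 => i yi.
  have : c i = 0.
    apply/eqP; rewrite eq_le c0 andbT -omj /om (bigD1 i) //= lerDl.
    exact: sumr_ge0.
  by move=> ->; rewrite mulr0.
exists (fun i => if [pick j | y i == x j] is Some j then al j else 0); split => [i|].
  by case: pickP => [j _|_] //; rewrite lexx ler01.
rewrite merge; apply: eq_bigr => j _; rewrite scalerA; congr (_ *: _).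
rewrite mulr_sumr; apply: eq_bigr => i /eqP yi; congr (_ * _).
case: pickP => [j' /eqP|/(_ j)]; last by rewrite yi eqxx.
by rewrite yi => /xinj ->.
Qed.

End FiniteZonotopes.

(** * Integral zonotopes as configurations *)

Section LatticeZonotopes.
Context {R : realType} {d : nat} (C : set 'rV[R]_d).
Hypotheses (C_cone : convex_cone C) (C_pointed : pointed C) (C0 : C 0).
Variables (a : 'rV[R]_d) (c : R).
Hypothesis ac : coercive C a c.
Implicit Types (p q : 'rV[int]_d) (V : {fset 'rV[int]_d}).

Definition gen V B (om : config V B) (p : V) : 'rV[R]_d :=
  (om p)%:R *: emb (val p).

Definition endpt V B (om : config V B) : 'rV[int]_d :=
  \sum_(p : V) val p *+ om p.

Lemma endpt_emb V B (om : config V B) : emb (endpt om) = \sum_p gen om p.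
Proof.
rewrite /endpt (big_morph (@emb R d) (@embD R d) (@emb0 R d)).
by apply: eq_bigr => p _; rewrite embMn.
Qed.

(** Pointedness forces [lam > 0]. A nonzero coordinate then turns proportionality into an equality
    between positive integer multiples of [p] and [q], and taking gcds makes the multipliers
    equal. *)
Lemma prim_nonparallel p q (lam : R) : primv p -> primv q -> C (emb p) -> C (emb q) ->
  p != q -> emb q != lam *: emb p.
Proof.
move=> pp pq Cp Cq; apply: contra => /eqP E.
have p0 : emb p != 0 :> 'rV[R]_d by rewrite emb_eq0 primv_neq0.
have q0 : emb q != 0 :> 'rV[R]_d by rewrite emb_eq0 primv_neq0.
have lam0 : 0 < lam.
  rewrite ltNge; apply/negP => lamN.
  have lamN' : lam < 0.
    rewrite lt_def lamN andbT eq_sym; apply: contra q0 => /eqP l0.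
    by rewrite E l0 scale0r.
  apply: (pointed_opp C_cone C_pointed Cp p0).
  have -> : - emb p = (- lam^-1) *: emb q.
    by rewrite E scalerA mulNr mulVf ?scaleN1r // lt_eqF.
  by apply: (cone_scale C_cone) => //; rewrite oppr_ge0 invr_le0 ltW.
have /existsP[j pj] : [exists j, p 0 j != 0].
  apply: contraNT (primv_neq0 pp) => /existsPn vn; apply/eqP/rowP => j; rewrite mxE.
  by apply/eqP; have := vn j; rewrite negbK.
have Ej : (q 0 j)%:~R = lam * (p 0 j)%:~R by have /rowP/(_ j) := E; rewrite !mxE.
have nj : `|q 0 j|%:R = lam * `|p 0 j|%:R :> R.
  by rewrite !natr_absz !intr_norm Ej normrM (gtr0_norm lam0).
have EE : q *+ `|p 0%R j|%N = p *+ `|q 0%R j|%N.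
  apply: (@emb_inj R); rewrite !embMn nj E scalerA [lam * _]mulrC //.
have pj0 : (0 < `|p 0%R j|)%N by rewrite absz_gt0.
have qj0 : (0 < `|q 0%R j|)%N.
  by rewrite -(ltr0n R) nj mulr_gt0 // ltr0n.
rewrite -(prednK pj0) -(prednK qj0) in EE.
by have [_ ->] := primv_mul_inj pq pp EE.
Qed.

(* The extra generator [y] may be parallel to some element of [V]; it is known, so the
   remaining generators are still determined. *)
Definition padded V B (om : config V B) (y : 'rV[R]_d) (o : option V) : 'rV[R]_d :=
  if o is Some p then gen om p else y.

(** The contribution of [y] cancels from the two support functions, and the coefficients of the
    remaining difference vanish by [kink_independence]. *)
Lemma padded_inj V B (om om' : config V B) y : prims_in C V ->
  zon (padded om y) = zon (padded om' y) -> om = om'.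
Proof.
move=> Vp /zon_support_inj H.
suff E (p : V) : (om p)%:R - (om' p)%:R = 0 :> R.
  apply/ffunP => p; apply: val_inj; apply/eqP.
  by rewrite -(eqr_nat R) -subr_eq0 E.
move: p; apply: (@kink_independence _ _ _ (fun p : V => emb (val p))) => [p|p q lam pq|u].
- by have [pp _] := Vp _ (valP p); rewrite emb_eq0 primv_neq0.
- have [pp Cp] := Vp _ (valP p); have [qq Cq] := Vp _ (valP q).
  by apply: prim_nonparallel => //; rewrite (inj_eq val_inj).
have := H u; rewrite /support !big_option /= => /addrI E.
have maxM (n : nat) (z : R) : Num.max 0 (n%:R * z) = n%:R * Num.max 0 z.
  by rewrite maxr_pMr // mulr0.
under eq_bigr do rewrite mulrBl -!maxM; rewrite sumrB.
by apply/eqP; rewrite subr_eq0; apply/eqP; move: E; rewrite /gen;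
  under eq_bigr do rewrite dotZr; under [X in _ = X]eq_bigr do rewrite dotZr.
Qed.

Lemma padded_zonotopes V B (om : config V B) (y K : 'rV[int]_d) :
  prims_in C V -> C (emb y) -> endpt om + y = K ->
  zonotopes C (emb K) (zon (padded om (emb y))).
Proof.
move=> Vp Cy EK.
exists #|{: option V}|, (fun i => padded om (emb y) (enum_val i)); split.
- move=> i; case: (enum_val i) => [p|] /=; last by split => //; exact: emb_integral.
  rewrite /gen -embMn; split; first exact: emb_integral.
  by rewrite embMn; apply: (cone_scale C_cone) => //; exact: (Vp _ (valP p)).2.
- by rewrite zon_zonotope.
rewrite -(big_enum_val (padded om (emb y))) /= big_option /= -endpt_emb -embD.
by rewrite addrC EK.
Qed.

Lemma bounded_lattice_fset (M : nat) : exists F : {fset 'rV[int]_d},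
  forall p, (forall j, (`|p 0%R j| <= M)%N) -> p \in F.
Proof.
pose h (g : {ffun 'I_d -> 'I_(M + M).+1}) : 'rV[int]_d := \row_j ((g j : nat)%:Z - M%:Z).
exists [fset h g | g : {ffun 'I_d -> 'I_(M + M).+1}]%fset => p pM.
apply/imfsetP; exists [ffun j => inord `|(p 0 j + M%:Z)%R|%N] => //.
apply/rowP => j; rewrite mxE ffunE; move: (p 0 j) (pM j) => z zM.
by rewrite inordK; lia.
Qed.

(** As [dot a >= 0] on the cone, every generator lies below the endpoint in [dot a]. By coercivity
    this bounds the norm of its primitive part, which therefore belongs to [V], and likewise the
    multiplicities, so that [B] suffices. Generators with the same primitive part are then
    merged. *)
Lemma zonotopes_gen V B (K : 'rV[int]_d) (T : set 'rV[R]_d) : prims_in C V ->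
  (forall p, primv p -> C (emb p) -> c * nrm (emb p : 'rV[R]_d) <= dot a (emb K) -> p \in V) ->
  dot a (emb K) <= c * B%:R ->
  zonotopes C (emb K) T ->
  exists2 om : config V B, endpt om = K & T = zon (gen om).
Proof.
move=> Vp Vall KB [m [v [vC -> vK]]].
have [c0 cP] := ac.
have /choice[w wE] : forall i, exists w, v i = emb w.
  by move=> i; apply: integral_emb; exact: (vC i).1.
have Cw i : C (emb (w i)) by rewrite -wE; exact: (vC i).2.
pose y i : 'rV[R]_d := emb (primpart (w i)); pose cc i : R := (gcdv (w i))%:R.
have vy i : v i = cc i *: y i by rewrite /cc /y -embMn primpartK wE.
have dv i : 0 <= dot a (v i) by rewrite wE; exact: (coercive_ge0 ac).
have dvK i : dot a (v i) <= dot a (emb K).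
  by rewrite -vK dot_sumr (bigD1 i) //= lerDl; exact: sumr_ge0.
have xinj : injective (fun p : V => emb (val p) : 'rV[R]_d).
  by move=> p q /emb_inj/val_inj.
have cc0 i : 0 <= cc i by rewrite ler0n.
have ccx i : cc i != 0 -> exists p : V, y i = emb (val p).
  rewrite pnatr_eq0 => gi.
  have w0 : w i != 0 by apply: contra gi => /eqP ->; rewrite gcdv0.
  have gp : 0 < (gcdv (w i))%:R :> R by rewrite ltr0n lt0n.
  have Cy : C (emb (primpart (w i))).
    have -> : emb (primpart (w i)) = (gcdv (w i))%:R^-1 *: emb (w i) :> 'rV[R]_d.
      have := congr1 (@emb R d) (primpartK (w i)); rewrite embMn => <-.
      by rewrite scalerA mulVf ?scale1r // gt_eqF.
    by apply: (cone_scale C_cone) => //; rewrite invr_ge0 ltW.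
  have pV : primpart (w i) \in V.
    apply: Vall => //; first exact: primpart_prim.
    apply: le_trans (cP _ Cy) (le_trans _ (dvK i)).
    rewrite vy dotZr ler_peMl ?(coercive_ge0 ac) //.
    by rewrite ler1n lt0n.
  by exists (FSetSub pV).
have [E1 E2] := zon_merge xinj cc0 ccx.
pose om (p : V) := \sum_(i | y i == emb (val p)) cc i.
pose N (p : V) := (\sum_(i | y i == emb (val p)) gcdv (w i))%N.
have omN (p : V) : om p = (N p)%:R by rewrite /om /N natr_sum.
have sumK : \sum_(p : V) om p *: emb (val p) = emb K.
  by rewrite -E2 -vK; apply: eq_bigr => i _; rewrite vy.
have NB (p : V) : (N p < B.+1)%N.
  have [pp Cp] := Vp _ (valP p).
  rewrite ltnS -(ler_nat R) -(ler_pM2l c0); apply: le_trans KB.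
  apply: (@le_trans _ _ (om p * dot a (emb (val p)))).
    rewrite omN mulrC ler_wpM2l //; apply: le_trans (cP _ Cp).
    rewrite ler_peMr ?(ltW c0) //; apply: nrm_emb_ge1; exact: primv_neq0.
  rewrite -sumK dot_sumr (bigD1 p) //= dotZr lerDl; apply: sumr_ge0 => q _.
  rewrite dotZr omN mulr_ge0 // (coercive_ge0 ac) //.
  exact: (Vp _ (valP q)).2.
pose om' : config V B := [ffun p => inord (N p)].
have genE (p : V) : gen om' p = om p *: emb (val p).
  by rewrite /gen ffunE inordK // omN.
exists om'.
  apply: (@emb_inj R); rewrite endpt_emb -sumK.
  by apply: eq_bigr => p _; rewrite genE.
rewrite zonotope_zon (_ : v = fun i => cc i *: y i); last exact/funext.
by rewrite E1; congr zon; apply/funext => p; rewrite genE.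
Qed.

End LatticeZonotopes.

(** * Homogeneous Lipschitz functions and partitions by direction *)

Section HomogeneousFunctions.
Context {R : realType} {d : nat} (C : set 'rV[R]_d).
Hypotheses (C_cone : convex_cone C) (C0 : C 0).
Implicit Types (f g : 'rV[R]_d -> R) (x y th : 'rV[R]_d).
Variables (a : 'rV[R]_d) (c : R).
Hypothesis ac : coercive C a c.

Lemma eq_hl f g : (forall x, C x -> f x = g x) -> hl C f -> hl C g.
Proof.
move=> fg [fh [K K0 fl]]; split.
  move=> s x s0 Cx; rewrite -!fg //; first exact: fh.
  exact: (cone_scale C_cone).
by exists K => // x y Cx Cy; rewrite -!fg //; exact: fl.
Qed.

Lemma hl_max f g : hl C f -> hl C g -> hl C (fun x => Num.max (f x) (g x)).
Proof.
move=> [fh [K K0 fl]] [gh [L L0 gl]]; split.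
  by move=> s x s0 Cx; rewrite fh // gh // maxr_pMr.
exists (K + L); first exact: addr_ge0.
move=> x y Cx Cy; have := fl _ _ Cx Cy; have := gl _ _ Cx Cy.
have := mulr_ge0 K0 (nrm_ge0 (x - y)); have := mulr_ge0 L0 (nrm_ge0 (x - y)).
rewrite mulrDl !ler_norml => h1 h2 /andP[h3 h4] /andP[h5 h6].
by have [h7|h7] := leP (f x) (g x); have [h8|h8] := leP (f y) (g y);
  apply/andP; split; lra.
Qed.

Lemma hlN f : hl C f -> hl C (fun x => - f x).
Proof. by move=> /(hlZ (-1)); apply: eq_hl => x _; rewrite mulN1r. Qed.

Lemma hlB f g : hl C f -> hl C g -> hl C (fun x => f x - g x).
Proof. by move=> hf /hlN; exact: hlD. Qed.

Lemma hl_min f g : hl C f -> hl C g -> hl C (fun x => Num.min (f x) (g x)).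
Proof.
move=> /hlN hf /hlN hg; have := hlN (hl_max hf hg).
by apply: eq_hl => x _; rewrite oppr_max !opprK.
Qed.

Lemma hl_cst0 : hl C (fun=> 0).
Proof. by have := hlZ 0 (dot_hl C a); apply: eq_hl => x _; rewrite mul0r. Qed.

Lemma hl_sum (I : Type) (s : seq I) (F : I -> 'rV[R]_d -> R) :
  (forall i, hl C (F i)) -> hl C (fun x => \sum_(i <- s) F i x).
Proof.
move=> hF; elim: s => [|i s IH].
  by apply: eq_hl hl_cst0 => x _; rewrite big_nil.
by apply: eq_hl (hlD (hF i) IH) => x _; rewrite big_cons.
Qed.

Lemma hl_coord j : hl C (fun x => x 0 j).
Proof.
apply: eq_hl (dot_hl C (delta_mx 0 j)) => x _.
rewrite /dot (bigD1 j) //= big1 ?addr0 => [|i ij].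
  by rewrite mxE !eqxx mul1r.
by rewrite mxE (negbTE ij) andbF mul0r.
Qed.

Lemma hl_dist th : hl C (fun x => nrm (x - dot a x *: th)).
Proof.
split.
  by move=> s x s0 Cx; rewrite dotZr -scalerA -scalerBr nrmZ ger0_norm.
exists (1 + nrm a * nrm th); first by rewrite addr_ge0 ?mulr_ge0 ?nrm_ge0.
move=> x y _ _.
have tri (u v : 'rV[R]_d) : `|nrm u - nrm v| <= nrm (u - v).
  have h1 := nrmD (u - v) v; have h2 := nrmD (v - u) u.
  rewrite !subrK in h1 h2; rewrite nrm_distC in h2.
  by rewrite ler_norml; apply/andP; split; lra.
apply: le_trans (tri _ _) _.
have -> : x - dot a x *: th - (y - dot a y *: th) = (x - y) - (dot a x - dot a y) *: th.
  by rewrite scalerBl !opprB addrACA [RHS]addrAC -!addrA; congr (_ + _); rewrite addrCA.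
apply: le_trans (nrmD _ _) _; rewrite nrmN nrmZ mulrDl mul1r lerD2l.
by rewrite mulrAC ler_wpM2r ?nrm_ge0 // dot_lip.
Qed.

Let dot_eq0 x : C x -> dot a x = 0 -> x = 0.
Proof.
move=> Cx x0; apply: nrm_eq0; apply/eqP; rewrite eq_le nrm_ge0 andbT.
by have := ac.2 _ Cx; rewrite x0 pmulr_rle0 // ac.1.
Qed.

(** This is the product of the degree-zero functions [f / dot a] and [g / dot a], rescaled to degree
    one. The difference is expressed through the ratios [g x / dot a x] and [f y / dot a y], which
    are bounded; where [dot a] vanishes on [C] the point is 0. *)
Lemma hl_mul f g : hl C f -> hl C g -> hl C (fun x => f x * g x / dot a x).
Proof.
move=> hf hg; have [F F0 fF] := hl_bound C0 ac hf; have [G G0 gG] := hl_bound C0 ac hg.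
have [[fh [K K0 fl]] [gh [L L0 gl]]] := (hf, hg).
split.
  move=> s x s0 Cx; rewrite fh // gh // dotZr.
  have [->|s1] := eqVneq s 0; first by rewrite !mul0r.
  have [e|e] := eqVneq (dot a x) 0; first by rewrite e mulr0 invr0 !mulr0.
  by field; rewrite s1 e.
pose M := G * K + F * L + F * G * nrm a.
have M0 : 0 <= M by rewrite !addr_ge0 ?mulr_ge0 ?nrm_ge0.
have bnd x : C x -> `|f x * g x / dot a x| <= M * nrm x.
  move=> Cx; have l0 := coercive_ge0 ac Cx.
  have [e|e] := eqVneq (dot a x) 0.
    by rewrite e invr0 mulr0 normr0 mulr_ge0 ?nrm_ge0.
  have lp : 0 < dot a x by rewrite lt_def e.
  rewrite normrM (ger0_norm (_ : 0 <= (dot a x)^-1)) ?invr_ge0 // ler_pdivrMr //.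
  rewrite normrM; apply: le_trans (ler_pM _ _ (fF _ Cx) (gG _ Cx)) _ => //.
  rewrite mulrACA mulrA ler_wpM2r //.
  have : dot a x <= nrm a * nrm x by exact: le_trans (ler_norm _) (dot_le_nrm _ _).
  move=> /(ler_wpM2l (mulr_ge0 F0 G0)) /le_trans; apply.
  rewrite /M !mulrDl mulrA lerDr addr_ge0 ?mulr_ge0 ?nrm_ge0 //.
exists M => // x y Cx Cy.
have [x0|x0] := eqVneq (dot a x) 0.
  rewrite (dot_eq0 Cx x0) (hl0 C0 hf) !mul0r !sub0r normrN nrmN; exact: bnd.
have [y0|y0] := eqVneq (dot a y) 0.
  rewrite (dot_eq0 Cy y0) (hl0 C0 hf) !mul0r !subr0; exact: bnd.
have xp : 0 < dot a x by rewrite lt_def x0 (coercive_ge0 ac).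
have yp : 0 < dot a y by rewrite lt_def y0 (coercive_ge0 ac).
have gx : `|g x / dot a x| <= G.
  by rewrite normrM (gtr0_norm (_ : 0 < (dot a x)^-1)) ?invr_gt0 // ler_pdivrMr // gG.
have fy : `|f y / dot a y| <= F.
  by rewrite normrM (gtr0_norm (_ : 0 < (dot a y)^-1)) ?invr_gt0 // ler_pdivrMr // fF.
have -> : f x * g x / dot a x - f y * g y / dot a y
  = (f x - f y) * (g x / dot a x)
    + (f y / dot a y) * ((g x - g y) + (g x / dot a x) * (dot a y - dot a x)).
  by field; rewrite x0 y0.
set n := nrm (x - y).
have n0 : 0 <= n := nrm_ge0 _.
apply: le_trans (ler_normD _ _) _; rewrite !normrM -[in X in _ + X]normrM.
have h1 : `|f x - f y| * (`|g x| * `|(dot a x)^-1|) <= K * n * G.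
  by rewrite -normrM; apply: ler_pM => //; exact: fl.
have h2 : `|g x - g y + g x / dot a x * (dot a y - dot a x)| <= L * n + G * (nrm a * n).
  apply: le_trans (ler_normD _ _) _; apply: lerD; first exact: gl.
  rewrite normrM; apply: ler_pM => //; rewrite distrC; exact: dot_lip.
have h3 : `|f y / dot a y| * `|g x - g y + g x / dot a x * (dot a y - dot a x)|
   <= F * (L * n + G * (nrm a * n)) by apply: ler_pM.
apply: le_trans (lerD h1 h3) _; apply: eq_ler; rewrite /M; ring.
Qed.

(** On the slice [dot a = 1] every point is within [eta / 2] of a grid point. The bump [psi i] lives
    where [x / dot a x] is within [eta] of [th i], and it is at least [dot a x] within [eta / 2].
    The parts are increments of the running sums cut off at [dot a]: they are homogeneous and
    Lipschitz without any division by the sum of the bumps. *)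
Lemma partition_exists (eta : R) : 0 < eta ->
  exists (m : nat) (th : 'I_m -> 'rV[R]_d) (xi : 'I_m -> 'rV[R]_d -> R),
  [/\ forall i, hl C (xi i),
      forall i x, C x -> 0 <= xi i x,
      forall x, C x -> \sum_i xi i x = dot a x &
      forall i x, C x -> xi i x * nrm (x - dot a x *: th i) <= eta * dot a x * xi i x].
Proof.
move=> eta0; have [c0 cP] := ac.
(* The mesh satisfies [d * h <= eta / 2], a bound for the l1 distance to the grid. *)
pose h := eta / (2 * d.+1%:R); have h0 : 0 < h by rewrite divr_gt0 // mulr_gt0.
(* Points of the slice have norm at most [c^-1], so the grid points used have coordinates at most
   [(c h)^-1 + 1]. *)
pose M := (Num.truncn ((c * h)^-1 + 1)).+1.
have [F FP] := @bounded_lattice_fset d M.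
pose th (i : nat) : 'rV[R]_d := h *: emb (nth 0 F i).
pose psi (i : nat) x := 2 / eta * Num.max 0 (eta * dot a x - nrm (x - dot a x *: th i)).
pose S (i : nat) x := Num.min (dot a x) (\sum_(j <- iota 0 i) psi j x).
have hpsi i : hl C (psi i).
  apply: hlZ; apply: hl_max; first exact: hl_cst0.
  by apply: hlB; [apply: hlZ; exact: dot_hl|exact: hl_dist].
have hS i : hl C (S i) by apply: hl_min; [exact: dot_hl|exact: hl_sum].
have e2 : 0 < 2 / eta by rewrite divr_gt0.
have psi0 i x : 0 <= psi i x by rewrite mulr_ge0 ?(ltW e2) // le_max lexx.
have psiS i x : \sum_(j <- iota 0 i.+1) psi j x = \sum_(j <- iota 0 i) psi j x + psi i x.
  by rewrite -addn1 iotaD big_cat /= add0n big_seq1.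
exists (size F), (fun i => th i), (fun i x => S i.+1 x - S i x); split.
- by move=> i; exact: hlB.
- move=> i x Cx; rewrite subr_ge0 /S psiS le_min ge_min lexx /=.
  by rewrite ge_min lerDl psi0 orbT.
- move=> x Cx; rewrite -(big_mkord xpredT (fun i => S i.+1 x - S i x)) telescope_sumr //.
  have l0 := coercive_ge0 ac Cx.
  rewrite {2}/S big_nil min_r // subr0 /S min_l //.
  have [x0|x0] := eqVneq (dot a x) 0; first by rewrite x0 sumr_ge0.
  have lp : 0 < dot a x by rewrite lt_def x0.
  pose y := (dot a x)^-1 *: x.
  have xy : x = dot a x *: y by rewrite scalerA mulfV // scale1r.
  pose p : 'rV[int]_d := map_mx Num.floor (h^-1 *: y).
  have ph j : h * (p 0 j)%:~R <= y 0 j < h * (p 0 j)%:~R + h.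
    have -> : p 0 j = Num.floor (h^-1 * y 0 j) by rewrite /p mxE; congr Num.floor; rewrite mxE.
    move: (y 0 j) => z; have := floor_itv (h^-1 * z); rewrite intrD => /andP[h1 h2].
    have hz : h * (h^-1 * z) = z by rewrite mulrA mulfV ?mul1r // gt_eqF.
    have := ler_wpM2l (ltW h0) h1; move: h2; rewrite -(ltr_pM2l h0) hz mulrDr mulr1.
    by move=> h2 {}h1; rewrite h1 h2.
  have ny : nrm y <= c^-1.
    rewrite /y nrmZ gtr0_norm ?invr_gt0 // ler_pdivrMl //.
    by rewrite ler_pdivlMr // mulrC; exact: cP.
  have pF : p \in F.
    apply: FP => j; have /andP[h1 h2] := ph j.
    have yj : `|y 0 j| <= c^-1 by exact: le_trans (coord_le_nrm _ _) ny.
    rewrite -(ler_nat R) natr_absz intr_norm.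
    have hM : (c * h)^-1 + 1 <= M%:R by rewrite ltW // truncnS_gt.
    apply: le_trans hM; rewrite -(ler_pM2l h0) mulrDr mulr1 invfM mulrCA mulfV ?gt_eqF // mulr1.
    move: yj; rewrite !ler_norml => /andP[h3 h4].
    have -> : h * `|(p 0 j)%:~R| = `|h * (p 0 j)%:~R| by rewrite normrM gtr0_norm.
    by rewrite ler_norml; apply/andP; split; lra.
  have dist : nrm (x - dot a x *: (h *: emb p)) <= eta / 2 * dot a x.
    have -> : x - dot a x *: (h *: emb p) = dot a x *: (y - h *: emb p).
      by rewrite scalerBr -xy.
    rewrite nrmZ gtr0_norm // mulrC ler_pM2r //.
    apply: (@le_trans _ _ (\sum_(j < d) h)).
      apply: ler_sum => j _; have /andP[h1 h2] := ph j.
      have -> : (y - h *: emb p) 0 j = y 0 j - h * (p 0 j)%:~R.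
        by rewrite mxE; congr (_ + _); rewrite mxE; congr (- _); rewrite mxE; congr (_ * _);
          rewrite mxE.
      by rewrite ger0_norm; lra.
    rewrite sumr_const card_ord -[leLHS]mulr_natl /h.
    have -> : d%:R * (eta / (2 * d.+1%:R)) = eta / 2 * (d%:R / d.+1%:R).
      by rewrite invfM; ring.
    rewrite ler_piMr ?divr_ge0 ?(ltW eta0) // ler_pdivrMr // mul1r ler_nat //.
  have iF : (index p F < size F)%N by rewrite index_mem.
  rewrite (bigD1_seq (index p F)) ?iota_uniq ?mem_iota //=.
  apply: ler_wpDr; first by apply: sumr_ge0 => i _; exact: psi0.
  rewrite /psi /th nth_index //.
  apply: (@le_trans _ _ (2 / eta * (eta * dot a x - nrm (x - dot a x *: (h *: emb p)))));
    last first.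
    by rewrite ler_pM2l // le_max lexx orbT.
  rewrite mulrAC ler_pdivlMr //; lra.
- move=> i x Cx; have l0 := coercive_ge0 ac Cx.
  have [le|gt] := leP (nrm (x - dot a x *: th i)) (eta * dot a x).
    rewrite mulrC ler_wpM2r //.
    by rewrite subr_ge0 /S psiS le_min ge_min lexx /= ge_min lerDl psi0 orbT.
  have p0 : psi i x = 0 by rewrite /psi max_l ?mulr0 //; lra.
  by rewrite /S psiS p0 addr0 subrr !mulr0 mul0r.
Qed.

End HomogeneousFunctions.

(** * The limit zonoid and its distance to a configuration *)

Section LimitShape.
Context {R : realType} {d : nat} (C : set 'rV[R]_d).
Hypotheses (C_cone : convex_cone C) (C0 : C 0).
Implicit Types (f g xi : 'rV[R]_d -> R) (x y z th : 'rV[R]_d).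
Variables (a : 'rV[R]_d) (c : R).
Hypothesis ac : coercive C a c.
Variable kk : 'rV[int]_d.
Hypothesis kkP : forall y, nrm (y - emb kk) <= d%:R -> C y.

Local Notation mom := (mom C a).

Lemma mom0 : mom (fun=> 0) = 0.
Proof.
have h0 := hl_cst0 C_cone a; have := momD C_cone C0 ac kkP h0 h0.
rewrite (_ : (fun x => 0 + 0) = fun=> 0); last by apply/funext => x; rewrite addr0.
by lra.
Qed.

Lemma mom_sum (I : Type) (s : seq I) (F : I -> 'rV[R]_d -> R) : (forall i, hl C (F i)) ->
  mom (fun x => \sum_(i <- s) F i x) = \sum_(i <- s) mom (F i).
Proof.
move=> hF; elim: s => [|i s IH].
  have h0 := hl_cst0 C_cone a.
  rewrite big_nil (eq_mom C_cone C0 ac kkP h0 (g := fun=> 0)); last by move=> x _;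
    rewrite big_nil.
  exact: mom0.
have hs := hl_sum C_cone a s hF.
rewrite big_cons -IH -(momD C_cone C0 ac kkP (hF i) hs).
by congr mom; apply/funext => x; rewrite big_cons.
Qed.

Lemma mom_ge0 xi : hl C xi -> (forall x, C x -> 0 <= xi x) -> 0 <= mom xi.
Proof.
move=> hxi xi0; have h0 := hl_cst0 C_cone a.
rewrite -mom0.
exact: (mom_le C_cone C0 ac kkP).
Qed.

(** For homogeneous [xi] the factor [xi / dot a] has degree zero, so this is the vector moment
    weighted by a function of the direction only. *)
Definition vecmom xi : 'rV[R]_d := \row_j mom (fun x => xi x * x 0 j / dot a x).

Let hl_vecmom xi j : hl C xi -> hl C (fun x => xi x * x 0 j / dot a x).
Proof. by move=> hxi; apply: (hl_mul C0 ac) => //; exact: hl_coord. Qed.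

Lemma vecmom_lin xi xi' (s s' : R) : hl C xi -> hl C xi' ->
  vecmom (fun x => s * xi x + s' * xi' x) = s *: vecmom xi + s' *: vecmom xi'.
Proof.
move=> h h'; apply/rowP => j; rewrite !mxE.
have hj := hl_vecmom j h; have hj' := hl_vecmom j h'.
rewrite -(momZ C_cone C0 ac kkP s hj) -(momZ C_cone C0 ac kkP s' hj').
rewrite -(momD C_cone C0 ac kkP (hlZ s hj) (hlZ s' hj')).
by congr mom; apply/funext => x; ring.
Qed.

Lemma vecmom_sum (I : finType) (F : I -> 'rV[R]_d -> R) : (forall i, hl C (F i)) ->
  vecmom (fun x => \sum_i F i x) = \sum_i vecmom (F i).
Proof.
move=> hF; apply/rowP => j; rewrite mxE summxE.
under eq_bigr do rewrite mxE.
rewrite -(mom_sum _ (fun i => hl_vecmom j (hF i))).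
by congr mom; apply/funext => x; rewrite !mulr_suml.
Qed.

Lemma eq_vecmom xi xi' : hl C xi' -> (forall x, C x -> xi x = xi' x) -> vecmom xi = vecmom xi'.
Proof.
move=> h' E; apply/rowP => j; rewrite !mxE; apply: (eq_mom C_cone C0 ac kkP).
  exact: hl_vecmom.
by move=> x Cx; rewrite E.
Qed.

Definition concentrated (eta : R) th xi :=
  forall x, C x -> xi x * nrm (x - dot a x *: th) <= eta * dot a x * xi x.

(** Where [xi] is positive, [x / dot a x] is within [eta] of [th], so each coordinate of the moment
    is that of [mom xi *: th] up to [eta * mom xi]; the factor [d] adds up the coordinates. *)
Lemma vecmom_concentrated eta th xi : hl C xi -> (forall x, C x -> 0 <= xi x) -> 0 <= eta ->
  concentrated eta th xi -> nrm (vecmom xi - mom xi *: th) <= d%:R * (eta * mom xi).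
Proof.
move=> h xi0 eta0 con; rewrite /nrm.
have -> : d%:R * (eta * mom xi) = \sum_(j < d) eta * mom xi.
  by rewrite sumr_const card_ord mulr_natl.
apply: ler_sum => j _; rewrite !mxE [mom xi * _]mulrC.
have hj := hl_vecmom j h; have hn := hlZ (- th 0 j) h.
rewrite -mulNr -(momZ C_cone C0 ac kkP _ h) -(momD C_cone C0 ac kkP hj hn).
have key x : C x -> `|xi x * x 0 j / dot a x + - th 0 j * xi x| <= eta * xi x.
  move=> Cx; have l0 := coercive_ge0 ac Cx.
  have [e|e] := eqVneq (dot a x) 0.
    have [G G0 gG] := hl_bound C0 ac h.
    have : `|xi x| <= 0 by have := gG _ Cx; rewrite e mulr0.
    by rewrite normr_le0 => /eqP ->; rewrite !mul0r !mulr0 addr0 normr0.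
  have lp : 0 < dot a x by rewrite lt_def e.
  have -> : xi x * x 0 j / dot a x + - th 0 j * xi x =
    xi x * (x 0 j - dot a x * th 0 j) / dot a x.
    by field.
  rewrite normrM (gtr0_norm (_ : 0 < (dot a x)^-1)) ?invr_gt0 // ler_pdivrMr //.
  rewrite normrM ger0_norm ?xi0 // mulrAC; apply: le_trans (con _ Cx).
  rewrite ler_wpM2l ?xi0 //; have := coord_le_nrm (x - dot a x *: th) j.
  by rewrite !mxE.
rewrite ler_norml -(momZ C_cone C0 ac kkP eta h); apply/andP; split; last first.
  apply: (mom_le C_cone C0 ac kkP); [exact: hlD|exact: hlZ|].
  by move=> x Cx; apply: le_trans (key _ Cx); exact: ler_norm.
rewrite -mulN1r -(momZ C_cone C0 ac kkP _ (hlZ eta h)).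
apply: (mom_le C_cone C0 ac kkP); [by do 2 apply: hlZ|exact: hlD|].
by move=> x Cx; have := key _ Cx; rewrite ler_norml => /andP[]; lra.
Qed.

Definition admissible xi := hl C xi /\ forall x, C x -> 0 <= xi x <= dot a x.

(* The zonoid generated by the measure with density [expR (- dot a x)] on [C]. *)
Definition limit_shape : set 'rV[R]_d := [set vecmom xi | xi in admissible].

Lemma limit_shape_convex : convex_set limit_shape.
Proof.
move=> _ _ lam /set_mem[xi [h h01] <-] /set_mem[xi' [h' h01'] <-].
apply/mem_set; rewrite /conv /=.
exists (fun x => lam%:num * xi x + (1 - lam%:num) * xi' x).
  split; first by apply: hlD; exact: hlZ.
  move=> x Cx; have /andP[p1 p2] := h01 _ Cx; have /andP[p3 p4] := h01' _ Cx.
  have l0 : 0 <= lam%:num by []; have l1 : lam%:num <= 1 by [].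
  by apply/andP; split; nra.
by rewrite vecmom_lin.
Qed.

Lemma limit_shape_nonempty : limit_shape !=set0.
Proof.
exists (vecmom (fun=> 0)); exists (fun=> 0) => //; split; first exact: (hl_cst0 C_cone a).
by move=> x Cx; rewrite lexx (coercive_ge0 ac).
Qed.

Section Estimate.
Variables (k : 'rV[R]_d).
Hypothesis mom_lin : mom (dot a) = dot a k.
Variables (eta : R) (m : nat) (th : 'I_m -> 'rV[R]_d) (xi : 'I_m -> 'rV[R]_d -> R).
Hypotheses (eta0 : 0 < eta) (hxi : forall i, hl C (xi i)).
Hypothesis xi_ge0 : forall i x, C x -> 0 <= xi i x.
Hypothesis xi_sum : forall x, C x -> \sum_i xi i x = dot a x.
Hypothesis xi_conc : forall i, concentrated eta (th i) (xi i).
Variables (V : {fset 'rV[int]_d}) (B : nat) (om : config V B) (n del : R).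
Hypotheses (Vp : prims_in C V) (n0 : 0 < n).
Hypothesis om_end : \sum_p gen om p = n *: k.
Hypothesis om_close : forall i, `|gsum (xi i) om / n - mom (xi i)| <= del.

(** One [eta] comes from replacing directions by the [th i] in the configuration, [d] of them from
    doing so in the limit shape; the last term comes from the deviations of the masses of the
    parts. *)
Let err : R := (1 + d%:R) * eta * dot a k + del * \sum_i nrm (th i).

Let e (p : V) : 'rV[R]_d := emb (val p).
Let Ce p : C (e p). Proof. exact: (Vp (valP p)).2. Qed.
#[local] Hint Resolve Ce : core.
Let lp p : 0 < dot a (e p).
Proof. by have [pp Cp] := Vp (valP p); exact: (prim_dot_gt0 ac). Qed.
Let w (p : V) : R := (om p)%:R.
Let w0 p : 0 <= w p. Proof. by rewrite ler0n. Qed.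

Let Y i : R := gsum (xi i) om.
Let Y0 i : 0 <= Y i.
Proof. by apply: sumr_ge0 => p _; apply: mulr_ge0 => //; exact: (xi_ge0 i (Ce p)). Qed.

Let Y_sum : \sum_i Y i = n * dot a k.
Proof.
rewrite -dotZr -om_end dot_sumr /Y /gsum exchange_big /=; apply: eq_bigr => p _.
by rewrite -mulr_sumr (xi_sum (Ce p)) /gen dotZr.
Qed.

Let M_sum : \sum_i mom (xi i) = dot a k.
Proof.
rewrite -mom_lin -mom_sum //; apply: (eq_mom C_cone C0 ac kkP) => //.
exact: dot_hl.
Qed.

Let m0 i : 0 <= mom (xi i).
Proof. by apply: mom_ge0 => // x; exact: xi_ge0. Qed.

Let discrete_step (b : V -> 'I_m -> R) : (forall p i, 0 <= b p i <= w p) ->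
  nrm (n^-1 *: (\sum_p \sum_i (b p i * xi i (e p) / dot a (e p)) *: e p)
       - n^-1 *: (\sum_i (\sum_p b p i * xi i (e p)) *: th i)) <= eta * dot a k.
Proof.
move=> b01; rewrite -scalerBr nrmZ gtr0_norm ?invr_gt0 // ler_pdivrMl //.
have -> : n * (eta * dot a k) = \sum_p \sum_i eta * (w p * xi i (e p)).
  rewrite mulrCA -Y_sum mulr_sumr exchange_big; apply: eq_bigr => i _.
  by rewrite /Y /gsum mulr_sumr.
have -> : \sum_i (\sum_p b p i * xi i (e p)) *: th i
   = \sum_p \sum_i (b p i * xi i (e p)) *: th i.
  by rewrite exchange_big; apply: eq_bigr => i _; rewrite scaler_suml.
rewrite -sumrB; apply: le_trans (nrm_sum _ _ _) _; apply: ler_sum => p _.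
rewrite -sumrB; apply: le_trans (nrm_sum _ _ _) _; apply: ler_sum => i _.
have /andP[b0 b1] := b01 p i; have x0 := xi_ge0 i (Ce p).
have -> : (b p i * xi i (e p) / dot a (e p)) *: e p - (b p i * xi i (e p)) *: th i
   = (b p i * xi i (e p) / dot a (e p)) *: (e p - dot a (e p) *: th i).
  by rewrite scalerBr scalerA divfK // gt_eqF.
rewrite nrmZ ger0_norm; last by rewrite divr_ge0 ?mulr_ge0 // ltW.
rewrite mulrAC ler_pdivrMr // -mulrA.
apply: le_trans (ler_wpM2l b0 (xi_conc i (Ce p))) _.
have el : 0 <= eta * dot a (e p) by rewrite mulr_ge0 // ltW.
by have := ler_wpM2l el (ler_wpM2r x0 b1); lra.
Qed.

Let middle_step (be : 'I_m -> R) : (forall i, 0 <= be i <= 1) ->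
  nrm (n^-1 *: (\sum_i (be i * Y i) *: th i) - \sum_i (be i * mom (xi i)) *: th i)
    <= del * \sum_i nrm (th i).
Proof.
move=> be01; rewrite scaler_sumr -sumrB mulr_sumr.
apply: le_trans (nrm_sum _ _ _) _; apply: ler_sum => i _.
rewrite scalerA -scalerBl nrmZ ler_wpM2r ?nrm_ge0 //.
have -> : n^-1 * (be i * Y i) - be i * mom (xi i) = be i * (Y i / n - mom (xi i)) by ring.
have /andP[b0 b1] := be01 i; rewrite normrM ger0_norm //.
by apply: le_trans (om_close i); rewrite ler_piMl.
Qed.

Let continuous_step (F : 'I_m -> 'rV[R]_d -> R) : (forall i, hl C (F i)) ->
  (forall i x, C x -> 0 <= F i x <= xi i x) -> (forall i, concentrated eta (th i) (F i)) ->
  nrm (\sum_i mom (F i) *: th i - \sum_i vecmom (F i)) <= d%:R * eta * dot a k.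
Proof.
move=> hF F01 Fc; rewrite -sumrB.
apply: le_trans (nrm_sum _ _ _) _.
rewrite -M_sum mulr_sumr; apply: ler_sum => i _; rewrite nrm_distC.
have F0 x : C x -> 0 <= F i x by move=> Cx; have /andP[] := F01 i x Cx.
apply: le_trans (vecmom_concentrated (hF i) F0 (ltW eta0) (Fc i)) _.
rewrite -mulrA ler_wpM2l // ler_wpM2l ?(ltW eta0) //.
by apply: (mom_le C_cone C0 ac kkP) => // x Cx; have /andP[] := F01 i x Cx.
Qed.

(** The coefficients [al] are averaged over each part into [be i], and the point of the limit shape
    uses the same [be i] as weights. Both points are close to combinations of the [th i], whose
    coefficients differ only by the deviations of the masses. *)
Lemma zon_near_shape x : zon (gen om) x ->
  exists2 z, limit_shape z & nrm (n^-1 *: x - z) <= err.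
Proof.
move=> [al [al01 ->]] {x}.
pose num i := \sum_p al p * w p * xi i (e p).
have num0 i : 0 <= num i.
  apply: sumr_ge0 => p _; have /andP[? ?] := al01 p.
  by rewrite !mulr_ge0 // xi_ge0.
have numY i : num i <= Y i.
  apply: ler_sum => p _; have /andP[? ?] := al01 p.
  by rewrite ler_wpM2r ?xi_ge0 // ler_piMl.
pose be i := num i / Y i.
have be01 i : 0 <= be i <= 1.
  rewrite /be; have [->|y0] := eqVneq (Y i) 0; first by rewrite invr0 mulr0 lexx ler01.
  have yp : 0 < Y i by rewrite lt_def y0 Y0.
  by apply/andP; split; [exact: divr_ge0|rewrite ler_pdivrMr // mul1r].
have beY i : be i * Y i = num i.
  rewrite /be; have [y0|y0] := eqVneq (Y i) 0; last by rewrite divfK.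
  by rewrite y0 mulr0; apply/eqP; rewrite eq_le num0 /= -y0 numY.
have hb i : hl C (fun x => be i * xi i x) by exact: hlZ.
exists (vecmom (fun x => \sum_i be i * xi i x)).
  exists (fun x => \sum_i be i * xi i x) => //; split; first exact: (hl_sum C_cone a).
  move=> x Cx; apply/andP; split.
    by apply: sumr_ge0 => i _; have /andP[? ?] := be01 i; rewrite mulr_ge0 // xi_ge0.
  rewrite -xi_sum //; apply: ler_sum => i _; have /andP[? ?] := be01 i.
  by rewrite ler_piMl // xi_ge0.
have b01 (p : V) (i : 'I_m) : 0 <= al p * w p <= w p.
  by have /andP[? ?] := al01 p; rewrite mulr_ge0 //= ler_piMl.
have s1 := discrete_step (b := fun p _ => al p * w p) b01.
have s2 := middle_step be01.
have s3 := continuous_step (F := fun i x => be i * xi i x) hb.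
rewrite vecmom_sum //.
have {}s3 : nrm (\sum_i (be i * mom (xi i)) *: th i - \sum_i vecmom (fun x => be i * xi i x))
    <= d%:R * eta * dot a k.
  have -> : \sum_i (be i * mom (xi i)) *: th i = \sum_i mom (fun x => be i * xi i x) *: th i.
    by apply: eq_bigr => i _; rewrite (momZ C_cone C0 ac kkP _ (hxi i)).
  apply: s3 => [i x Cx|i x Cx]; have /andP[b0 b1] := be01 i.
    by rewrite mulr_ge0 ?xi_ge0 // ler_piMl // xi_ge0.
  by have := ler_wpM2l b0 (xi_conc i Cx); lra.
have xE : \sum_p al p *: gen om p = \sum_p \sum_i (al p * w p * xi i (e p) / dot a (e p)) *: e p.
  apply: eq_bigr => p _; rewrite -scaler_suml -mulr_suml -mulr_sumr xi_sum //.
  by rewrite mulfK ?gt_eqF // /gen scalerA.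
rewrite xE.
have nE : \sum_i (be i * Y i) *: th i = \sum_i (\sum_p al p * w p * xi i (e p)) *: th i.
  by apply: eq_bigr => i _; rewrite beY.
rewrite nE in s2; move: s1 s2 s3.
set P := n^-1 *: _; set Q := n^-1 *: _; set S := \sum_i _ *: _; set U := \sum_i vecmom _.
move=> s1 s2 s3; rewrite -(subrK Q P) -addrA -(subrK S Q) -[_ - S + S - U]addrA.
apply: le_trans (nrmD _ _) _; rewrite subrK.
apply: le_trans (lerD (lexx _) (nrmD _ _)) _.
by rewrite /err; lra.
Qed.

(** Here [be i] is the share that [ze] takes of the moment of the part [i], and the generator at [p]
    gets the mean of the [be i] with weights [xi i / dot a]. *)
Lemma limit_shape_near_zon z : limit_shape z ->
  exists2 x, zon (gen om) x & nrm (n^-1 *: x - z) <= err.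
Proof.
move=> [ze [hz z01] <-].
pose F i x := ze x * xi i x / dot a x.
have hF i : hl C (F i) by exact: (hl_mul C0 ac).
have F01 i x : C x -> 0 <= F i x <= xi i x.
  move=> Cx; have /andP[z0 z1] := z01 _ Cx; have x0 := xi_ge0 i Cx.
  have l0 := coercive_ge0 ac Cx; rewrite /F.
  have [l1|l1] := eqVneq (dot a x) 0; first by rewrite l1 invr0 mulr0 lexx.
  have lpos : 0 < dot a x by rewrite lt_def l1.
  by rewrite divr_ge0 ?mulr_ge0 //= ler_pdivrMr // mulrC ler_wpM2l.
have Fsum x : C x -> \sum_i F i x = ze x.
  move=> Cx; have /andP[z0 z1] := z01 _ Cx; rewrite -mulr_suml -mulr_sumr xi_sum //.
  have [l1|l1] := eqVneq (dot a x) 0; last by rewrite mulfK.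
  by rewrite l1 invr0 mulr0; move: z1; rewrite l1 => z1; apply/eqP; rewrite eq_le z0 z1.
have Fc i : concentrated eta (th i) (F i).
  move=> x Cx; have /andP[z0 z1] := z01 _ Cx; have l0 := coercive_ge0 ac Cx.
  have -> : F i x * nrm (x - dot a x *: th i) =
    ze x / dot a x * (xi i x * nrm (x - dot a x *: th i)).
    by rewrite /F; ring.
  have -> : eta * dot a x * F i x = ze x / dot a x * (eta * dot a x * xi i x) by rewrite /F; ring.
  by rewrite ler_wpM2l ?divr_ge0 // xi_conc.
pose be i := mom (F i) / mom (xi i).
have MF0 i : 0 <= mom (F i) by apply: mom_ge0 => // x Cx; have /andP[] := F01 i x Cx.
have MF1 i : mom (F i) <= mom (xi i).
  by apply: (mom_le C_cone C0 ac kkP) => // x Cx; have /andP[] := F01 i x Cx.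
have be01 i : 0 <= be i <= 1.
  rewrite /be; have [->|y0] := eqVneq (mom (xi i)) 0; first by rewrite invr0 mulr0 lexx ler01.
  have yp : 0 < mom (xi i) by rewrite lt_def y0 m0.
  by apply/andP; split; [exact: divr_ge0|rewrite ler_pdivrMr // mul1r].
have beM i : be i * mom (xi i) = mom (F i).
  rewrite /be; have [y0|y0] := eqVneq (mom (xi i)) 0; last by rewrite divfK.
  by rewrite y0 mulr0; apply/eqP; rewrite eq_le MF0 /= -y0 MF1.
pose al p := \sum_i be i * xi i (e p) / dot a (e p).
have al01 p : 0 <= al p <= 1.
  rewrite /al -mulr_suml; apply/andP; split.
    apply: divr_ge0; last exact: ltW.
    by apply: sumr_ge0 => i _; have /andP[? ?] := be01 i; rewrite mulr_ge0 // xi_ge0.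
  rewrite ler_pdivrMr // mul1r -xi_sum //; apply: ler_sum => i _.
  by have /andP[? ?] := be01 i; rewrite ler_piMl // xi_ge0.
exists (\sum_p al p *: gen om p); first by exists al.
have b01 p i : 0 <= be i * w p <= w p.
  by have /andP[? ?] := be01 i; rewrite mulr_ge0 //= ler_piMl.
have s1 := discrete_step (b := fun p i => be i * w p) b01.
have s2 := middle_step be01.
have s3 := continuous_step hF F01 Fc.
have -> : vecmom ze = \sum_i vecmom (F i).
  by rewrite -vecmom_sum //; apply: eq_vecmom => [|x Cx]; [exact: (hl_sum C_cone a)|rewrite Fsum].
have xE : \sum_p al p *: gen om p = \sum_p \sum_i (be i * w p * xi i (e p) / dot a (e p)) *: e p.
  apply: eq_bigr => p _; rewrite -scaler_suml /gen scalerA; congr (_ *: _).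
  by rewrite /al mulr_suml; apply: eq_bigr => i _; rewrite /w; ring.
rewrite xE.
have nE : \sum_i (be i * Y i) *: th i = \sum_i (\sum_p be i * w p * xi i (e p)) *: th i.
  apply: eq_bigr => i _; rewrite /Y /gsum mulr_sumr; congr (_ *: _).
  by apply: eq_bigr => p _; rewrite mulrA.
have mE : \sum_i (be i * mom (xi i)) *: th i = \sum_i mom (F i) *: th i.
  by apply: eq_bigr => i _; rewrite beM.
rewrite nE mE in s2; move: s1 s2 s3.
set P := n^-1 *: _; set Q := n^-1 *: _; set S := \sum_i _ *: _; set U := \sum_i vecmom _.
move=> s1 s2 s3; rewrite -(subrK Q P) -addrA -(subrK S Q) -[_ - S + S - U]addrA.
apply: le_trans (nrmD _ _) _; rewrite subrK.
apply: le_trans (lerD (lexx _) (nrmD _ _)) _.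
by rewrite /err; lra.
Qed.

Lemma hausdorff_le (eps : R) : err <= eps ->
  (hausdorff_dist [set n^-1 *: x | x in zon (gen om)] limit_shape <= eps%:E)%E.
Proof.
move=> errE; rewrite /hausdorff_dist ge_max; apply/andP; split.
  apply: ge_ereal_sup => _ [_ [x zx <-] <-].
  have [z sz H] := zon_near_shape zx.
  apply: le_trans (_ : (eucl_norm (n^-1 *: x - z))%:E <= _)%E; last first.
    by rewrite lee_fin; apply: le_trans (eucl_le_nrm _) (le_trans H errE).
  by apply: ereal_inf_lbound; exists z.
apply: ge_ereal_sup => _ [z sz <-].
have [x zx H] := limit_shape_near_zon sz.
apply: le_trans (_ : (eucl_norm (z - n^-1 *: x))%:E <= _)%E; last first.
  by rewrite lee_fin; apply: le_trans (eucl_le_nrm _) _; rewrite nrm_distC (le_trans H).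
by apply: ereal_inf_lbound; exists (n^-1 *: x) => //; exists x.
Qed.

End Estimate.

End LimitShape.

(** * Counting bad zonotopes against all zonotopes *)

Lemma sum_pred_const {R : realType} (I : finType) (P : pred I) (x : R) :
  \sum_(i | P i) x = #|P|%:R * x.
Proof. by rewrite mulr_natl -sumr_const; apply: eq_bigl. Qed.

Section FiniteCard.
Context {T : choiceType} {I : finType}.

Lemma finite_card_le_image (f : I -> T) (P : pred I) (A : set T) :
  A `<=` [set f i | i in [set i | P i]] -> finite_set A /\ (finite_card A <= #|P|)%N.
Proof.
move=> Af; have fA : finite_set A.
  by apply: sub_finite_set Af _; apply: finite_image; exact: finite_finset.
split => //; rewrite /finite_card cardE -(size_map f).
apply: uniq_leq_size => // x; rewrite in_fset_set // inE => /Af[i /= Pi <-].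
by apply: map_f; rewrite mem_enum.
Qed.

(** [h] records what [g] forgets: the pair of them is injective on [P]. *)
Lemma card_le_finite_card (J : finType) (g : I -> T) (h : I -> J) (P : pred I) (A : set T) :
  finite_set A -> (forall i, P i -> A (g i)) ->
  (forall i i', P i -> P i' -> g i = g i' -> h i = h i' -> i = i') ->
  (#|P| <= finite_card A * #|J|)%N.
Proof.
move=> fA PA inj; rewrite cardE -(size_map (fun i => (g i, h i))).
rewrite [#|J|]cardE -(size_allpairs pair); apply: uniq_leq_size.
  rewrite map_inj_in_uniq ?enum_uniq // => i i'; rewrite !mem_enum => Pi Pi' [].
  exact: inj.
move=> x /mapP[i]; rewrite mem_enum => Pi ->; apply/allpairsP.
exists (g i, h i) => /=; split => //; last by rewrite mem_enum.
by rewrite in_fset_set // inE; exact: PA.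
Qed.

End FiniteCard.

Lemma inord_shift_inj (M : nat) (z z' : int) : (`|z| <= M)%N -> (`|z'| <= M)%N ->
  inord `|(z + M%:Z)%R|%N = inord `|(z' + M%:Z)%R|%N :> 'I_(M + M).+1 -> z = z'.
Proof. by move=> zM z'M /(congr1 val); rewrite /= !inordK; lia. Qed.

Section Concentration.
Context {R : realType} {d : nat} (C : set 'rV[R]_d).
Hypotheses (d2 : (2 <= d)%N) (C_cone : convex_cone C) (C_pointed : pointed C) (C0 : C 0).
Implicit Types (V : {fset 'rV[int]_d}) (t del : R).
Variables (k0 : 'rV[int]_d) (r : R) (a : 'rV[R]_d) (c : R) (kk : 'rV[int]_d).
Let k : 'rV[R]_d := emb k0.
Hypotheses (r0 : 0 < r) (kr : forall y, nrm (y - k) <= r -> C y).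
Hypothesis kkP : forall y, nrm (y - emb kk) <= d%:R -> C y.
Hypothesis ac : coercive C a c.
Hypothesis mom_lin : forall b, mom C a (dot b) = dot b k.

Local Notation kap := (@kappa R d).
Local Notation l := (dot a k).

Let kap0 : 0 < kap. Proof. exact: kappa_gt0. Qed.

Let l_ge0 : 0 <= l.
Proof. by apply: (coercive_ge0 ac); apply: kr; rewrite subrr nrm0 ltW. Qed.

Let d_gt0 : 0 < (d%:R : R). Proof. by rewrite ltr0n; exact: leq_trans d2. Qed.

Lemma mom_coord j : mom C a (fun x => x 0 j) = k 0 j.
Proof.
have E (x : 'rV[R]_d) : x 0 j = dot (delta_mx 0 j) x.
  rewrite /dot (bigD1 j) //= big1 ?addr0 => [|i ij].
    by rewrite mxE !eqxx mul1r.
  by rewrite mxE (negbTE ij) andbF mul0r.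
rewrite E -mom_lin; congr mom; apply/funext => x; exact: E.
Qed.

Lemma gsum_dot V B (om : config V B) (b : 'rV[R]_d) : gsum (dot b) om = dot b (emb (endpt om)).
Proof.
by rewrite endpt_emb dot_sumr; apply: eq_bigr => p _; rewrite /gen dotZr.
Qed.

Lemma gsum_coord V B (om : config V B) j :
  gsum (fun x : 'rV[R]_d => x 0 j) om = emb (endpt om) 0 j :> R.
Proof.
by rewrite endpt_emb summxE; apply: eq_bigr => p _; rewrite /gen [RHS]mxE.
Qed.

Let finite_min (I : finType) (u : I -> R) : (forall i, 0 < u i) ->
  exists2 e, 0 < e & forall i, e <= u i.
Proof.
move=> u0; have [|e e0 eP] := @small_eps R _ (enum I) u (fun=> 1); first by move=> i _.
by exists e => // i; have := eP i; rewrite mem_enum normr1 mulr1 => /(_ isT)/ltW.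
Qed.

(** Union bound, with [es] a common lower bound for the finitely many rates. *)
Let far_family m (F : 'I_m -> 'rV[R]_d -> R) del : (forall i, hl C (F i)) -> 0 < del ->
  exists2 es, 0 < es & \forall t \near +oo, forall V B, almost_all C a t V -> truncated a t V B ->
    \sum_(om : config V B |
        [exists i, del * t ^+ d.+1 <= `|gsum (F i) om - kap * mom C a (F i) * t ^+ d.+1|])
      weight a t om
    <= m%:R * (4 * expR (- (es * t ^+ d))) * \sum_(om : config V B) weight a t om.
Proof.
move=> hF del0.
have /choice[et etP] : forall i, exists e, 0 < e /\
  \forall t \near +oo, forall V B, almost_all C a t V -> truncated a t V B ->
  \sum_(om : config V B | del * t ^+ d.+1 <= `|gsum (F i) om - kap * mom C a (F i) * t ^+ d.+1|)
     weight a t om <= 4 * expR (- (e * t ^+ d)) * \sum_(om : config V B) weight a t om.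
  by move=> i; have [e e0 eP] := deviation d2 C_cone C0 ac kkP (hF i) del0; exists e.
have [es es0 esP] := finite_min (fun i => (etP i).1).
exists es => //.
have H := filter_forall _ (fun i => (etP i).2).
near=> t => V B aV tV.
have t0 : 0 < t by near: t; apply: nbhs_pinfty_gt; exact: num_real.
have td0 : 0 <= t ^+ d by rewrite exprn_ge0 // ltW.
have h i : \sum_(om : config V B | del * t ^+ d.+1 <=
  `|gsum (F i) om - kap * mom C a (F i) * t ^+ d.+1|)
     weight a t om <= 4 * expR (- (et i * t ^+ d)) * \sum_(om : config V B) weight a t om.
  by move: i V B aV tV; near: t; exact: H.
have W0 (om : config V B) : 0 <= weight a t om by exact: expR_ge0.
apply: (@le_trans _ _ (\sum_(i < m) \sum_(om : config V B |
    del * t ^+ d.+1 <= `|gsum (F i) om - kap * mom C a (F i) * t ^+ d.+1|) weight a t om)).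
  under [leRHS]eq_bigr do rewrite big_mkcond.
  rewrite exchange_big big_mkcond /=; apply: ler_sum => om _.
  have s0 : 0 <= \sum_(i < m) (if del * t ^+ d.+1 <=
    `|gsum (F i) om - kap * mom C a (F i) * t ^+ d.+1| then weight a t om else 0).
    by apply: sumr_ge0 => i _; case: ifP.
  case: ifP => [/existsP[i Hi]|//]; rewrite (bigD1 i) //= Hi lerDl.
  by apply: sumr_ge0 => i' _; case: ifP.
rewrite -mulrA -[X in X%:R]card_ord mulr_natl -sumr_const; apply: ler_sum => i _.
apply: le_trans (h i) _; rewrite ler_wpM2r ?sumr_ge0 // ler_pM2l // ler_expR lerN2.
by rewrite ler_wpM2r.
Unshelve. all: by end_near. Qed.

(** As [t <= t^d], the term of order [q + 1] of the exponential series dominates [t^q] with one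
    power to spare. *)
Lemma poly_exp_bound (u A : R) q : 0 < u -> 0 <= A -> exists2 D, 0 <= D &
  forall t, 1 <= t -> A * t ^+ q * expR (- (u * t ^+ d)) <= D / t.
Proof.
move=> u0 A0; pose f : R := q.+1`!%:R.
have f0 : 0 < f by rewrite ltr0n fact_gt0.
exists (A * f / u ^+ q.+1); first by rewrite divr_ge0 ?mulr_ge0 ?exprn_ge0 // ltW.
move=> t t1; have t0 : 0 < t by lra.
have tdt : t <= t ^+ d by rewrite -[leLHS]expr1 ler_weXn2l // (leq_trans _ d2).
have uq : 0 < u ^+ q.+1 by rewrite exprn_gt0.
have tq : 0 < t ^+ q by rewrite exprn_gt0.
have h1 : expR (- (u * t ^+ d)) <= expR (- (u * t)) by rewrite ler_expR lerN2 ler_pM2l.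
have ut : 0 <= u * t by rewrite mulr_ge0 // ltW.
have h2 : (u * t) ^+ q.+1 / f <= expR (u * t).
  by have := expR_ge1Dxn q ut; rewrite -/f; lra.
have h3 : expR (- (u * t)) <= f / (u ^+ q.+1 * (t * t ^+ q)).
  rewrite expRN -[leRHS]invf_div lef_pV2 ?posrE ?expR_gt0 ?divr_gt0 ?mulr_gt0 //.
  by rewrite -exprS -exprMn.
apply: le_trans (ler_wpM2l (mulr_ge0 A0 (ltW tq)) (le_trans h1 h3)) _.
by apply: eq_ler; field; rewrite !gt_eqF.
Qed.

Definition bad (eps : R) (n : nat) : set (set 'rV[R]_d) :=
  [set T | zonotopes C (n%:R *: k) T /\
    (eps%:E < hausdorff_dist [set (n%:R^-1 : R) *: x | x in T] (limit_shape C a))%E].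

(** The total weight [Z] cancels in the ratio of the two bounds, so it is never estimated. The
    constant is [s = (1 + e) kappa], where [e] makes room for the padding generator. *)
Lemma concentration (eps : R) : 0 < eps -> exists s D, [/\ 0 < s, 0 <= D &
  \forall t \near +oo, forall n : nat, n%:R = s * t ^+ d.+1 ->
    (finite_card (bad eps n))%:R / (num_zonotopes C (n%:R *: k))%:R <= D / t :> R].
Proof.
have ar1 (u v w : R) : 8 * w <= v -> 1 + v <= u -> w * 4 <= 1 / 2 * u by lra.
have ar2 (u v w x y : R) : - (w * (y * v)) <= u - v * x -> v * (x - w * y) <= u by lra.
have ar3 (s u v w : R) : s = u + v -> v <= s / 2 -> u <= w -> s / 2 <= w by lra.
have ar4 (u v : R) : u <= v + 1 -> u + u + 1 <= 2 * v + 3 by lra.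
have ar5 (s u v w : R) : s / 2 <= u -> u <= v * w -> s <= 2 * v * w by lra.
have ar6 (u v w x y z f : R) : z * (x * (w + v * f)) * u <= y / 2 * u ->
  (1 + z) * x * w * u + (- (y * u) - x * (w - v * (z * f)) * u) <= - (y / 2 * u) by lra.
move=> eps0; have [c0 cP] := ac.
have [lp0 d0 kp] := And3 l_ge0 d_gt0 kap0.
have dp : 0 < 1 + d%:R :> R by lra.
(* [eta] and [del] make the two summands of the error in [hausdorff_le] at most [eps / 2] each. *)
pose eta := eps / (2 * ((1 + d%:R) * (l + 1))).
have eta_den : 0 < 2 * ((1 + d%:R) * (l + 1)) by rewrite !mulr_gt0 //; lra.
have eta0 : 0 < eta by rewrite divr_gt0.
have [m [th [xi [hxi xi0 xi_sum xi_conc]]]] := partition_exists C_cone ac eta0.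
pose Th := \sum_i nrm (th i).
have Th0 : 0 <= Th by apply: sumr_ge0 => i _; exact: nrm_ge0.
pose del := eps / (2 * (Th + 1)).
have del_den : 0 < 2 * (Th + 1) by rewrite mulr_gt0 //; lra.
have del0 : 0 < del by rewrite divr_gt0.
have err_le : (1 + d%:R) * eta * l + del * Th <= eps.
  have e1 : (1 + d%:R) * eta * l <= eps / 2.
    rewrite /eta (_ : _ * l = eps / 2 * (l / (l + 1))); last by field; rewrite !gt_eqF //; lra.
    rewrite ler_piMr ?divr_ge0 ?(ltW eps0) // ler_pdivrMr ?mul1r; lra.
  have e2 : del * Th <= eps / 2.
    rewrite /del (_ : _ * Th = eps / 2 * (Th / (Th + 1))); last by field; rewrite !gt_eqF //; lra.
    rewrite ler_piMr ?divr_ge0 ?(ltW eps0) // ler_pdivrMr ?mul1r; lra.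
  lra.
have mxi0 i : 0 <= mom C a (xi i) by apply: (mom_ge0 C_cone C0 ac kkP) => // x; exact: xi0.
have mxi i : mom C a (xi i) <= l.
  rewrite -mom_lin; apply: (mom_le C_cone C0 ac kkP) => //; first exact: dot_hl.
  move=> x Cx; rewrite -xi_sum // (bigD1 i) //= lerDl; apply: sumr_ge0 => j _.
  exact: xi0.
have dk0 : 0 < del * kap / 2 by rewrite divr_gt0 // mulr_gt0.
have [es es0 Hes] := far_family hxi dk0.
pose e1 := del / (2 * (l + 1)); pose Q := kap * (l + nrm a * r).
have nar : 0 <= nrm a * r by apply: mulr_ge0; [exact: nrm_ge0|exact: ltW].
have Q0 : 0 <= Q by apply: mulr_ge0; [exact: ltW|exact: addr_ge0].
(* The two bounds after 1: changing the normalization from [kap T] to [n] must cost at most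
   [del / 2], and the exponent lost by padding, [e Q t^d], at most half of [es t^d]. *)
pose e := Num.min 1 (Num.min e1 (es / (2 * (Q + 1)))).
have l1 : 0 < 2 * (l + 1) by rewrite mulr_gt0 //; lra.
have Q1 : 0 < 2 * (Q + 1) by rewrite mulr_gt0 //; lra.
have e0 : 0 < e by rewrite !lt_min ltr01 !divr_gt0.
have e1p : 0 < 1 + e by rewrite addr_gt0.
have el : e * l <= del / 2.
  have : e <= e1 by rewrite !ge_min lexx orbT.
  by rewrite /e1 ler_pdivlMr //; nra.
have eQ : e * Q <= es / 2.
  have : e <= es / (2 * (Q + 1)) by rewrite !ge_min lexx !orbT.
  by rewrite ler_pdivlMr //; nra.
(* Coordinates within [e' kap T] of those of [kap T k] give a distance of at most [e r kap T];
   divided by [e kap T], the missing vector is then within [r] of [k], hence in the cone. *)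
pose e' := e * r / d%:R.
have e'0 : 0 < e' by rewrite divr_gt0 // mulr_gt0.
have e'k : 0 < e' * kap by rewrite mulr_gt0.
have hco (j : 'I_d) : hl C (fun x => x 0 j) by exact: hl_coord.
have [ec ec0 Hec] := far_family hco e'k.
(* [A T] will bound the number [2 M + 1] of possible values of a coordinate of a typical
   endpoint. *)
pose A := 2 * (kap * (nrm k + e')) + 3.
have nke : 0 <= nrm k + e' by apply: addr_ge0; [exact: nrm_ge0|exact: ltW].
have A0 : 0 <= A.
  by apply: addr_ge0 => //; apply: mulr_ge0 => //; apply: mulr_ge0 => //; exact: ltW.
have es2 : 0 < es / 2 by rewrite divr_gt0.
have A8 : 0 <= 8 * m%:R * A ^+ d by rewrite mulr_ge0 ?exprn_ge0 // mulr_ge0.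
have [D D0 DP] := poly_exp_bound (d.+1 * d) es2 A8.
exists ((1 + e) * kap), D; split => //; first exact: mulr_gt0.
near=> t => n nE.
have t0 : 0 < t by near: t; apply: nbhs_pinfty_gt; exact: num_real.
have t1 : 1 <= t by near: t; apply: nbhs_pinfty_ge; exact: num_real.
have tec : (8 * d%:R) / ec <= t by near: t; apply: nbhs_pinfty_ge; exact: num_real.
have hes : forall V B, almost_all C a t V -> truncated a t V B ->
    \sum_(om : config V B |
        [exists i, del * kap / 2 * t ^+ d.+1 <= `|gsum (xi i) om -
          kap * mom C a (xi i) * t ^+ d.+1|])
      weight a t om
    <= m%:R * (4 * expR (- (es * t ^+ d))) * \sum_(om : config V B) weight a t om.
  by near: t; exact: Hes.
have hec : forall V B, almost_all C a t V -> truncated a t V B ->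
    \sum_(om : config V B |
        [exists j, e' * kap * t ^+ d.+1 <= `|gsum (fun x =>
          x 0 j) om - kap * mom C a (fun x => x 0 j) * t ^+ d.+1|])
      weight a t om
    <= d%:R * (4 * expR (- (ec * t ^+ d))) * \sum_(om : config V B) weight a t om.
  by near: t; exact: Hec.
set T := t ^+ d.+1 in nE hes hec.
have T0 : 0 < T by rewrite exprn_gt0.
have T1 : 1 <= T by rewrite exprn_ege1.
have Tt : T / t = t ^+ d by rewrite /T exprS mulrAC mulfV ?mul1r // gt_eqF.
have td0 : 0 < t ^+ d by rewrite exprn_gt0.
have tdt : t <= t ^+ d by rewrite -[leLHS]expr1 ler_weXn2l // (leq_trans _ d2).
pose K := k0 *+ n.
have KE : emb K = n%:R *: k by rewrite /K embMn.
have aK : dot a (emb K) = n%:R * l by rewrite KE dotZr.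
have n0 : 0 < n%:R :> R by rewrite nE; apply: mulr_gt0 => //; exact: mulr_gt0.
(* Size of a box containing every primitive vector that can occur in a zonotope with endpoint [K];
   it bounds the multiplicities too. *)
pose Mf := (Num.truncn (n%:R * l / c)).+1.
have MfP : n%:R * l / c <= Mf%:R by rewrite ltW // truncnS_gt.
have [F FP] := @bounded_lattice_fset d Mf.
have [V [aV VF]] := almost_all_exists C_cone C0 ac F t0.
have Vp : prims_in C V := aV.1.
have [B0 B0P] := @truncation_exists R V (fun p => dot a (emb (val p)) / t)
  (fun p => divr_gt0 (prim_dot_gt0 ac (Vp _ (valP p)).1 (Vp _ (valP p)).2) t0).
pose B := maxn B0 Mf.
have tV : truncated a t V B by apply: B0P; exact: leq_maxl.
have Vall p : primv p -> C (emb p) -> c * nrm (emb p : 'rV[R]_d) <= dot a (emb K) -> p \in V.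
  move=> pp Cp; rewrite aK => H; apply: VF => //; apply: FP => j.
  rewrite -(ler_nat R) natr_absz intr_norm; apply: le_trans MfP.
  have := coord_le_nrm (emb p : 'rV[R]_d) j; rewrite mxE => /le_trans; apply.
  by rewrite ler_pdivlMr // mulrC.
have KB : dot a (emb K) <= c * B%:R.
  rewrite aK [c * _]mulrC -ler_pdivrMr //; apply: le_trans MfP _.
  by rewrite ler_nat leq_maxr.
set Z := \sum_(om : config V B) weight a t om.
have W0 (om : config V B) : 0 < weight a t om by exact: expR_gt0.
have {}hes := hes _ _ aV tV; have {}hec := hec _ _ aV tV; rewrite -/Z in hes hec.
have Z0 : 0 < Z.
  rewrite /Z (bigD1 [ffun=> ord0]) //= ltr_pwDl //.
  by apply: sumr_ge0 => om _; exact: ltW.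
have zonK T' : zonotopes C (n%:R *: k) T' ->
    exists2 om : config V B, endpt om = K & T' = zon (gen om).
  by rewrite -KE; exact: (zonotopes_gen C_cone ac Vp Vall KB).
(* [finite_card] would be 0 on an infinite set, so finiteness comes before any lower bound on the
   number of zonotopes. *)
have fin_zon : finite_set (zonotopes C (n%:R *: k)).
  have H : zonotopes C (n%:R *: k) `<=` [set zon (gen om) | om in [set om : config V B |
    xpredT om]].
    by move=> T' /zonK[om _ ->]; exists om.
  exact: (finite_card_le_image H).1.
pose PB (om : config V B) := (endpt om == K) && [exists i, del * kap / 2 * T <=
  `|gsum (xi i) om - kap * mom C a (xi i) * T|].
have badPB : bad eps n `<=` [set zon (gen om) | om in [set om | PB om]].
  move=> T' [/zonK[om omK ->] Hd]; exists om => //=; rewrite /PB omK eqxx /=.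
  apply: contraPT Hd => /existsPn close; apply/negP; rewrite -leNgt.
  apply: (hausdorff_le C_cone C0 ac kkP (mom_lin a) eta0 hxi xi0 xi_sum xi_conc Vp n0 _ _ err_le).
    by rewrite -endpt_emb omK.
  move=> i; have := close i; rewrite -ltNge => Hi.
  (* As [n = (1 + e) kap T], the centre [kap T mom] becomes [n mom] at the cost of [e kap T mom]. *)
  have -> : gsum (xi i) om / n%:R - mom C a (xi i)
     = ((gsum (xi i) om - kap * mom C a (xi i) * T) - e * kap * T * mom C a (xi i)) / n%:R.
    by rewrite nE; field; rewrite !gt_eqF //; lra.
  rewrite normrM (gtr0_norm (_ : 0 < n%:R^-1)) ?invr_gt0 // ler_pdivrMr //.
  apply: le_trans (ler_normB _ _) _.
  have kT : 0 < kap * T by rewrite mulr_gt0.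
  have h1 : `|e * kap * T * mom C a (xi i)| <= del / 2 * (kap * T).
    rewrite ger0_norm; last first.
      by apply: mulr_ge0 => //; apply: mulr_ge0; [apply: mulr_ge0|]; exact: ltW.
    have h2 : e * mom C a (xi i) <= del / 2.
      by apply: le_trans el; rewrite ler_pM2l.
    by apply: le_trans (ler_wpM2r (ltW kT) h2); apply: eq_ler; ring.
  have h3 : del * (kap * T) <= del * n%:R.
    by rewrite ler_pM2l // nE -mulrA ler_peMl ?(ltW kT) // lerDl ltW.
  apply: le_trans (lerD (ltW Hi) h1) _; apply: le_trans h3.
  by apply: eq_ler; field.
have cardB := (finite_card_le_image badPB).2.
(* All members of [PB] have endpoint [K], hence the common weight [exp (- n l / t)], and together
   they weigh at most as much as the deviating configurations. *)
have upper : (finite_card (bad eps n))%:R * expR (- (n%:R * l / t))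
    <= m%:R * (4 * expR (- (es * t ^+ d))) * Z.
  apply: (@le_trans _ _ (#|PB|%:R * expR (- (n%:R * l / t)))).
    by rewrite ler_wpM2r ?expR_ge0 // ler_nat.
  apply: le_trans hes.
  apply: (@le_trans _ _ (\sum_(om | PB om) weight a t om)).
    rewrite -sum_pred_const; apply: ler_sum => om /andP[/eqP omK _].
    by rewrite /weight gsum_dot omK aK.
  rewrite [leLHS]big_mkcond [leRHS]big_mkcond /=; apply: ler_sum => om _.
  rewrite /PB; case: (_ == _) => /=; last by case: ifP => // _; exact: ltW.
  by [].
(* A configuration whose endpoint is near [kap T k] becomes a zonotope with endpoint
   [n k] once the generator [n k - endpt om], which lies in the cone, is added. *)
pose PG (om : config V B) := ~~ [exists j, e' * kap * T <=
  `|gsum (fun x => x 0 j) om - kap * mom C a (fun x => x 0 j) * T|].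
have PGP om j : PG om -> `|emb (endpt om) 0 j - kap * k 0 j * T| < e' * kap * T.
  by move=> /existsPn/(_ j); rewrite -ltNge mom_coord gsum_coord.
have PGn om : PG om -> nrm (emb (endpt om) - (kap * T) *: k) <= e * r * (kap * T).
  move=> G; have -> : e * r * (kap * T) = \sum_(j < d) e' * kap * T.
    rewrite sumr_const card_ord -[RHS]mulr_natl /e'; field; rewrite gt_eqF //.
  apply: ler_sum => j _; have := PGP _ j G => /ltW; apply: le_trans; apply: eq_ler.
  by congr (`|_|); rewrite !mxE; ring.
pose x0 := kap * T * (nrm k + e').
pose M := (Num.truncn x0).+1.
have kT0 : 0 < kap * T by rewrite mulr_gt0.
have x00 : 0 <= x0 by apply: mulr_ge0 => //; apply: mulr_ge0; exact: ltW.
have XM om j : PG om -> (`|endpt om 0%R j| <= M)%N.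
  move=> G; rewrite -(ler_nat R) natr_absz intr_norm.
  apply: (@le_trans _ _ x0); last by rewrite ltW // truncnS_gt.
  have := PGP _ j G; rewrite [emb _ _ _]mxE => H.
  have h1 : `|(endpt om 0 j)%:~R : R| <= `|(endpt om 0 j)%:~R -
    kap * k 0 j * T| + `|kap * k 0 j * T|.
    by apply: le_trans (ler_normD _ _); rewrite subrK.
  have h2 : `|kap * k 0 j * T| <= kap * T * nrm k.
    rewrite mulrAC normrM (gtr0_norm kT0).
    by apply: ler_wpM2l; [exact: ltW|exact: coord_le_nrm].
  apply: le_trans h1 (le_trans (lerD (ltW H) h2) _).
  by apply: eq_ler; rewrite /x0; ring.
pose yy (om : config V B) := K - endpt om.
have Cy om : PG om -> C (emb (yy om)).
  move=> G; have eT : 0 < e * (kap * T) by exact: mulr_gt0.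
  have -> : emb (yy om) = (e * (kap * T)) *: ((e * (kap * T))^-1 *: emb (yy om)) :> 'rV[R]_d.
    by rewrite scalerA mulfV ?scale1r // gt_eqF.
  apply: (cone_scale C_cone); first exact: ltW.
  apply: kr.
  have -> : (e * (kap * T))^-1 *: emb (yy om) - k
     = - ((e * (kap * T))^-1 *: (emb (endpt om) - (kap * T) *: k)).
    have EY : emb (yy om) = n%:R *: k - emb (endpt om).
      by apply/eqP; rewrite -subr_eq0 opprB addrA -KE; apply/eqP;
        apply/rowP => j; rewrite !mxE rmorphB /=; ring.
    rewrite EY -scalerN opprB; apply: (scalerI (lt0r_neq0 eT)).
    rewrite scalerBr [in LHS]scalerA [in RHS]scalerA mulfV ?lt0r_neq0 // !scale1r.
    rewrite addrAC -scalerBl; congr (_ *: _ - _).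
    by rewrite nE; ring.
  rewrite nrmN nrmZ gtr0_norm ?invr_gt0 // ler_pdivrMl //.
  by apply: le_trans (PGn _ G) _; apply: eq_ler; ring.
pose hh (om : config V B) := [ffun j : 'I_d =>
  inord `|(endpt om 0 j + M%:Z)%R|%N : 'I_(M + M).+1].
(* The padded zonotope and the endpoint recorded by [hh] determine the configuration: the endpoint
   gives the padding generator, and [padded_inj] recovers the rest. *)
have cardG : (#|PG| <= num_zonotopes C (n%:R *: k) * (M + M).+1 ^ d)%N.
  have -> : ((M + M).+1 ^ d = #|{: {ffun 'I_d -> 'I_(M + M).+1}}|)%N.
    by rewrite card_ffun !card_ord.
  apply: (@card_le_finite_card _ _ _ (fun om => zon (padded om (emb (yy om)))) hh) => //.
    move=> om G; rewrite -KE; apply: (padded_zonotopes C_cone Vp (Cy _ G)).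
    by rewrite /yy addrC subrK.
  move=> om om' G G' Ez /ffunP Eh.
  have EX : endpt om = endpt om'.
    apply/rowP => j; have := Eh j; rewrite !ffunE.
    exact: inord_shift_inj (XM _ j G) (XM _ j G').
  move: Ez; rewrite /yy EX; exact: (padded_inj C_cone C_pointed Vp).
(* The complement of [PG] carries at most half of [Z], and on [PG] the value of [dot a] at the
   endpoint is at least [kap T (l - nrm a e r)]. *)
have lower : Z / 2 <= #|PG|%:R * expR (- (kap * T * (l - nrm a * (e * r)) / t)).
  have small : d%:R * (4 * expR (- (ec * t ^+ d))) <= 1 / 2.
    have y0 : 8 * d%:R <= ec * t ^+ d.
      rewrite mulrC; apply: (@le_trans _ _ (t * ec)); first by rewrite -ler_pdivrMr.
      by rewrite mulrC ler_pM2l.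
    have h1 := expR_ge1Dx (ec * t ^+ d).
    rewrite expRN mulrA ler_pdivrMr ?expR_gt0 //.
    exact: ar1 y0 h1.
  have split_Z : Z = \sum_(om | PG om) weight a t om + \sum_(om | ~~ PG om) weight a t om.
    by rewrite /Z (bigID PG).
  have h1 : \sum_(om | ~~ PG om) weight a t om <= Z / 2.
    apply: (@le_trans _ _ (d%:R * (4 * expR (- (ec * t ^+ d))) * Z)).
      by apply: le_trans hec; apply: eq_ler; apply: eq_bigl => om; rewrite /PG negbK.
    by apply: le_trans (ler_wpM2r (ltW Z0) small) _; apply: eq_ler; rewrite mul1r mulrC.
  have h2 : \sum_(om | PG om) weight a t om <=
    #|PG|%:R * expR (- (kap * T * (l - nrm a * (e * r)) / t)).
    rewrite -sum_pred_const; apply: ler_sum => om G.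
    rewrite /weight ler_expR lerN2 ler_pM2r ?invr_gt0 // gsum_dot.
    have h3 := dot_le_nrm a (emb (endpt om) - (kap * T) *: k).
    rewrite dotBr dotZr in h3.
    have h4 := le_trans h3 (ler_wpM2l (nrm_ge0 a) (PGn _ G)).
    move: h4; rewrite ler_norml => /andP[h4 _].
    exact: ar2 h4.
  exact: ar3 split_Z h1 h2.
set N := num_zonotopes C (n%:R *: k) in cardG *.
set nb := finite_card (bad eps n) in upper *.
have boxE : ((M + M).+1 ^ d)%:R <= A ^+ d * t ^+ (d.+1 * d) :> R.
  rewrite natrX exprM -/T -exprMn lerXn2r ?nnegrE // ?mulr_ge0 ?(ltW T0) //.
  have h1 : M%:R <= x0 + 1 :> R by rewrite /M -natr1 lerD2r truncn_le.
  rewrite -natr1 natrD /A; apply: (@le_trans _ _ (2 * x0 + 3)); first exact: ar4.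
  rewrite [leRHS]mulrDl; apply: lerD; first by apply: eq_ler; rewrite /x0; ring.
  by rewrite ler_peMr.
have lower2 : Z <= 2 * (N%:R * (A ^+ d * t ^+ (d.+1 * d))) * expR (- (kap * T * (l -
  nrm a * (e * r)) / t)).
  have h1 : #|PG|%:R <= N%:R * (A ^+ d * t ^+ (d.+1 * d)) :> R.
    apply: (@le_trans _ _ ((N * (M + M).+1 ^ d)%N%:R)); first by rewrite ler_nat.
    by rewrite natrM ler_wpM2l.
  exact: ar5 lower (ler_wpM2r (expR_ge0 _) h1).
(* Positivity of [Z] in the lower bound excludes [N = 0], so the quotient is a true ratio and not a
   division by zero. *)
have N0 : 0 < N%:R :> R.
  rewrite ltr0n lt0n; apply/eqP => N0; move: lower2; rewrite N0 mul0r mulr0 mul0r.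
  by rewrite leNgt Z0.
rewrite ler_pdivrMr //; apply: le_trans (_ : _ <=
  8 * m%:R * A ^+ d * t ^+ (d.+1 * d) * expR (- (es / 2 * t ^+ d)) * N%:R) _; last first.
  by rewrite ler_wpM2r //; exact: DP.
(* The exponent on the left is [(e Q - es) t^d]: [Q] collects the padding loss [kap l] and the
   endpoint error [kap nrm a r]. *)
have expo : expR (n%:R * l / t) * (expR (- (es * t ^+ d)) * expR (- (kap * T * (l -
  nrm a * (e * r)) / t)))
   <= expR (- (es / 2 * t ^+ d)).
  rewrite -!expRD ler_expR.
  have -> : n%:R * l / t = (1 + e) * kap * l * t ^+ d by rewrite nE -Tt; ring.
  have -> : kap * T * (l - nrm a * (e * r)) / t =
    kap * (l - nrm a * (e * r)) * t ^+ d by rewrite -Tt; ring.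
  exact: ar6 (ler_wpM2r (ltW td0) eQ).
have up2 : nb%:R <= expR (n%:R * l / t) * (m%:R * (4 * expR (- (es * t ^+ d))) * Z).
  rewrite -(ler_pM2r (expR_gt0 (- (n%:R * l / t)))); apply: le_trans upper _.
  by apply: eq_ler; rewrite [RHS]mulrAC -expRD subrr expR0 mul1r.
apply: le_trans up2 _.
set E1 := expR (n%:R * l / t); set E2 := expR (- (es * t ^+ d)).
set E3 := expR (- (kap * T * (l - nrm a * (e * r)) / t)) in lower2 expo *.
have pos : 0 <= E1 * (m%:R * (4 * E2)) by rewrite !mulr_ge0 ?expR_ge0.
rewrite mulrA; apply: le_trans (ler_wpM2l pos lower2) _.
have pos2 : 0 <= 8 * m%:R * A ^+ d * t ^+ (d.+1 * d) * N%:R.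
  by rewrite !mulr_ge0 ?exprn_ge0 // ltW.
apply: le_trans (_ : _ <= 8 * m%:R * A ^+ d * t ^+ (d.+1 * d) * N%:R * (E1 * (E2 * E3))) _.
  by apply: eq_ler; ring.
by rewrite [leRHS]mulrAC ler_wpM2l.
Unshelve. all: by end_near. Qed.

End Concentration.

Theorem theorem1p1 (R : realType) (d : nat) (C : set 'rV[R]_d) (k : 'rV[R]_d)
    (hd : (2 <= d)%N)
    (C_closed : closed C) (C_cone : convex_cone C) (C_pointed : pointed C)
    (C_int : C° !=set0)
    (k_int : integral_vector k) (k_in : C° k) :
  exists T0 : set 'rV[R]_d,
    [/\ convex_set T0, T0 !=set0 &
      forall eps : R, 0 < eps ->
        (finite_card [set T | zonotopes C (n%:R *: k) T /\
            (eps%:E < hausdorff_dist [set (n%:R^-1 : R) *: x | x in T] T0)%E])%:R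
          / (num_zonotopes C (n%:R *: k))%:R @[n --> \oo] --> (0 : R)].
Proof.
have [k0 kE] := integral_emb k_int; rewrite {}kE in k_in *.
have [r r0 kr] := interior_nrm k_in.
have C0 : C 0.
  rewrite -(scale0r (emb k0)); apply: (cone_scale C_cone) => //.
  by apply: kr; rewrite subrr nrm0 ltW.
have [kk kkP] := kk_exists C_cone r0 kr.
have [a [c [ac amin]]] := minimizer_exists C_closed C_cone C_pointed C0 r0 kr kkP.
have mom_lin b : mom C a (dot b) = dot b (emb k0).
  apply: (mom_stationary C_cone C0 ac kkP b _ amin) => a' c' ac'.
  by have [] := exp_densP C_cone kkP ac'.
exists (limit_shape C a); split.
- exact: (limit_shape_convex C_cone C0 ac kkP).
- exact: limit_shape_nonempty ac.
move=> eps eps0.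
have [s [D [s0 D0 [M [_ MP]]]]] :=
  concentration hd C_cone C_pointed C0 r0 kr kkP ac mom_lin eps0.
apply/cvgrPdist_le => e e0.
(* [t > A] gives [t > 0], puts [t] in the range of the estimate, and makes [D / t] at most [e]. *)
pose A := Num.max (Num.max M 0) (D / e).
have A0 : 0 <= A by rewrite !le_max lexx orbT.
near=> n.
have nA : s * A ^+ d.+1 < n%:R by near: n; exact: nbhs_infty_gtr.
(* The real scale for which [n = s t^(d+1)] holds exactly, as [concentration] demands. *)
pose t := (n%:R / s) `^ (d.+1%:R^-1).
have ns0 : 0 <= n%:R / s by rewrite divr_ge0 // ltW.
have tE : t ^+ d.+1 = n%:R / s.
  by rewrite -powR_mulrn ?powR_ge0 // -powRrM mulVf ?pnatr_eq0 // powRr1.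
have tA : A < t.
  rewrite ltNge; apply/negP => tA; move: nA; apply/negP; rewrite -leNgt.
  by rewrite -ler_pdivrMl // mulrC -tE lerXn2r // nnegrE // powR_ge0.
have t0 : 0 < t by exact: le_lt_trans tA.
have tM : M < t by apply: le_lt_trans tA; rewrite !le_max lexx.
have := MP _ tM n; rewrite tE mulrCA mulfV ?gt_eqF // mulr1 => /(_ erefl) H.
rewrite sub0r normrN ger0_norm; last by rewrite divr_ge0.
apply: le_trans H _; rewrite ler_pdivrMr // mulrC -ler_pdivrMr //.
by apply: le_trans (ltW tA); rewrite le_max lexx orbT.
Unshelve. all: by end_near. Qed.
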